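(* Let $K$ be a non-Archimedean local field with residue field of cardinality $q$, let $n\ge1$, and let $L$ be the unramified extension of $K$ of degree $n$. (i) Let $\alpha>0$ and $\gamma=\alpha/n$. The expansion with respect to a canonical basis of $L$ over $K$ defines an isometric linear isomorphism $\iota$ between $L$ (with the norm $|\cdot|_L^{1/n}$) and $K^n$ (with the norm $\|\cdot\|$), and this isomorphism identifies the operator $D^\alpha_{K^n}$ with the operator $D^\gamma_L$. (ii) Let $0<\alpha<n$, $1\le p<\frac n\alpha$, and $\varphi\in L^p(K^n)$. Then $$ \left\|D^\alpha_{K^n,\varepsilon}(D^{-\alpha}_{K^n}\varphi)-\varphi\right\|_{L^p(K^n)}\longrightarrow 0\quad\text{as }\varepsilon=q^{-\nu}\to0 . $$ The kernel $R$ in the representation $$ \left(D^\alpha_{K^n,\varepsilon}(D^{-\alpha}_{K^n}\varphi)\right)(x)=c_{\alpha,n}d_{\alpha,n}\int_{K^n}R(\tau)\varphi(x-\sigma\tau)\,d\tau,\qquad \sigma\in K,\ |\sigma|_K=\varepsilon, $$ equals $$ R(\tau)=\begin{cases}1-\left(1-\dfrac1{q^n}\right)\dfrac1{1-q^{-\alpha n}}\,\|\tau\|^{\frac{\alpha}{n}-1}, & \text{if } \|\tau\|<1,\\ 0, & \text{if } \|\tau\|\ge1.\end{cases} $$ (iii) Let $\alpha=n$, and let $\varphi\in L^\infty_{\mathrm{loc}}(K^n)$ satisfy $\varphi(t)=O(\|t\|^{-\beta})$ as $t\to\infty$ for some $\beta>n$. Then $$ \left\|D^n_{K^n,\varepsilon}(D^{-n}_{K^n}\varphi)-\varphi\right\|_{L^1(K^n)}\longrightarrow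 0\quad\text{as }\varepsilon=q^{-\nu}\to0, $$ and the representation in (ii) holds with $\alpha=n$ and with the kernel (where $\tau$ is identified with an element of $L$) $$ R(\tau)=\begin{cases}\dfrac{\log q^n}{q^n-1}-\log|\tau|_L, & \text{if } |\tau|_L<1,\\ 0, & \text{if } |\tau|_L\ge1.\end{cases} $$
   Context: $K$ is a non-Archimedean local field with normalized absolute value $|\cdot|_K$ (a generator of the maximal ideal of the ring of integers $O=\{x\in K:|x|_K\le1\}$ has absolute value $q^{-1}$, where $q$ is the cardinality of the residue field). On $K^n$ put $\|x\|=\max_{1\le j\le n}|x_j|_K$, and let $dx=dx_1\cdots dx_n$ be the Haar measure giving the unit ball measure $1$. The unramified extension $L/K$ of degree $n$ is the extension of degree $n$ (unique up to isomorphism) whose residue field $\bar L$ is a separable extension of degree $n$ of the residue field $\bar K$ of $K$. A canonical basis of $L$ over $K$ consists of representatives of a basis of $\bar L$ over $\bar K$. $|\cdot|_L$ is the normalized absolute value of $L$ (whose residue field has cardinality $q^n$); if $x\in L$ has coordinates $x_1,\dots,x_n\in K$ in the canonical basis, then $|x|_L=(\max_j|x_j|_K)^n$. Haar measure on $L$ gives its ring of integers measure $1$. Operators: $$(D^\alpha_{K^n}v)(x)=c_{\alpha,n}\int_{K^n}\frac{v(z)-v(x)}{\|z-x\|^{n+\alpha}}\,dz,\qquad c_{\alpha,n}=\frac{1-q^\alpha}{1-q^{-\alpha-n}},$$ $$(D^\gamma_Lu)(x)=\frac{1-q^{n\gamma}}{1-q^{-n(\gamma+1)}}\int_L\frac{u(z)-u(x)}{|z-x|_L^{\gamma+1}}\,dz.$$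 The truncated operator $D^\alpha_{K^n,\varepsilon}$, $\varepsilon=q^{-\nu}$, $\nu\in\mathbb N$, is given by the formula for $D^\alpha_{K^n}$ with integration restricted to $\{z:\|z-x\|\ge\varepsilon\}$. The Riesz potential is $$(D^{-\alpha}_{K^n}\varphi)(x)=d_{\alpha,n}\int_{K^n}\|x-y\|^{\alpha-n}\varphi(y)\,dy,\qquad d_{\alpha,n}=\frac{1-q^{-\alpha}}{1-q^{\alpha-n}},\qquad 0<\alpha<n,$$ and, for $\alpha=n$, $$(D^{-n}_{K^n}\varphi)(x)=d_{n,n}\int_{K^n}\log\left(\|x-y\|^n\right)\varphi(y)\,dy,\qquad d_{n,n}=\frac{1-q^n}{q^n\log q^n}.$$
   Formalization: In (ii) the printed kernel is false for n ≥ 2; the formal statement uses R(τ) = 1 − (1 − q^{-n})/(1 − q^{-α}) ‖τ‖^{α−n} for ‖τ‖ < 1 (and 0 otherwise), which agrees with the printed formula when n = 1. *)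

(* Defs.v *)
From HB Require Import structures.
From mathcomp Require Import all_boot all_order all_algebra all_field.
From mathcomp Require Import all_classical all_reals all_analysis.
From mathcomp Require Import complex.

Set Implicit Arguments.
Unset Strict Implicit.
Unset Printing Implicit Defensive.

Import Order.TTheory GRing.Theory Num.Theory numFieldNormedType.Exports.

Local Open Scope classical_set_scope.
Local Open Scope complex_scope.
Local Open Scope ring_scope.

(* [res] exhibits [k] as the residue field O / m, where O = {|x| <= 1} and
   m = {|x| < 1}: it restricts to a surjective ring morphism O -> k with
   kernel m.  Its values outside O are irrelevant. *)
Record residue_map (R : realType) (K : fieldType) (abs : K -> R)
    (k : fieldType) (res : K -> k) : Prop := ResidueMap {
  residue1 : res 1 = 1;
  residueD : forall x y, abs x <= 1 -> abs y <= 1 ->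
    res (x + y) = res x + res y;
  residueM : forall x y, abs x <= 1 -> abs y <= 1 ->
    res (x * y) = res x * res y;
  residue_ker : forall x, abs x <= 1 -> (res x = 0 <-> abs x < 1);
  residue_surj : forall a, exists2 x, abs x <= 1 & res x = a }.

(* K is a non-Archimedean local field (complete with respect to a discrete
   valuation, with finite residue field k of cardinality q) and [abs] is its
   normalized absolute value. *)
Record local_field (R : realType) (K : fieldType) (abs : K -> R)
    (k : fieldType) (res : K -> k) (q : nat) : Prop := LocalField {
  absv_ge0 : forall x, 0 <= abs x;
  absv_eq0 : forall x, abs x = 0 <-> x = 0;
  absvM : forall x y, abs (x * y) = abs x * abs y;
  absv_ultra : forall x y, abs (x + y) <= Num.max (abs x) (abs y);
  absv_residue : residue_map abs res;
  card_residue : ([set: k] #= `I_q)%card;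
  absv_uniformizer : exists2 pi : K, abs pi = q%:R^-1 &
    forall x, abs x < 1 -> exists2 y, abs y <= 1 & x = pi * y;
  absv_complete : forall u : nat -> K,
    (forall e, 0 < e ->
       exists M, forall i j, (M <= i)%N -> (M <= j)%N -> abs (u i - u j) < e) ->
    exists l, forall e, 0 < e ->
      exists M, forall i, (M <= i)%N -> abs (u i - l) < e }.

(* [absL] is the normalized absolute value of a degree n extension L of K,
   whose residue field extension Lbar / Kbar is separable of degree n.  The
   clause [unram_res] says that O_K is mapped into O_L and that the structure
   map Kbar -> Lbar is the one induced by K -> L; in particular it forces
   [absL] to extend [absK] up to equivalence. *)
Record unramified_extension (R : realType)
    (K : fieldType) (absK : K -> R) (Kbar : fieldType) (resK : K -> Kbar)
    (L : fieldExtType K) (absL : L -> R)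
    (Lbar : fieldExtType Kbar) (resL : L -> Lbar) (q n : nat) : Prop :=
    UnramifiedExtension {
  unram_local : local_field absL resL (q ^ n);
  unram_deg : \dim {:L} = n;
  unram_res : forall a, absK a <= 1 ->
    absL a%:A <= 1 /\ resL a%:A = (resK a)%:A;
  unram_resdeg : \dim {:Lbar} = n;
  unram_sep : separable 1%VS {:Lbar} }.

Definition canonical_basis (R : realType) (K Kbar : fieldType)
    (L : fieldExtType K) (absL : L -> R) (Lbar : fieldExtType Kbar)
    (resL : L -> Lbar) (n : nat) (e : n.-tuple L) : Prop :=
  (forall i, absL (tnth e i) <= 1) /\ basis_of {:Lbar} (map resL e).

Definition coordinates (K : fieldType) (L : fieldExtType K) (n : nat)
    (e : n.-tuple L) (x : L) : 'rV[K]_n := \row_j coord e j x.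

Definition of_coordinates (K : fieldType) (L : fieldExtType K) (n : nat)
    (e : n.-tuple L) (t : 'rV[K]_n) : L := \sum_(j < n) t 0 j *: tnth e j.

Definition supnorm (R : realType) (K : fieldType) (abs : K -> R) (n : nat)
    (x : 'rV[K]_n) : R := \big[Num.max/0]_(j < n) abs (x 0 j).

Definition normopen (R : realType) (V : zmodType) (N : V -> R) : set (set V) :=
  [set U | forall x, U x ->
     exists2 r, 0 < r & forall y, N (y - x) < r -> U y].

(* V with the Borel sigma-algebra of the metric N (x - y). *)
Definition borel (R : realType) (V : zmodType) (N : V -> R) : Type :=
  g_sigma_algebraType (normopen N).

(* The Haar measure giving the unit ball measure 1. *)
Definition normalized_Haar (R : realType) (V : zmodType) (N : V -> R)
    (mu : {measure set (borel N) -> \bar R}) : Prop :=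
  (forall (a : V) (A : set (borel N)), measurable A ->
     mu ((fun x : V => x + a) @` A) = mu A) /\
  mu [set x | N x <= 1] = 1%:E.

Section ComplexValued.
Context (R : realType) (d : measure_display) (T : measurableType d).
Variable mu : {measure set T -> \bar R}.
Implicit Types (D : set T) (f : T -> R[i]).

Definition cmeasurable f : Prop :=
  measurable_fun setT (fun x => complex.Re (f x)) /\
  measurable_fun setT (fun x => complex.Im (f x)).

Definition cintegrable D f : Prop :=
  mu.-integrable D (fun x => (complex.Re (f x))%:E) /\
  mu.-integrable D (fun x => (complex.Im (f x))%:E).

Definition cintegral D f : R[i] :=
  (\int[mu]_(x in D) complex.Re (f x)) +i* (\int[mu]_(x in D) complex.Im (f x)).

Definition cLnorm (p : R) f : \bar R :=
  Lnorm mu p%:E (fun x => (ComplexField.Normc.normc (f x))%:E).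

Definition in_Lp (p : R) f : Prop := cmeasurable f /\ (cLnorm p f < +oo)%E.

End ComplexValued.

Section OperatorsOnKn.
Context (R : realType) (K : fieldType) (abs : K -> R) (q n : nat).
Local Notation Kn := 'rV[K]_n.
Local Notation N := (@supnorm R K abs n).
Variable mu : {measure set (borel N) -> \bar R}.
Implicit Types (a : R) (v phi : Kn -> R[i]) (x y z : Kn).

Definition c_coef a : R := (1 - q%:R `^ a) / (1 - q%:R `^ (- a - n%:R)).

(* At z = x the integrand is 0, whatever the value of the power. *)
Definition hypersing_integrand a v x z : R[i] :=
  (v z - v x) * (N (z - x) `^ (- (n%:R + a)))%:C.

Definition frac_Kn a v x : R[i] :=
  (c_coef a)%:C * cintegral mu setT (hypersing_integrand a v x).

Definition frac_Kn_trunc (eps : R) a v x : R[i] :=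
  (c_coef a)%:C *
  cintegral mu [set z | eps <= N (z - x)] (hypersing_integrand a v x).

Definition d_coef a : R := (1 - q%:R `^ (- a)) / (1 - q%:R `^ (a - n%:R)).

Definition riesz_integrand a phi x y : R[i] :=
  (N (x - y) `^ (a - n%:R))%:C * phi y.

(* The Riesz potential of order a, for 0 < a < n. *)
Definition riesz a phi x : R[i] :=
  (d_coef a)%:C * cintegral mu setT (riesz_integrand a phi x).

Definition d_coef_log : R :=
  (1 - q%:R ^+ n) / (q%:R ^+ n * ln (q%:R ^+ n)).

Definition riesz_log_integrand phi x y : R[i] :=
  (ln (N (x - y) ^+ n))%:C * phi y.

(* The Riesz potential of order n. *)
Definition riesz_log phi x : R[i] :=
  d_coef_log%:C * cintegral mu setT (riesz_log_integrand phi x).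

(* This is the kernel 1 - (1 - 1/Q) / (1 - Q^(-gamma)) |tau|_L^(gamma - 1) of
   the one-dimensional theory over L, where Q = q^n, gamma = a / n and
   |tau|_L = N(tau)^n; so Q^(-gamma) = q^(-a) and
   |tau|_L^(gamma - 1) = N(tau)^(a - n).  With q^(-(a n)) and
   N(tau)^(a / n - 1) in their place the representation fails for n >= 2. *)
Definition riesz_kernel a (tau : Kn) : R :=
  if N tau < 1 then
    1 - (1 - (q%:R ^+ n)^-1) / (1 - q%:R `^ (- a)) * N tau `^ (a - n%:R)
  else 0.

(* The family f_nu tends to phi in L^p(K^n). *)
Definition cvg_Lp (p : R) (f : nat -> Kn -> R[i]) phi : Prop :=
  (forall nu, in_Lp mu p (fun x => f nu x - phi x)) /\
  cLnorm mu p (fun x => f nu x - phi x) @[nu --> \oo] --> 0%E.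

(* f(x) = C * \int ker(tau) phi(x - sigma tau) dtau as locally integrable
   functions, i.e. for almost every x, whenever |sigma| = eps. *)
Definition kernel_representation (eps C : R) (ker : Kn -> R) f phi : Prop :=
  forall sigma : K, abs sigma = eps ->
  \forall x \ae mu,
    cintegrable mu setT (fun tau : Kn => (ker tau)%:C * phi (x - sigma *: tau))
    /\ f x = C%:C *
         cintegral mu setT (fun tau : Kn => (ker tau)%:C * phi (x - sigma *: tau)).

(* Compact subsets of K^n are the closed bounded ones. *)
Definition Linfty_loc phi : Prop :=
  cmeasurable (phi : borel N -> R[i]) /\
  forall r : R, exists M : R, \forall t \ae mu,
    N t <= r -> ComplexField.Normc.normc (phi t) <= M.

(* phi(t) = O(|t|^(- b)) as t -> oo *)
Definition bigO_at_infty (b : R) phi : Prop :=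
  exists C r : R, \forall t \ae mu,
    r <= N t -> ComplexField.Normc.normc (phi t) <= C * N t `^ (- b).

End OperatorsOnKn.

Section OperatorOnL.
Context (R : realType) (K : fieldType) (L : fieldExtType K) (absL : L -> R).
Context (q n : nat).
Variable muL : {measure set (borel absL) -> \bar R}.

Definition frac_L_integrand (g : R) (u : L -> R[i]) (x z : L) : R[i] :=
  (u z - u x) * (absL (z - x) `^ (- (g + 1)))%:C.

Definition frac_L (g : R) (u : L -> R[i]) (x : L) : R[i] :=
  ((1 - q%:R `^ (n%:R * g)) / (1 - q%:R `^ (- (n%:R * (g + 1)))))%:C *
  cintegral muL setT (frac_L_integrand g u x).

Definition riesz_log_kernel (t : L) : R :=
  if absL t < 1 then
    ln (q%:R ^+ n) / (q%:R ^+ n - 1) - ln (absL t)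
  else 0.

End OperatorOnL.

(* Main.v *)
Require Import Defs.
From HB Require Import structures.
From mathcomp Require Import all_boot all_order all_algebra all_field.
From mathcomp Require Import all_classical all_reals all_analysis measurable_realfun.
From mathcomp Require Import complex.
From mathcomp Require Import zify ring lra.

(** Let N be the sup norm of K^n. Up to a constant, both Riesz kernels are radial
    functions kap whose increments along the spheres N = q^i form a geometric
    progression. In the truncated operator applied to the potential of f, Fubini's
    theorem allows one to integrate first over z the function
      (kap (z - y) - kap (x - y)) N (z - x)^(- n - alpha),   N (z - x) >= eps.
    By the ultrametric inequality this is a difference of geometric series, which
    vanishes when N (x - y) >= eps. The outcome is the convolution of f with a
    nonnegative kernel of mass one supported in the ball of radius eps, and
    convergence in L^p follows from Jensen's inequality and the continuity of
    translations in L^p; for the latter, Borel sets are approximated, within a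
    ball, by sets invariant under a small ball of translations.
    Part (i) rests on |x|_L = N (coordinates of x)^n: the coordinates then map
    balls to balls, and transport one Haar measure to the other. *)

Set Implicit Arguments.
Unset Strict Implicit.
Unset Printing Implicit Defensive.

Import Order.TTheory GRing.Theory Num.Theory numFieldNormedType.Exports.

Local Open Scope classical_set_scope.
Local Open Scope complex_scope.
Local Open Scope ring_scope.

(** * Ultrametric norms, balls and Haar measure *)

(** The exchange of integrals cannot be read off the signed result: for N (x - y) >= eps the inner
    integral over z vanishes, but the integral of its absolute value is only bounded by a multiple
    of N (x - y)^(- n). Fubini's theorem therefore requires f to be integrable, for almost every x,
    against kap (x - .) and against this slowly decaying weight. The growth conditions on f serve
    this purpose: p < n / alpha says, for p > 1, that N^(alpha - n) lies at infinity in the dual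
    space of L^p, and beta > n leaves a margin that absorbs the logarithm. Write A = q^alpha and Q =
    q^n. Every integral is a telescoping sum over spheres, whose discrete primitive comes from
    summation by parts in terms of the values of kap and of its increments D (A / Q)^i. The power
    and the logarithm are the cases A < Q and A = Q of one computation. The mass of the resulting
    kernel does not depend on eps, and the constants of the two operators are exactly those that
    make it one. *)

Section SigmaFinite.
Context d (T : measurableType d) (R : realType) (mu : {measure set T -> \bar R}).
Hypothesis sf : sigma_finite [set: T] mu.
Let copy : set T -> \bar R := mu.
HB.instance Definition _ := Measure.on copy.
HB.instance Definition _ := Measure_isSigmaFinite.Build _ _ _ copy sf.

(** Fubini's and Tonelli's theorems take a measure bundled with its sigma-finiteness, while the Haar
    measure comes as a bare measure. The equality allows the former to be substituted for the
    latter. *)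
Lemma sigma_finite_measureP :
  exists nu : {sigma_finite_measure set T -> \bar R}, mu = nu.
Proof.
exists (copy : {sigma_finite_measure set T -> \bar R}).
exact: eq_measure.
Qed.

End SigmaFinite.

(** What is used of K^n as a metric group. The countable family of [un_dense] is needed to compare
    the Borel sets of the product with the product of the Borel sigma-algebras. *)
Record ultranorm (R : realType) (V : zmodType) (N : V -> R) (q : nat) : Prop :=
  Ultranorm {
  un_q : (1 < q)%N;
  un_ge0 : forall x, 0 <= N x;
  un_eq0 : forall x, N x = 0 <-> x = 0;
  un_opp : forall x, N (- x) = N x;
  un_ultra : forall x y, N (x + y) <= Num.max (N x) (N y);
  un_val : forall x, x <> 0 -> exists k : int, N x = q%:R ^ k;
  un_dense : exists c : nat -> V,
    forall (k : int) x, exists i, N (x - c i) <= q%:R ^ k }.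

Definition uball (R : realType) (V : zmodType) (N : V -> R) (q : nat)
  (k : int) (a : V) : set (borel N) := [set x : V | N (x - a) <= q%:R ^ k].

Definition ushell (R : realType) (V : zmodType) (N : V -> R) (q : nat)
  (k : int) : set (borel N) := [set x : V | N x = q%:R ^ k].

Definition uout (R : realType) (V : zmodType) (N : V -> R) (q : nat)
  (k : int) (a : V) : set (borel N) := [set x : V | q%:R ^ k <= N (x - a)].

Arguments uball {R V} N q k a.
Arguments uout {R V} N q k a.
Arguments ushell {R V} N q k.

Lemma subrACA (V : zmodType) (x y a b : V) :
  x - y - (a - b) = (x - a) - (y - b).
Proof. by rewrite !opprB [b - a]addrC addrACA [- y + b]addrC. Qed.

Lemma small_expz (R : realType) (q : nat) (r : R) : (1 < q)%N ->
  0 < r -> exists k : nat, q%:R ^ (- k%:Z) < r.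
Proof.
move=> q1 r0; have q0 : 0 < q%:R :> R by rewrite ltr0n ltnW.
have : (q%:R^-1 : R) ^+ k @[k --> \oo] --> (0 : R).
  by apply: cvg_expr; rewrite ger0_norm ?invf_lt1 ?ltr1n// invr_ge0 ltW.
move/cvgrPdist_lt => /(_ _ r0)[k _ /(_ k (leqnn k))] /=.
rewrite sub0r normrN ger0_norm; last by rewrite exprn_ge0// invr_ge0 ltW.
by move=> h; exists k; rewrite -invr_expz -exprVn.
Qed.

Lemma large_expz (R : realType) (q : nat) (r : R) : (1 < q)%N ->
  exists k : nat, r < q%:R ^ (k%:Z).
Proof.
move=> q1; have q0 : 0 < q%:R :> R by rewrite ltr0n ltnW.
have [r0|r0] := leP r 0; first by exists 0%N; rewrite (le_lt_trans r0).
have [k kr] : exists k : nat, q%:R ^ (- k%:Z) < r^-1.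
  by apply: small_expz; rewrite ?invr_gt0.
exists k; move: kr; rewrite -invr_expz ltf_pV2// posrE exprz_gt0//.
Qed.

Section Ultranorm.
Context (R : realType) (V : zmodType) (N : V -> R) (q : nat).
Hypothesis hN : ultranorm N q.
Local Notation T := (borel N).
Local Notation B := (uball N q).
Implicit Types (x y a : V) (k : int).

Lemma un0 : N 0 = 0. Proof. exact/(un_eq0 hN). Qed.

Lemma un_gt0 x : (0 < N x) = (x != 0).
Proof.
rewrite lt_neqAle (un_ge0 hN) andbT eq_sym; apply/idP/idP; apply: contraNN.
- by move=> /eqP ->; rewrite un0.
- by move=> /eqP /(un_eq0 hN) ->.
Qed.

Lemma un_sub x y : N (x - y) = N (y - x).
Proof. by rewrite -(un_opp hN) opprB. Qed.

Lemma un_le x y r : N x <= r -> N y <= r -> N (x + y) <= r.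
Proof. by move=> ? ?; rewrite (le_trans (un_ultra hN _ _))// ge_max; apply/andP. Qed.

Lemma un_leB x y r : N x <= r -> N y <= r -> N (x - y) <= r.
Proof. by move=> ? ?; apply: un_le => //; rewrite (un_opp hN). Qed.

Lemma un_domr x y : N x < N y -> N (x + y) = N y.
Proof.
move=> xy; apply/eqP; rewrite eq_le; apply/andP; split.
  by apply: un_le; rewrite ?lexx// ltW.
have := un_ultra hN (x + y) (- x); rewrite (un_opp hN) addrC addKr.
by rewrite le_max => /orP[//|]; rewrite leNgt xy.
Qed.

Lemma un_doml x y : N y < N x -> N (x + y) = N x.
Proof. by move=> yx; rewrite addrC un_domr. Qed.

Lemma q_gt0 : 0 < q%:R :> R.
Proof. by rewrite ltr0n (leq_trans _ (un_q hN)). Qed.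

Lemma q_gt1 : 1 < q%:R :> R. Proof. by rewrite ltr1n (un_q hN). Qed.

Lemma qX_gt0 k : 0 < q%:R ^ k :> R. Proof. by rewrite exprz_gt0// q_gt0. Qed.

Lemma qX_le (i j : int) : (q%:R ^ i <= q%:R ^ j :> R) = (i <= j).
Proof. by rewrite ler_eXz2l// q_gt1. Qed.

Lemma qX_lt (i j : int) : (q%:R ^ i < q%:R ^ j :> R) = (i < j).
Proof. by rewrite ltr_eXz2l// q_gt1. Qed.

Lemma qX_inj (i j : int) : q%:R ^ i = q%:R ^ j :> R -> i = j.
Proof. by move=> ij; apply/eqP; rewrite eq_le -!qX_le ij lexx. Qed.

Lemma small_qX (r : R) : 0 < r -> exists k : nat, q%:R ^ (- k%:Z) < r.
Proof. exact/small_expz/(un_q hN). Qed.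

Lemma large_qX (r : R) : exists k : nat, r < q%:R ^ (k%:Z).
Proof. exact/large_expz/(un_q hN). Qed.

Lemma normopen_measurable (U : set T) : normopen N U -> measurable U.
Proof. exact: sub_sigma_algebra. Qed.

Lemma uball_open k a : normopen N (B k a).
Proof.
move=> x /= xa; exists (q%:R ^ k); first exact: qX_gt0.
move=> y yx; rewrite /uball/=; have -> : y - a = (y - x) + (x - a) by rewrite addrA subrK.
by apply: un_le => //; exact: ltW.
Qed.

Lemma measurable_uball k a : measurable (B k a).
Proof. by apply: normopen_measurable; exact: uball_open. Qed.

Lemma uball_sub k a x : B k a x -> B k x = B k a.
Proof.
rewrite /uball /= => xa; apply/seteqP; split => y /= h; rewrite /=.
  by have -> : y - a = (y - x) + (x - a); [rewrite addrA subrK|exact: un_le].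
by have -> : y - x = (y - a) - (x - a); [rewrite opprB addrA subrK|exact: un_leB].
Qed.

Lemma uball_le (i j : int) a : i <= j -> B i a `<=` B j a.
Proof. by move=> ij x /= /le_trans; apply; rewrite qX_le. Qed.

Lemma measurable_set1_un a : measurable ([set a] : set T).
Proof.
have -> : [set a] = \bigcap_k B (- k%:Z) a :> set T.
  apply/seteqP; split => [x -> k _|x h]; rewrite /uball/=.
    by rewrite subrr un0 ltW// qX_gt0.
  apply/eqP; rewrite -subr_eq0; apply/negPn/negP; rewrite -un_gt0 => /small_qX[k].
  by rewrite ltNge => /negP; apply; exact: h.
by apply: bigcap_measurable => // k _; exact: measurable_uball.
Qed.

(** Away from 0 an ultrametric norm is locally constant, so the preimage of any set is open up to
    the point 0. *)
Lemma measurable_un : measurable_fun [set: T] N.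
Proof.
move=> _ Y mY; rewrite setTI.
have -> : N @^-1` Y =
    ((N @^-1` Y) `\ (0 : V)) `|` [set x | x = 0 /\ Y 0] :> set T.
  apply/seteqP; split => [x /= Yx|x /= [[]//|[->]]]; last by rewrite un0.
  have [x0|/eqP x0] := eqVneq x 0; [right|by left].
  by split => //; rewrite -un0 -x0.
apply: measurableU; last first.
  have [Y0|Y0] := pselect (Y 0).
    have -> : [set x | x = 0 /\ Y 0] = [set (0 : V)] by apply/seteqP; split => x/=; [case|].
    exact: measurable_set1_un.
  by have -> : [set x | x = 0 /\ Y 0] = set0 :> set V by apply/seteqP; split => x/= // [].
apply: normopen_measurable => x /= [Yx /eqP x0]; exists (N x); first by rewrite un_gt0.
move=> y yx; have e : N y = N x by rewrite -(un_domr yx) subrK.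
split; first by rewrite /= e.
by move=> y0; move: x0; rewrite -un_gt0 -e y0 un0 ltxx.
Qed.

Lemma measurable_fun_un d (X : measurableType d) (D : set X) (f : X -> T) :
  measurable_fun D f -> measurable_fun D (N \o f).
Proof. by move=> mf; apply: measurableT_comp mf; exact: measurable_un. Qed.

Lemma normopen_bigcup (c : nat -> V) (U : set T) :
  (forall (k : int) x, exists i, N (x - c i) <= q%:R ^ k) -> normopen N U ->
  U = \bigcup_k \bigcup_(i in [set i | B (- k%:Z) (c i) `<=` U]) B (- k%:Z) (c i).
Proof.
move=> hc oU; apply/seteqP; split => [x Ux|x [k _ [i /= iU] xi]]; last exact: iU.
have [r r0 xr] := oU _ Ux; have [k kr] := small_qX r0.
have [i xi] := hc (- k%:Z) x; exists k => //; exists i => //= y yi.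
apply: xr; apply: le_lt_trans kr; have : B (- k%:Z) x y by rewrite (uball_sub xi).
by [].
Qed.

(** The product sigma-algebra contains products of balls but not, by definition, the open sets of
    the product. By density the preimage of an open set is a countable union of products of balls of
    equal radius, and the difference of two such balls is again a ball. *)
Lemma measurable_sub_un :
  measurable_fun [set: T * T] (fun z : T * T => (z.1 : V) - (z.2 : V) : T).
Proof.
have [c hc] := un_dense hN.
refine (@measurability _ _ _ T _ _ (normopen N) erefl _) => _ [U oU <-].
rewrite setTI.
have -> : (fun z : T * T => (z.1 : V) - (z.2 : V) : T) @^-1` U =
   \bigcup_k \bigcup_i \bigcup_(j in [set j | B (- k%:Z) (c i - c j) `<=` U])
     (B (- k%:Z) (c i) `*` B (- k%:Z) (c j)).
  apply/seteqP; split => [[x y] /= Uxy|[x y] [k _ [i _ [j /= jU [/= xi yj]]]]].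
    have [r r0 xr] := oU _ Uxy; have [k kr] := small_qX r0.
    have [i xi] := hc (- k%:Z) x; have [j yj] := hc (- k%:Z) y.
    exists k => //; exists i => //; exists j => //= z zij.
    apply: xr; apply: le_lt_trans kr.
    have -> : z - (x - y) = z - (c i - c j) - ((x - c i) - (y - c j)).
      by rewrite -(subrACA (x : V)) [in RHS](opprB (x - y : V)) addrA subrK.
    by do 2 apply: un_leB => //.
  apply: jU; rewrite /uball/=.
  rewrite subrACA.
  exact: un_leB.
apply: bigcup_measurable => k _; apply: bigcup_measurable => i _.
apply: bigcup_measurable => j _; apply: measurableX; exact: measurable_uball.
Qed.

End Ultranorm.

Section UltraHaar.
Context (R : realType) (V : zmodType) (N : V -> R) (q : nat).
Hypothesis hN : ultranorm N q.
Local Notation T := (borel N).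
Local Notation B := (uball N q).
Implicit Types (x y a : V) (k : int).

(** Two balls are nested or disjoint, so the balls and the empty set form a pi-system; it generates
    the Borel sets because every open set is a countable union of balls. *)
Lemma uball_measure_unique (m1 m2 : {measure set T -> \bar R}) :
  (forall k a, m1 (B k a) = m2 (B k a)) ->
  (forall k a, (m1 (B k a) < +oo)%E) ->
  forall A, measurable A -> m1 A = m2 A.
Proof.
move=> m12 m1oo.
pose G : set (set T) := [set A | A = set0 \/ exists k a, A = B k a].
have mG A : G A -> measurable A.
  by move=> [->//|[k [a ->]]]; exact: measurable_uball.
apply: (measure_unique G (fun i : nat => B i%:Z 0)).
- apply/seteqP; split; last first.
    by apply: smallest_sub => //; exact: sigma_algebra_measurable.
  have [c hc] := un_dense hN.
  apply: smallest_sub; first exact: smallest_sigma_algebra.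
  move=> U oU; rewrite (normopen_bigcup hN hc oU).
  have sG := smallest_sigma_algebra setT G.
  apply: (sigma_algebra_bigcup (G := G)) => k.
  rewrite bigcup_mkcond; apply: (sigma_algebra_bigcup (G := G)) => i.
  case: ifPn => _; last exact: sigma_algebra0.
  by apply: sub_sigma_algebra; right; exists (- k%:Z), (c i).
- move=> A1 A2 [->|[k1 [a1 ->]]]; first by rewrite set0I; left.
  move=> [->|[k2 [a2 ->]]]; first by rewrite setI0; left.
  have [e|/set0P[x [x1 x2]]] := eqVneq (B k1 a1 `&` B k2 a2) set0; first by left.
  right; rewrite -(uball_sub hN x1) -(uball_sub hN x2).
  have [k12|k21] := leP k1 k2.
    by exists k1, x; apply/setIidl/(uball_le hN).
  by exists k2, x; apply/setIidr/(uball_le hN)/ltW.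
- by move=> i; right; exists i%:Z, 0.
- apply/seteqP; split => // x _; have [k xk] := large_qX hN (N x).
  by exists k => //; rewrite /uball/= subr0 ltW.
- by move=> A [->|[k [a ->]]]; rewrite ?measure0.
- by move=> k; exact: m1oo.
Qed.

Variables (n : nat) (mu : {measure set T -> \bar R}).
Hypothesis muB : forall k a, mu (B k a) = ((q%:R ^+ n) ^ k)%:E.

Lemma uhaar_sigma_finite : sigma_finite [set: T] mu.
Proof.
exists (fun i : nat => B i%:Z 0).
  apply/seteqP; split => // x _; have [k xk] := large_qX hN (N x).
  by exists k => //; rewrite /uball/= subr0 ltW.
by move=> i; split; [exact: measurable_uball|rewrite muB ltry].
Qed.

Lemma uball_measure_small a e : 0 < e -> (0 < n)%N ->
  exists j : nat, (mu (B (- j%:Z) a) < e%:E)%E.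
Proof.
move=> e0 n0; have [j je] := small_qX hN e0; exists j; rewrite muB lte_fin.
apply: le_lt_trans je; rewrite -!invr_expz lef_pV2 ?posrE; last 2 first.
- by rewrite exprz_gt0// exprn_gt0// (q_gt0 hN).
- exact: (qX_gt0 hN).
rewrite -!exprnP -exprM; apply: ler_weXn2l; last by rewrite leq_pmull.
by rewrite ltW// (q_gt1 hN).
Qed.

Lemma uhaar_set1 a : (0 < n)%N -> mu [set a] = 0%E.
Proof.
move=> n0; apply/eqP; rewrite eq_le measure_ge0 andbT; apply/lee_addgt0Pr => e e0.
rewrite add0e; have [j je] := uball_measure_small a e0 n0.
apply: le_trans (ltW je); apply: le_measure; rewrite ?inE.
- exact: (measurable_set1_un hN).
- exact: measurable_uball.
- by move=> x ->; rewrite /uball/= subrr (un0 hN) ltW// (qX_gt0 hN).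
Qed.

Section similarity.
Variables (phi psi : V -> V) (j : int).
Hypothesis phi_sim : forall x y, N (phi x - phi y) = q%:R ^ j * N (x - y).
Hypothesis phiK : cancel psi phi.

Lemma sim_uball k a : phi @^-1` (B k a) = B (k - j) (psi a).
Proof.
have e x : N (phi x - a) = q%:R ^ j * N (x - psi a) by rewrite -phi_sim phiK.
apply/seteqP; split => x; rewrite /uball/= e;
by rewrite mulrC -ler_pdivlMr ?(qX_gt0 hN)// invr_expz -expfzDr// lt0r_neq0// (q_gt0 hN).
Qed.

Lemma measurable_sim : measurable_fun [set: T] (phi : T -> T).
Proof.
refine (@measurability _ _ _ T _ _ (normopen N) erefl _) => _ [U oU <-].
rewrite setTI; apply: normopen_measurable => x /oU [r r0 xr].
exists (r / q%:R ^ j); first by rewrite divr_gt0// (qX_gt0 hN).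
by move=> y yx; apply: xr; rewrite phi_sim mulrC -ltr_pdivlMr// (qX_gt0 hN).
Qed.

(** Both sides are measures in [A], and they agree on balls because the preimage of a ball is a ball
    with radius divided by q^j. Translations and reflections are the case j = 0; t |-> x - sigma t
    is the case |sigma| = q^j. *)
Lemma sim_measure (A : set T) : measurable A ->
  mu (phi @^-1` A) = (((q%:R ^+ n) ^ (- j))%:E * mu A)%E.
Proof.
have c0 : 0 <= (q%:R ^+ n) ^ (- j) :> R.
  by rewrite exprz_ge0// exprn_ge0// ltW// (q_gt0 hN).
pose m1 := measure_function_pushforward__canonical__measure_function_Measure
  mu measurable_sim.
pose m2 : {measure set T -> \bar R} := mscale (NngNum c0) mu.
apply: (@uball_measure_unique m1 m2) => k a.
  rewrite /m1/= /pushforward sim_uball /m2/= /mscale/= !muB -EFinM.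
  rewrite -expfzDr 1?addrC// lt0r_neq0// exprn_gt0//; exact: (q_gt0 hN).
by rewrite /m1/= /pushforward sim_uball muB ltry.
Qed.

Lemma ge0_integral_sim (f : T -> \bar R) : measurable_fun [set: T] f ->
  (forall x, 0 <= f x)%E ->
  (\int[mu]_x f (phi x) = ((q%:R ^+ n) ^ (- j))%:E * \int[mu]_x f x)%E.
Proof.
move=> mf f0; have c0 : 0 <= (q%:R ^+ n) ^ (- j) :> R.
  by rewrite exprz_ge0// exprn_ge0// ltW// (q_gt0 hN).
have <- := ge0_integral_pushforward measurable_sim mu measurableT mf (fun x _ => f0 x).
pose m1 := measure_function_pushforward__canonical__measure_function_Measure
  mu measurable_sim.
pose m2 : {measure set T -> \bar R} := mscale (NngNum c0) mu.
rewrite (@eq_measure_integral _ _ _ _ m2 m1); first by rewrite ge0_integral_mscale.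
by move=> A mA _; exact: sim_measure.
Qed.

Lemma integrable_sim (f : T -> R) : measurable_fun [set: T] f ->
  mu.-integrable [set: T] (EFin \o f) <->
  mu.-integrable [set: T] (fun x => (f (phi x))%:E).
Proof.
move=> mf; have c0 : 0 < (q%:R ^+ n) ^ (- j) :> R.
  by rewrite exprz_gt0// exprn_gt0// (q_gt0 hN).
have mfphi : measurable_fun [set: T] (f \o phi).
  by apply: measurableT_comp => //; exact: measurable_sim.
have e : (\int[mu]_x `|(f (phi x))%:E| =
    ((q%:R ^+ n) ^ (- j))%:E * \int[mu]_x `|(f x)%:E|)%E.
  rewrite -(@ge0_integral_sim (fun x => `|(f x)%:E|%E))//.
  by apply: measurableT_comp => //; exact/measurable_EFinP.
split=> /integrableP [_ foo]; apply/integrableP; split.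
- exact/measurable_EFinP.
- by rewrite e lte_mul_pinfty// lee_fin ltW.
- exact/measurable_EFinP.
- move: foo; rewrite e => foo; rewrite ltey; apply/eqP => h.
  by move: foo; rewrite h gt0_muley ?lte_fin// ltxx.
Qed.

Lemma Rintegral_sim (f : T -> R) : measurable_fun [set: T] f ->
  mu.-integrable [set: T] (EFin \o f) ->
  \int[mu]_x f (phi x) = (q%:R ^+ n) ^ (- j) * \int[mu]_x f x.
Proof.
move=> mf fi; have c0 : 0 <= (q%:R ^+ n) ^ (- j) :> R.
  by rewrite exprz_ge0// exprn_ge0// ltW// (q_gt0 hN).
have fi2 := (integrable_sim mf).1 fi.
rewrite /Rintegral [in LHS]integralE [in RHS]integralE.
have -> : (\int[mu]_x (fun x => (f (phi x))%:E)^\+ x =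
  \int[mu]_x (EFin \o f)^\+ (phi x))%E by apply: eq_integral => x _; rewrite ?funeposE ?funenegE.
have -> : (\int[mu]_x (fun x => (f (phi x))%:E)^\- x =
  \int[mu]_x (EFin \o f)^\- (phi x))%E by apply: eq_integral => x _; rewrite ?funeposE ?funenegE.
have mEf : measurable_fun [set: T] (EFin \o f) by exact/measurable_EFinP.
rewrite ge0_integral_sim//; last exact: measurable_funepos.
rewrite ge0_integral_sim//; last exact: measurable_funeneg.
have := integrable_pos_fin_num measurableT fi.
have := integrable_neg_fin_num measurableT fi.
set a := (\int[mu]_x _)%E; set b := (\int[mu]_x _)%E => a1 b1.
by rewrite -(fineK a1) -(fineK b1) -!EFinM -!EFinB /= mulrBr.
Qed.

End similarity.

End UltraHaar.

(** * Local fields and the unramified extension *)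

Section LocalField.
Context (R : realType) (K k : fieldType) (abs : K -> R) (res : K -> k) (q : nat).
Hypothesis hK : local_field abs res q.
Implicit Types x y : K.

Lemma abs0 : abs 0 = 0. Proof. exact/(absv_eq0 hK). Qed.

Lemma abs_gt0 x : (0 < abs x) = (x != 0).
Proof.
rewrite lt_neqAle (absv_ge0 hK) andbT eq_sym; apply/idP/idP; apply: contraNN.
- by move=> /eqP ->; rewrite abs0.
- by move=> /eqP /(absv_eq0 hK) ->.
Qed.

Lemma abs1 : abs 1 = 1.
Proof.
have a0 : abs 1 != 0 by rewrite gt_eqF// abs_gt0 oner_neq0.
by apply: (mulfI a0); rewrite -(absvM hK) !mulr1.
Qed.

Lemma absN1 : abs (- 1) = 1.
Proof.
apply/eqP; rewrite -(@eqrXn2 _ 2)// ?(absv_ge0 hK)// expr1n.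
by rewrite expr2 -(absvM hK) mulrNN mulr1 abs1.
Qed.

Lemma absN x : abs (- x) = abs x.
Proof. by rewrite -mulN1r (absvM hK) absN1 mul1r. Qed.

Lemma absV x : abs x^-1 = (abs x)^-1.
Proof.
have [->|x0] := eqVneq x 0; first by rewrite invr0 abs0 invr0.
have a0 : abs x != 0 by rewrite gt_eqF// abs_gt0.
by apply: (mulfI a0); rewrite -(absvM hK) !divff// abs1.
Qed.

Lemma absXz x (j : int) : abs (x ^ j) = abs x ^ j.
Proof.
have h (m : nat) : abs (x ^+ m) = abs x ^+ m.
  by elim: m => [|m ih]; rewrite ?expr0 ?abs1// !exprS (absvM hK) ih.
by case: j => m; rewrite ?NegzE -?invr_expz ?absV h.
Qed.

Lemma abs_le x y r : abs x <= r -> abs y <= r -> abs (x + y) <= r.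
Proof. by move=> ? ?; rewrite (le_trans (absv_ultra hK _ _))// ge_max; apply/andP. Qed.

Lemma resN1 x : abs x <= 1 -> res (- x) = - res x.
Proof.
move=> x1; apply/eqP; rewrite -addr_eq0 -(residueD (absv_residue hK)) ?absN// addNr.
by apply/eqP/(residue_ker (absv_residue hK)); rewrite ?abs0.
Qed.

Lemma res_eq x y : abs x <= 1 -> abs y <= 1 -> res x = res y <-> abs (x - y) < 1.
Proof.
move=> x1 y1; have xy1 : abs (x - y) <= 1 by apply: abs_le; rewrite ?absN.
rewrite -(residue_ker (absv_residue hK) xy1).
rewrite (residueD (absv_residue hK)) ?absN// resN1//.
by split=> [->|/eqP]; rewrite ?subrr// subr_eq0 => /eqP.
Qed.

Lemma residue_enum : exists f : k -> nat, set_bij [set: k] `I_q f.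
Proof. by have := card_residue hK; move=> /(@card_set_bijP k nat). Qed.

Lemma residue_gt1 : (1 < q)%N.
Proof.
have [f [fq fi _]] := residue_enum.
have f0 : (f 0%R < q)%N by apply: fq.
have f1 : (f 1%R < q)%N by apply: fq.
rewrite ltnNge; apply/negP => q1.
have /eqP := oner_neq0 k; apply; apply: fi; rewrite ?inE//.
by move: f0 f1 q1; case: (q) => [|[|//]]// + + _; rewrite !ltnS !leqn0 => /eqP -> /eqP ->.
Qed.

Let q0 : 0 < q%:R :> R. Proof. by rewrite ltr0n ltnW// residue_gt1. Qed.

(** Division by the uniformizer multiplies the absolute value by q, so an element of absolute value
    in ]q^(-m), 1] reaches absolute value 1 in fewer than m + 1 divisions. Elements outside the unit
    ball are inverted. *)
Lemma abs_val x : x != 0 -> exists j : int, abs x = q%:R ^ j.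
Proof.
have [p hp hpi] := absv_uniformizer hK.
have small (m : nat) : forall x, x != 0 -> abs x <= 1 -> q%:R ^ (- m%:Z) < abs x ->
    exists j : int, abs x = q%:R ^ j.
  elim: m => [|m ih] {}x x0 x1; first by rewrite oppr0 expr0z ltNge x1.
  move=> mx; have [e|n1] := eqVneq (abs x) 1; first by exists 0.
  have xlt1 : abs x < 1 by rewrite lt_neqAle n1 x1.
  have [y y1 e] := hpi x xlt1.
  have y0 : y != 0 by apply: contra_neq x0; rewrite e => ->; rewrite mulr0.
  have ey : abs x = q%:R^-1 * abs y by rewrite e (absvM hK) hp.
  have [j jy] : exists j : int, abs y = q%:R ^ j.
    apply: ih => //; move: mx; rewrite ey -ltr_pdivrMl ?invr_gt0// invrK.
    rewrite -[X in X * _]expr1z -expfzDr ?gt_eqF//.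
    by have -> : 1 - m.+1%:Z = - m%:Z by lia.
  exists (j - 1); rewrite ey jy mulrC -[X in _ * X]exprN1 -expfzDr ?gt_eqF//.
move=> x0; have [x1|x1] := leP (abs x) 1.
  have [m mx] : exists m : nat, q%:R ^ (- m%:Z) < abs x.
    by apply: small_expz; rewrite ?residue_gt1// abs_gt0.
  exact: small mx.
have x'1 : abs x^-1 <= 1 by rewrite absV invf_le1 ?ltW// abs_gt0.
have [m mx] : exists m : nat, q%:R ^ (- m%:Z) < abs x^-1.
  by apply: small_expz; rewrite ?residue_gt1// abs_gt0 invr_eq0.
have x'0 : x^-1 != 0 by rewrite invr_eq0.
have [j jx] := small m _ x'0 x'1 mx.
by exists (- j); rewrite -invr_expz -jx absV invrK.
Qed.

Lemma abs_surj (j : int) : exists2 x, x != 0 & abs x = q%:R ^ j.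
Proof.
have [p hp _] := absv_uniformizer hK.
have e : abs (p ^ (- j)) = q%:R ^ j.
  by rewrite absXz hp exprz_inv opprK.
by exists (p ^ (- j)) => //; rewrite -abs_gt0 e exprz_gt0.
Qed.

Lemma abs_lt1 x : (abs x < 1) = (abs x <= q%:R ^ (- 1)).
Proof.
have [->|x0] := eqVneq x 0; first by rewrite abs0 ltr01 exprz_ge0// ltW.
have [j ->] := abs_val x0; have q1 : 1 < q%:R :> R by rewrite ltr1n residue_gt1.
by rewrite -[X in _ < X](expr0z (q%:R : R)) ltr_eXz2l// ler_eXz2l//; lia.
Qed.

(** One representative for each residue class, numbered by a bijection of the residue field with
    [I_q]. Being congruent modulo the maximal ideal means being at distance at most 1 / q, since
    absolute values are powers of q. *)
Lemma residue_reps : exists g : nat -> K, (forall i, abs (g i) <= 1) /\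
  forall x, abs x <= 1 -> exists2 i, (i < q)%N &
    forall j, (j < q)%N -> abs (x - g j) <= q%:R ^ (- 1) <-> j = i.
Proof.
have [f [fq fi fs]] := residue_enum.
have /choice[g hg] : forall i, exists x, abs x <= 1 /\ ((i < q)%N -> f (res x) = i).
  move=> i; have [/fs[a _ ai]|iq] := pselect ((i < q)%N).
    by have [x x1 xa] := residue_surj (absv_residue hK) a; exists x; rewrite xa.
  by exists 0; rewrite abs0 ler01.
exists g; split=> [i|x x1]; first by have [] := hg i.
exists (f (res x)) => [|j jq]; first exact: fq.
have [gj rj] := hg j; rewrite -abs_lt1 -res_eq//; split=> [->|jx]; first by rewrite rj.
by apply: fi; rewrite ?inE// rj.
Qed.

End LocalField.

Section Supnorm.
Context (R : realType) (K k : fieldType) (abs : K -> R) (res : K -> k) (q n : nat).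
Hypothesis hK : local_field abs res q.
Local Notation V := 'rV[K]_n.
Local Notation N := (@supnorm R K abs n).
Implicit Types x y : V.

Lemma supnorm_leP r x : 0 <= r -> N x <= r <-> forall j, abs (x 0 j) <= r.
Proof.
move=> r0; rewrite /supnorm; split=> [/bigmax_leP[_ h] j|h]; first exact: h.
by apply/bigmax_leP; split.
Qed.

Lemma supnorm_ge0 x : 0 <= N x.
Proof. exact: bigmax_ge_id. Qed.

Lemma supnorm_ge x j : abs (x 0 j) <= N x.
Proof. exact: ((supnorm_leP x (supnorm_ge0 x)).1 (lexx _) j). Qed.

Lemma supnorm_scale (a : K) x : N (a *: x) = abs a * N x.
Proof.
have [->|a0] := eqVneq a 0.
  rewrite scale0r (abs0 hK) mul0r; apply/eqP; rewrite eq_le supnorm_ge0 andbT.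
  by apply/supnorm_leP => // j; rewrite mxE (abs0 hK).
have aa : 0 < abs a by rewrite (abs_gt0 hK).
apply/eqP; rewrite eq_le; apply/andP; split.
  apply/supnorm_leP => [|j]; first by rewrite mulr_ge0 ?supnorm_ge0// ltW.
  by rewrite mxE (absvM hK) ler_wpM2l ?supnorm_ge// ltW.
rewrite -ler_pdivlMl//; apply/supnorm_leP => [|j].
  by rewrite mulr_ge0 ?supnorm_ge0// invr_ge0 ltW.
rewrite ler_pdivlMl// -(absvM hK); apply: le_trans (supnorm_ge _ j).
by rewrite mxE.
Qed.

Lemma supnorm_eq0 x : N x = 0 <-> x = 0.
Proof.
split=> [x0|->]; last first.
  by rewrite -(scale0r 0) supnorm_scale (abs0 hK) mul0r.
apply/rowP => j; rewrite mxE; apply/(absv_eq0 hK)/eqP.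
by rewrite eq_le (absv_ge0 hK) andbT -x0 supnorm_ge.
Qed.

Lemma supnorm_opp x : N (- x) = N x.
Proof. by rewrite -scaleN1r supnorm_scale (absN1 hK) mul1r. Qed.

Lemma supnorm_ultra x y : N (x + y) <= Num.max (N x) (N y).
Proof.
apply/supnorm_leP => [|j]; first by rewrite le_max supnorm_ge0.
rewrite mxE (le_trans (absv_ultra hK _ _))// ge_max !le_max !supnorm_ge ?orbT//.
Qed.

Lemma supnorm_arg x : x <> 0 -> exists j, N x = abs (x 0 j).
Proof.
move=> /eqP x0; have : N x != 0 by apply: contra_neq x0 => /supnorm_eq0.
rewrite /supnorm; elim/big_ind : _ => [/eqP//|a b|j _ _]; last by exists j.
by rewrite /Num.max; case: ifP.
Qed.

Lemma supnorm_val x : x <> 0 -> exists j : int, N x = q%:R ^ j.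
Proof.
move=> x0; have [j e] := supnorm_arg x0; rewrite e.
apply: (abs_val hK); rewrite -(abs_gt0 hK) -e lt_neqAle supnorm_ge0 andbT eq_sym.
by apply/eqP => /supnorm_eq0.
Qed.

(** Coset representatives of the unit ball modulo the ball of radius 1 / q. The index type has q^n
    elements, which becomes the ratio of the Haar measures of the two balls. *)
Lemma supnorm_reps : exists r : {ffun 'I_n -> 'I_q} -> V,
  (forall F, N (r F) <= 1) /\
  forall x, N x <= 1 -> exists F, forall G, N (x - r G) <= q%:R ^ (- 1) <-> G = F.
Proof.
have [g [g1 hg]] := residue_reps hK.
have q0 : 0 <= q%:R ^ (- 1) :> R by rewrite exprz_ge0.
exists (fun F : {ffun 'I_n -> 'I_q} => \row_j g (F j)); split=> [F|x /supnorm_leP x1].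
  by apply/supnorm_leP => // j; rewrite mxE.
have /choice[F hF] : forall j, exists i : 'I_q, forall i' : 'I_q,
    abs (x 0 j - g i') <= q%:R ^ (- 1) <-> i' = i.
  move=> j; have [i iq hi] := hg _ (x1 ler01 j); exists (Ordinal iq) => i'.
  by rewrite hi//; split=> [e|->//]; apply: val_inj.
exists [ffun j => F j] => G; split=> [/supnorm_leP h|->].
  by apply/ffunP => j; rewrite ffunE; apply/hF; move: (h q0 j); rewrite !mxE.
by apply/supnorm_leP => // j; rewrite !mxE ffunE; apply/hF.
Qed.

Lemma supnorm_reps_scaled (m : int) : exists r : {ffun 'I_n -> 'I_q} -> V,
  (forall F, N (r F) <= q%:R ^ m) /\ forall x, N x <= q%:R ^ m ->
    exists F, forall G, N (x - r G) <= q%:R ^ (m - 1) <-> G = F.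
Proof.
have [r [r1 hr]] := supnorm_reps; have [p p0 hp] := abs_surj hK m.
have q0 : 0 < q%:R :> R by rewrite ltr0n ltnW// (residue_gt1 hK).
have qm : 0 < q%:R ^ m :> R by rewrite exprz_gt0.
exists (fun F : {ffun 'I_n -> 'I_q} => p *: r F); split=> [F|x xm].
  by rewrite supnorm_scale hp ler_piMr// ltW.
have [|F hF] := hr (p^-1 *: x).
  by rewrite supnorm_scale (absV hK) hp ler_pdivrMl// mulr1.
exists F => G; rewrite -hF.
have -> : x - p *: r G = p *: (p^-1 *: x - r G).
  by rewrite scalerBr scalerA divff// scale1r.
by rewrite supnorm_scale hp expfzDr ?gt_eqF// ler_pM2l.
Qed.

Lemma supnorm_cover (m : nat) (j : int) : exists s : seq V, forall x,
  N x <= q%:R ^ j -> exists2 c, c \in s & N (x - c) <= q%:R ^ (j - m%:Z).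
Proof.
elim: m j => [|m ih] j.
  by exists [:: 0] => x xj; exists 0; rewrite ?inE// !subr0.
have [r [_ hr]] := supnorm_reps_scaled j; have [s hs] := ih (j - 1).
exists [seq r F + c | F <- enum {ffun 'I_n -> 'I_q}, c <- s] => x xj.
have [F hF] := hr _ xj; have [c cs xc] := hs _ ((hF F).2 erefl).
exists (r F + c); first by apply/allpairsP; exists (F, c); rewrite mem_enum.
by rewrite opprD addrA; have -> : j - m.+1%:Z = j - 1 - m%:Z by lia.
Qed.

(** The finite covers of all balls at all scales have countably many centres altogether; they are
    enumerated by [pickle]. *)
Lemma supnorm_dense : exists c : nat -> V,
  forall (j : int) x, exists i, N (x - c i) <= q%:R ^ j.
Proof.
have /choice[s hs] : forall mj : nat * int, exists s : seq V, forall x,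
    N x <= q%:R ^ mj.2 ->
    exists2 c, c \in s & N (x - c) <= q%:R ^ (mj.2 - mj.1%:Z).
  by move=> [m j]; exact: supnorm_cover.
exists (fun i => if (unpickle i : option (nat * int * nat)) is Some (mj, l)
  then nth 0 (s mj) l else 0) => j x.
have [m xm] := large_expz (N x) (residue_gt1 hK).
have q1 : 1 < q%:R :> R by rewrite ltr1n (residue_gt1 hK).
(* The cover of the ball of radius q^m at depth |m - j| has mesh q^(m - |m - j|), which is at most
   q^j. *)
pose mj := ((`|m%:Z - j|)%N, m%:Z).
have [c cs xc] := hs mj x (ltW xm).
exists (pickle (mj, index c (s mj))); rewrite pickleK nth_index//.
by apply: le_trans xc _; rewrite ler_eXz2l//=; lia.
Qed.

Lemma supnorm_ultranorm : ultranorm N q.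
Proof.
split.
- exact: residue_gt1 hK.
- exact: supnorm_ge0.
- exact: supnorm_eq0.
- exact: supnorm_opp.
- exact: supnorm_ultra.
- exact: supnorm_val.
- exact: supnorm_dense.
Qed.

Let hN := supnorm_ultranorm.

Variable mu : {measure set (borel N) -> \bar R}.
Hypothesis haar : normalized_Haar mu.

Lemma haar_uball_center j a : mu (uball N q j a) = mu (uball N q j 0).
Proof.
rewrite -[RHS](haar.1 a); last exact: measurable_uball.
congr (mu _); apply/seteqP; split => [x xa|_ [x x0 <-]].
  by exists (x - a); rewrite ?subrK//= /uball/= subr0.
by move: x0; rewrite /uball/= subr0 addrK.
Qed.

(** A ball is the disjoint union of q^n translates of the ball with radius divided by q. Run upwards
    and downwards from the unit ball, this recursion determines the measure of every ball. *)
Lemma haar_uball_rec j :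
  mu (uball N q j 0) = ((q%:R ^+ n)%:E * mu (uball N q (j - 1) 0))%E.
Proof.
have [r [r1 hr]] := supnorm_reps_scaled j.
have -> : uball N q j 0 = \bigcup_(F in [set: {ffun 'I_n -> 'I_q}]) uball N q (j - 1) (r F).
  apply/seteqP; split => [x|x [F _]]; rewrite /uball/= ?subr0.
    by move=> /hr[F hF]; exists F => //; apply/hF.
  move=> h; rewrite -(subrK (r F) x); apply: (un_le hN) => //.
  by apply: le_trans h _; rewrite (qX_le hN); lia.
rewrite measure_fin_bigcup; last 3 first.
- exact: finite_finset.
- apply/trivIsetP => F G _ _ FG; apply/seteqP; split=> // x [/= xF xG].
  have : N x <= q%:R ^ j.
    rewrite -(subrK (r F) x); apply: (un_le hN) => //.
    by apply: le_trans xF _; rewrite (qX_le hN); lia.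
  by move=> /hr[H hH]; move: FG; rewrite ((hH F).1 xF) ((hH G).1 xG) eqxx.
- by move=> F _; exact: measurable_uball.
have -> : [set: {ffun 'I_n -> 'I_q}] = [set` enum {ffun 'I_n -> 'I_q}].
  by apply/seteqP; split=> // F _; rewrite /= mem_enum.
rewrite -fsbig_seq ?enum_uniq// (eq_bigr (fun=> mu (uball N q (j - 1) 0))); last first.
  by move=> F _; exact: haar_uball_center.
rewrite big_const_seq count_predT -cardE card_ffun !card_ord -natrX.
elim: (q ^ n)%N => [|m ih]; first by rewrite mul0e.
by rewrite iterS ih -natr1 EFinD ge0_muleDl ?lee_fin// mul1e addeC.
Qed.

Lemma haar_uball j a : mu (uball N q j a) = ((q%:R ^+ n) ^ j)%:E.
Proof.
rewrite haar_uball_center.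
have Q0 : 0 < q%:R ^+ n :> R by rewrite exprn_gt0// (q_gt0 hN).
have m0 : mu (uball N q 0 0) = 1%E.
  rewrite -haar.2; congr (mu _); apply/seteqP.
  by split=> x; rewrite /uball/= subr0 expr0z.
have up (m : nat) : mu (uball N q m%:Z 0) = ((q%:R ^+ n) ^ m%:Z)%:E.
  elim: m => [|m ih]; first by rewrite m0 expr0z.
  rewrite haar_uball_rec; have -> : m.+1%:Z - 1 = m%:Z by lia.
  by rewrite ih -EFinM -!exprnP exprS.
have down (m : nat) : mu (uball N q (- m%:Z) 0) = ((q%:R ^+ n) ^ (- m%:Z))%:E.
  elim: m => [|m ih]; first by rewrite oppr0 m0 expr0z.
  move: ih; rewrite haar_uball_rec.
  have -> : - m%:Z - 1 = - m.+1%:Z by lia.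
  move=> e; have -> : (q%:R ^+ n) ^ (- m.+1%:Z) = (q%:R ^+ n)^-1 * (q%:R ^+ n) ^ (- m%:Z) :> R.
    rewrite -[X in X * _]exprN1 -expfzDr ?gt_eqF//; congr (_ ^ _); lia.
  by rewrite EFinM -e muleA -EFinM mulVf ?gt_eqF// mul1e.
by case: (intP j) => [|m|m]; rewrite ?NegzE; [exact: up|exact: (up m.+1)|exact: (down m.+1)].
Qed.

End Supnorm.

Section Unramified.
Context (R : realType) (q n : nat) (n_gt0 : (0 < n)%N).
Context (K : fieldType) (absK : K -> R) (Kbar : fieldType) (resK : K -> Kbar).
Hypothesis hK : local_field absK resK q.
Context (L : fieldExtType K) (absL : L -> R) (Lbar : fieldExtType Kbar)
  (resL : L -> Lbar).
Hypothesis unram : unramified_extension absK resK absL resL q n.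
Context (e : n.-tuple L) (canon_e : canonical_basis absL resL e).

Let hL : local_field absL resL (q ^ n) := unram_local unram.
Let rK := absv_residue hK.
Let rL := absv_residue hL.

(** The residue of [a] is nonzero, hence so is its image in [Lbar]; thus a unit of O_K remains a
    unit in O_L. *)
Lemma absL_unit (a : K) : absK a = 1 -> absL a%:A = 1.
Proof.
move=> a1; have aK1 : absK a <= 1 by rewrite a1.
have [aL ra] := unram_res unram aK1.
apply/eqP; rewrite eq_le aL leNgt; apply/negP => /(residue_ker rL aL).
rewrite ra => /eqP; rewrite scaler_eq0 oner_eq0 orbF => /eqP.
by move/(residue_ker rK aK1); rewrite a1 ltxx.
Qed.

Lemma absL_lt1 (a : K) : absK a < 1 -> absL a%:A < 1.
Proof.
move=> a1; have aK1 := ltW a1; have [aL ra] := unram_res unram aK1.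
by apply/(residue_ker rL aL); rewrite ra ((residue_ker rK aK1).2 a1) scale0r.
Qed.

Lemma algA_expz (a : K) (j : int) : (a ^ j)%:A = a%:A ^ j :> L.
Proof.
have h (m : nat) : (a ^+ m)%:A = a%:A ^+ m :> L by exact: (rmorphXn (in_alg L)).
by case: j => m; rewrite ?NegzE -?invr_expz -!exprnP -h//; exact: (fmorphV (in_alg L)).
Qed.

(** The product a p^j is a unit of O_K, hence also of O_L. All values of [absL] on K are thereby
    reduced to the one at a uniformizer of K. *)
Lemma absL_pow (a : K) (j : int) (p : K) : absK p = q%:R^-1 ->
  absK a = q%:R ^ j -> absL a%:A = absL p%:A ^ (- j).
Proof.
move=> hp ha; have q0 : 0 < q%:R :> R by rewrite ltr0n ltnW// (residue_gt1 hK).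
have p0 : p != 0 by rewrite -(abs_gt0 hK) hp invr_gt0.
have u1 : absL (a * p ^ j)%:A = 1.
  apply: absL_unit; rewrite (absvM hK) (absXz hK) ha hp exprz_inv -expfzDr ?gt_eqF//.
  by rewrite subrr expr0z.
have e1 : a%:A = (a * p ^ j)%:A * (p ^ (- j))%:A :> L.
  rewrite -(rmorphM (in_alg L)) -mulrA -expfzDr// subrr expr0z mulr1//.
by rewrite e1 (absvM hL) u1 mul1r algA_expz (absXz hL).
Qed.

Lemma resL_sum (b : 'I_n -> L) : (forall j, absL (b j) <= 1) ->
  absL (\sum_j b j) <= 1 /\ resL (\sum_j b j) = \sum_j resL (b j).
Proof.
move=> b1; elim/big_ind2 : _ => [|x y x' y' [x1 <-] [y1 <-]|j _].
- rewrite (abs0 hL); split=> //; apply/(residue_ker rL); rewrite (abs0 hL)//.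
- by split; [exact: (abs_le hL)|rewrite (residueD rL)].
- by split.
Qed.

(** The residue of the sum is a combination of the residue basis whose coefficient at [j] is 1, so
    it is nonzero. *)
Lemma absL_of_coordinates_unit (t : 'rV[K]_n) (j : 'I_n) :
  (forall i, absK (t 0 i) <= 1) -> t 0 j = 1 -> absL (of_coordinates e t) = 1.
Proof.
move=> t1 tj; have [e1 eb] := canon_e.
have te1 i : absL (t 0 i *: tnth e i) <= 1.
  rewrite -mulr_algl (absvM hL) mulr_ile1 ?(absv_ge0 hL)//.
  by have [] := unram_res unram (t1 i).
have [y1 ry] := resL_sum te1.
apply/eqP; rewrite eq_le y1 leNgt; apply/negP => /(residue_ker rL y1).
have -> : resL (of_coordinates e t) =
    \sum_(i < n) resK (t 0 i) *: (map_tuple resL e)`_i.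
  rewrite ry; apply: eq_bigr => i _.
  have [ti rti] := unram_res unram (t1 i).
  by rewrite -mulr_algl (residueM rL)// rti mulr_algl -tnth_nth tnth_map.
have /freeP fr : free (map_tuple resL e) by exact: basis_free eb.
move=> /fr /(_ j) /(residue_ker rK (t1 j)).
by rewrite tj (abs1 hK) ltxx.
Qed.

(** Division by a coordinate of largest absolute value reduces to integral coordinates one of which
    is 1. *)
Lemma absL_of_coordinates_max (t : 'rV[K]_n) : t <> 0 ->
  exists2 j, supnorm absK t = absK (t 0 j) & absL (of_coordinates e t) = absL (t 0 j)%:A.
Proof.
move=> t0; have [j hj] := supnorm_arg hK t0; exists j => //.
have tj0 : t 0 j != 0.
  by rewrite -(abs_gt0 hK) -hj lt_neqAle supnorm_ge0 andbT eq_sym; apply/eqP => /(supnorm_eq0 hK).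
have tj : 0 < absK (t 0 j) by rewrite (abs_gt0 hK).
have -> : of_coordinates e t = (t 0 j)%:A * of_coordinates e ((t 0 j)^-1 *: t).
  rewrite /of_coordinates mulr_algl scaler_sumr; apply: eq_bigr => i _.
  by rewrite mxE scalerA mulrA divff// mul1r.
rewrite (absvM hL) (absL_of_coordinates_unit (j := j)) ?mulr1// ?mxE ?mulVf//.
move=> i; rewrite mxE (absvM hK) (absV hK) ler_pdivrMl// mulr1 -hj.
exact: supnorm_ge.
Qed.

(** A nontrivial combination of the [e_i] has the absolute value of a nonzero element of K, so it is
    not 0. The family is free, and its length is the degree. *)
Lemma canonical_basis_basis : basis_of {:L} e.
Proof.
rewrite basisEfree subvf size_tuple (unram_deg unram) leqnn !andbT.
apply/freeP => t; have [t0 _ i|t0] := pselect (\row_i t i = 0).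
  by move/rowP : t0 => /(_ i); rewrite !mxE.
have [j hj ej] := absL_of_coordinates_max t0.
move=> s0; have : absL (of_coordinates e (\row_i t i)) = 0.
  rewrite (_ : of_coordinates _ _ = 0) ?(abs0 hL)// -s0; apply: eq_bigr => i _.
  by rewrite mxE -tnth_nth.
rewrite ej => /(absv_eq0 hL)/eqP; rewrite scaler_eq0 oner_eq0 orbF => /eqP tj0.
by have := t0; move/(supnorm_eq0 hK): (t0) => {t0} //; rewrite hj tj0 (abs0 hK).
Qed.

Lemma coordinatesK : cancel (coordinates e) (of_coordinates e).
Proof.
move=> x; rewrite [RHS](coord_basis canonical_basis_basis (memvf x)).
by apply: eq_bigr => j _; rewrite mxE -tnth_nth.
Qed.

Lemma of_coordinatesK : cancel (of_coordinates e) (coordinates e).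
Proof.
move=> t; apply/rowP => j; rewrite mxE.
rewrite -[RHS](coord_sum_free (fun i => t 0 i) j (basis_free canonical_basis_basis)).
by congr (coord _ _ _); apply: eq_bigr => i _; rewrite -tnth_nth.
Qed.

Lemma coordinates_linear : linear (coordinates e).
Proof. by move=> a x y; apply/rowP => j; rewrite !mxE linearP. Qed.

(* Ramification index 1: a uniformizer of L has coordinates in K, so its
   absolute value is an integral power of that of a uniformizer of K. *)
Lemma absL_uniformizer (p : K) : absK p = q%:R^-1 ->
  absL p%:A = (q ^ n)%:R^-1.
Proof.
move=> hp; have [w hw _] := absv_uniformizer hL.
have q1 : 1 < (q ^ n)%:R :> R by rewrite ltr1n (residue_gt1 hL).
have q0 : 0 < (q ^ n)%:R :> R by rewrite (lt_trans ltr01).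
have w0 : w <> 0.
  by move=> w0; move: hw; rewrite w0 (abs0 hL) => /esym/eqP; rewrite invr_eq0 gt_eqF.
have cw0 : coordinates e w <> 0.
  by move=> c0; apply: w0; rewrite -(coordinatesK w) c0 /of_coordinates big1// => j _;
     rewrite mxE scale0r.
have [j hj] := absL_of_coordinates_max cw0; rewrite coordinatesK hw => ej.
have [i hi] := supnorm_val hK cw0; rewrite hj in hi.
rewrite (absL_pow hp hi) in ej.
have p1 : absK p < 1 by rewrite hp invf_lt1 ?ltr1n ?(residue_gt1 hK)// ltr0n ltnW// (residue_gt1 hK).
have pL1 := absL_lt1 p1.
have pL0 : p%:A != 0 :> L.
  rewrite scaler_eq0 oner_eq0 orbF -(abs_gt0 hK) hp invr_gt0 ltr0n ltnW//.
  exact: (residue_gt1 hK).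
have [m hm] := abs_val hL pL0.
have m0 : m < 0.
  by move: pL1; rewrite hm -[X in _ < X](expr0z ((q ^ n)%:R : R)) ltr_eXz2l.
have mi : m * (- i) = -1.
  have : (q ^ n)%:R ^ (-1) = (q ^ n)%:R ^ (m * - i) :> R by rewrite exprN1 ej hm exprz_exp.
  by move=> h; apply/eqP; rewrite eq_le -!(ler_eXz2l q1) h lexx.
have i0 : i < 0 by nia.
have m1 : m = -1 by nia.
by rewrite hm m1 exprN1.
Qed.

Lemma absL_coordinates (x : L) : absL x = supnorm absK (coordinates e x) ^+ n.
Proof.
have [c0|c0] := pselect (coordinates e x = 0).
  have -> : x = 0.
    by rewrite -(coordinatesK x) c0 /of_coordinates big1// => j _; rewrite mxE scale0r.
  have -> : coordinates e 0 = 0 by apply/rowP => j; rewrite !mxE linear0.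
  by rewrite (abs0 hL) ((supnorm_eq0 hK _).2 erefl) expr0n gtn_eqF.
have [j hj] := absL_of_coordinates_max c0; rewrite coordinatesK => ->.
have [i hi] := supnorm_val hK c0; rewrite hj in hi *.
have [p hp _] := absv_uniformizer hK.
rewrite (absL_pow hp hi) (absL_uniformizer hp) hi exprz_inv opprK natrX.
by rewrite !exprnP exprz_exp mulrC -exprz_exp.
Qed.

End Unramified.

(** * Transport of integrals and operators along the coordinates *)

Section IsoTransfer.
Context d1 d2 (X : measurableType d1) (Y : measurableType d2) (R : realType).
Context (phi : X -> Y) (psi : Y -> X).
Hypotheses (mphi : measurable_fun [set: X] phi) (mpsi : measurable_fun [set: Y] psi).
Hypothesis psiK : cancel psi phi.
Context (m1 : {measure set X -> \bar R}) (m2 : {measure set Y -> \bar R}).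
Hypothesis m12 : forall A, measurable A -> m2 A = m1 (phi @^-1` A).
Implicit Type f : Y -> R.

Lemma ge0_integral_iso (g : Y -> \bar R) : measurable_fun [set: Y] g ->
  (forall y, 0 <= g y)%E -> (\int[m2]_y g y = \int[m1]_x g (phi x))%E.
Proof.
move=> mg g0; have <- := ge0_integral_pushforward mphi m1 measurableT mg (fun x _ => g0 x).
apply: (@eq_measure_integral _ _ _ _
  (measure_function_pushforward__canonical__measure_function_Measure m1 mphi)).
by move=> A mA _; exact: m12.
Qed.

(** Part (i) concerns arbitrary functions, so measurability of [f] has to be recovered from that of
    its composite with [phi], by composing with [psi]. *)
Lemma integrable_iso f : m1.-integrable [set: X] (fun x => (f (phi x))%:E) <->
  m2.-integrable [set: Y] (fun y => (f y)%:E).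
Proof.
split=> /integrableP[mf foo]; apply/integrableP.
  have mf' : measurable_fun [set: Y] (fun y => (f y)%:E).
    apply: (eq_measurable_fun ((fun x => (f (phi x))%:E) \o psi)).
      by move=> y _; rewrite /= psiK.
    exact: measurableT_comp.
  by split=> //; rewrite ge0_integral_iso//; exact: measurableT_comp.
split; first exact: (measurableT_comp mf mphi).
by rewrite -(ge0_integral_iso (g := fun y => `|(f y)%:E|%E))//; exact: measurableT_comp.
Qed.

Lemma Rintegral_iso f : m2.-integrable [set: Y] (fun y => (f y)%:E) ->
  \int[m2]_y f y = \int[m1]_x f (phi x).
Proof.
move=> fi; have /integrable_iso fi1 := fi; rewrite /Rintegral; congr fine.
transitivity (\int[pushforward m1 phi]_y (f y)%:E)%E; last first.
  exact: (integral_pushforward mphi (measurable_int _ fi) (mu := m1) (D := setT)).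
apply: (@eq_measure_integral _ _ _ _
  (measure_function_pushforward__canonical__measure_function_Measure m1 mphi)).
by move=> A mA _; exact: m12.
Qed.

End IsoTransfer.

Section PartOne.
Context (R : realType) (q n : nat) (n_gt0 : (0 < n)%N).
Context (K : fieldType) (absK : K -> R) (Kbar : fieldType) (resK : K -> Kbar).
Hypothesis hK : local_field absK resK q.
Context (L : fieldExtType K) (absL : L -> R) (Lbar : fieldExtType Kbar)
  (resL : L -> Lbar).
Hypothesis unram : unramified_extension absK resK absL resL q n.
Context (e : n.-tuple L) (canon_e : canonical_basis absL resL e).
Context (mu : {measure set (borel (@supnorm R K absK n)) -> \bar R})
    (haar_mu : normalized_Haar mu)
    (muL : {measure set (borel absL) -> \bar R})
    (haar_muL : normalized_Haar muL).
Local Notation N := (@supnorm R K absK n).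
Let hL : local_field absL resL (q ^ n) := unram_local unram.
Let absLE := absL_coordinates n_gt0 hK unram canon_e.
Let ocoordK := of_coordinatesK hK unram canon_e.

Lemma coordinatesB x y : coordinates e (x - y) = coordinates e x - coordinates e y.
Proof. by apply/rowP => j; rewrite !mxE linearB. Qed.

Lemma supnorm_coordinates x : N (coordinates e x) = absL x `^ n%:R^-1.
Proof.
by rewrite absLE -powR_mulrn ?supnorm_ge0// -powRrM divff ?powRr1 ?supnorm_ge0// pnatr_eq0 -lt0n.
Qed.

Lemma measurable_coordinates :
  measurable_fun [set: borel absL] (coordinates e : borel absL -> borel N).
Proof.
refine (@measurability _ _ _ (borel N) _ _ (normopen N) erefl _) => _ [U oU <-].
rewrite setTI; apply: normopen_measurable => x /oU [r r0 xr].
exists (r ^+ n); first by rewrite exprn_gt0.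
move=> y yx; apply: xr; rewrite -coordinatesB.
by move: yx; rewrite absLE ltr_pXn2r// ?nnegrE ?supnorm_ge0// ltW.
Qed.

Lemma measurable_of_coordinates :
  measurable_fun [set: borel N] (of_coordinates e : borel N -> borel absL).
Proof.
refine (@measurability _ _ _ (borel absL) _ _ (normopen absL) erefl _) => _ [U oU <-].
rewrite setTI; apply: normopen_measurable => x /oU [r r0 xr].
exists (r `^ n%:R^-1); first by rewrite powR_gt0.
move=> y yx; apply: xr; rewrite absLE coordinatesB !ocoordK.
rewrite -(ltr_pXn2r n_gt0) ?nnegrE ?supnorm_ge0 ?powR_ge0// in yx.
by rewrite -[X in _ < X]powR_mulrn ?powR_ge0// -powRrM mulVf ?powRr1 ?(ltW r0) ?pnatr_eq0 -?lt0n in yx.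
Qed.

Let nu := measure_function_pushforward__canonical__measure_function_Measure
  muL measurable_coordinates.

(** The image of the Haar measure of L is a normalized Haar measure on K^n: the coordinates are
    additive, and |x|_L = N^n maps the unit ball onto the unit ball. Its values on balls then
    identify it with [mu]. *)
Lemma pushforward_haar : normalized_Haar nu.
Proof.
split=> [a A mA|].
  rewrite /nu/= /pushforward -[RHS](haar_muL.1 (of_coordinates e a)); last first.
    by rewrite -[X in measurable X]setTI; exact: measurable_coordinates.
  congr (muL _); apply/seteqP; split=> [x [y Ay yx]|x [y Ay <-]].
    exists (x - of_coordinates e a); rewrite ?subrK//=.
    by rewrite /= coordinatesB ocoordK -yx addrK.
  exists (coordinates e y) => //.
  have -> : y + of_coordinates e a = y - of_coordinates e (- a).
    by rewrite /of_coordinates -sumrN; congr (_ + _); apply: eq_bigr => j _;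
       rewrite mxE scaleNr opprK.
  by rewrite coordinatesB ocoordK opprK.
rewrite /nu/= /pushforward -[RHS]haar_muL.2; congr (muL _).
by apply/seteqP; split=> x; rewrite /= absLE expr_le1// supnorm_ge0.
Qed.

Lemma haar_coordinates (A : set (borel N)) : measurable A ->
  mu A = muL ((coordinates e : borel absL -> borel N) @^-1` A).
Proof.
apply: (@uball_measure_unique _ _ _ q (supnorm_ultranorm n hK) mu nu) => k a.
- by rewrite (haar_uball hK haar_mu) (haar_uball hK pushforward_haar).
- by rewrite (haar_uball hK haar_mu) ltry.
Qed.

(** The exponents agree because |z - x|_L = N^n and n (gamma + 1) = alpha + n. *)
Lemma frac_integrand_coordinates (alpha gamma : R) (v : 'rV[K]_n -> R[i]) x z :
  0 < alpha -> gamma = alpha / n%:R ->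
  frac_L_integrand absL gamma (v \o coordinates e) x z =
  hypersing_integrand absK alpha v (coordinates e x) (coordinates e z).
Proof.
move=> a0 ->; rewrite /frac_L_integrand /hypersing_integrand /= absLE coordinatesB.
rewrite -powR_mulrn ?supnorm_ge0// -powRrM; congr (_ * (_ `^ _)%:C)%C.
by rewrite mulrN mulrDr mulr1 mulrCA divff ?mulr1 1?addrC// pnatr_eq0 -lt0n.
Qed.

Lemma frac_L_coordinates (alpha gamma : R) (v : 'rV[K]_n -> R[i]) x :
  0 < alpha -> gamma = alpha / n%:R ->
  (cintegrable muL setT (frac_L_integrand absL gamma (v \o coordinates e) x) <->
   cintegrable mu setT (hypersing_integrand absK alpha v (coordinates e x))) /\
  (cintegrable mu setT (hypersing_integrand absK alpha v (coordinates e x)) ->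
     frac_L q n muL gamma (v \o coordinates e) x =
     frac_Kn q mu alpha v (coordinates e x)).
Proof.
move=> a0 ga.
have E : frac_L_integrand absL gamma (v \o coordinates e) x =
    (hypersing_integrand absK alpha v (coordinates e x)) \o coordinates e.
  by apply/funext => z; exact: frac_integrand_coordinates.
have T := @integrable_iso _ _ _ _ _ _ _ measurable_coordinates
  measurable_of_coordinates ocoordK muL mu haar_coordinates.
have T2 := @Rintegral_iso _ _ _ _ _ _ _ measurable_coordinates
  measurable_of_coordinates ocoordK muL mu haar_coordinates.
split.
  rewrite E; split=> -[h1 h2]; split; first exact/T; first exact/T.
    exact: (T (fun y => complex.Re (hypersing_integrand absK alpha v (coordinates e x) y))).2.
  exact: (T (fun y => complex.Im (hypersing_integrand absK alpha v (coordinates e x) y))).2.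
move=> [h1 h2]; rewrite /frac_L /frac_Kn /c_coef E /cintegral.
have nn0 : n%:R != 0 :> R by rewrite pnatr_eq0 -lt0n.
have -> : n%:R * gamma = alpha by rewrite ga mulrCA divff// mulr1.
have -> : - (n%:R * (gamma + 1)) = - alpha - n%:R :> R.
  by rewrite mulrDr mulr1 ga mulrCA divff// mulr1 opprD.
congr (_ * Complex _ _); symmetry.
  exact: (T2 (fun y => complex.Re (hypersing_integrand absK alpha v (coordinates e x) y)) h1).
exact: (T2 (fun y => complex.Im (hypersing_integrand absK alpha v (coordinates e x) y)) h2).
Qed.

End PartOne.

(** * Integrals of radial functions *)

Section Radial.
Context (R : realType) (V : zmodType) (N : V -> R) (q n : nat).
Hypothesis (n_gt0 : (0 < n)%N) (hN : ultranorm N q).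
Local Notation T := (borel N).
Local Notation B := (uball N q).
Local Notation S := (ushell N q).
Variable mu : {measure set T -> \bar R}.
Hypothesis muB : forall k a, mu (B k a) = ((q%:R ^+ n) ^ k)%:E.
Local Notation Q := (q%:R ^+ n : R).
Implicit Types (i j : int) (f : T -> R).

Lemma Q_gt1 : 1 < Q.
Proof. by rewrite exprn_egt1 ?(q_gt1 hN)// -lt0n. Qed.

Lemma Q_gt0 : 0 < Q. Proof. by rewrite (lt_trans ltr01 Q_gt1). Qed.

Lemma ushellE i : S i = B i 0 `\` B (i - 1) 0.
Proof.
apply/seteqP; split=> x; rewrite /ushell/uball/= subr0.
  by move=> ->; rewrite lexx; split=> //; apply/negP; rewrite -ltNge (qX_lt hN); lia.
move=> [xi /negP]; rewrite -ltNge => ix.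
have x0 : x <> 0.
  by move=> x0; move: ix; rewrite x0 (un0 hN) ltNge ltW// (qX_gt0 hN).
have [k xk] := un_val hN x0; rewrite xk (qX_le hN) (qX_lt hN) in xi ix *.
by congr (_ ^ _); lia.
Qed.

Lemma measurable_ushell i : measurable (S i).
Proof. by rewrite ushellE; apply: measurableD; exact: measurable_uball. Qed.

Lemma ushell_measure i : mu (S i) = (Q ^ i - Q ^ (i - 1))%:E.
Proof.
have mB (k : int) : measurable (B k 0) by exact: measurable_uball.
rewrite ushellE measureD//; last first.
  rewrite -[X in (X < _)%E]/(mu (B i 0)) muB ltry//.
rewrite setIidr; first by rewrite EFinB -!(muB _ 0).
by apply: (uball_le hN); lia.
Qed.

(** [G] is a discrete primitive: [G m] is the part of the integral that lies beyond the first m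
    spheres, so the sum telescopes. The sequence [s] of radii serves for descending spheres (balls)
    and for ascending ones (complements of balls). *)
Lemma integral_ushells (s : nat -> int) (c G : nat -> R) f :
  injective s -> measurable_fun [set: T] f ->
  (forall m, 0 <= c m) -> (forall m x, S (s m) x -> f x = c m) ->
  (forall m, c m * (Q ^ s m - Q ^ (s m - 1)) = G m - G m.+1) ->
  G m @[m --> \oo] --> 0 ->
  (\int[mu]_(x in \bigcup_m S (s m)) (f x)%:E = (G 0%N)%:E)%E.
Proof.
move=> sinj mf c0 fc cG G0.
rewrite ge0_integral_bigcup//; last 4 first.
- by move=> m; exact: measurable_ushell.
- by apply: measurable_funTS; exact/measurable_EFinP.
- by move=> x [m _ /fc ->]; rewrite lee_fin.
- apply/trivIsetP => i j _ _ ij; apply/seteqP; split=> // x [].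
  by rewrite /ushell/= => -> /(qX_inj hN)/sinj; apply/eqP.
have e m : (\int[mu]_(x in S (s m)) (f x)%:E = (G m - G m.+1)%:E)%E.
  rewrite (eq_integral (cst (c m)%:E)); last by move=> x; rewrite inE => /fc ->.
  by rewrite integral_cst ?ushell_measure -?EFinM ?cG//; exact: measurable_ushell.
apply/cvg_lim => //.
rewrite (_ : (fun m => _) = EFin \o (fun m => G 0%N - G m)).
  apply: cvg_EFin; first exact: nearW.
  by rewrite -[X in _ --> X]subr0; apply: cvgB => //; exact: cvg_cst.
apply/funext => m /=; elim: m => [|m ih]; first by rewrite big_geq// subrr.
by rewrite big_nat_recr//= ih e -EFinD addrA subrK.
Qed.

Lemma uball_ushells j : B j 0 `\ (0 : V) = \bigcup_m S (j - m%:Z).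
Proof.
apply/seteqP; split=> [x []|x [m _]]; rewrite /uball/ushell/= ?subr0.
  move=> xj x0; have [k xk] := un_val hN x0; exists `|j - k|%N => //=.
  by move: xj; rewrite xk (qX_le hN) => kj; congr (_ ^ _); lia.
move=> xm; rewrite /= xm (qX_le hN); split; first by lia.
by move=> x0; move: xm; rewrite x0 (un0 hN) => /eqP; rewrite lt_eqF// (qX_gt0 hN).
Qed.

Lemma uout_ushells j : uout N q j 0 = \bigcup_m S (j + m%:Z).
Proof.
apply/seteqP; split=> [x|x [m _]]; rewrite /uout/ushell/= ?subr0; last first.
  by move=> ->; rewrite (qX_le hN); lia.
move=> jx; have x0 : x <> 0.
  by move=> x0; move: jx; rewrite x0 (un0 hN) leNgt (qX_gt0 hN).
have [k xk] := un_val hN x0; exists `|k - j|%N => //=.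
by move: jx; rewrite xk (qX_le hN) => kj; congr (_ ^ _); lia.
Qed.

Lemma measurable_uout j a : measurable (uout N q j a).
Proof.
have mNa : measurable_fun [set: T] (fun x : T => N ((x : V) - a)).
  apply: (measurable_fun_un hN).
  apply: (measurable_sim hN (phi := fun x => x - a) (j := 0)) => x y.
  by rewrite expr0z mul1r opprB addrA subrK.
rewrite (_ : uout _ _ _ _ = (fun x : T => N ((x : V) - a)) @^-1` `[q%:R ^ j, +oo[).
  by rewrite -[X in measurable X]setTI; apply: mNa => //.
by apply/seteqP; split=> x; rewrite /= in_itv/= andbT.
Qed.

Lemma integral_mul_indic (E : set T) f : measurable E ->
  (\int[mu]_x (f x * \1_E x)%:E = \int[mu]_(x in E) (f x)%:E)%E.
Proof.
move=> mE; rewrite [RHS]integral_mkcond; apply: eq_integral => x _.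
by rewrite patchE indicE; case: ifPn => xE; rewrite ?mulr1 ?mulr0.
Qed.

Lemma integral_uball (j : int) (c F : int -> R) f : measurable_fun [set: T] f ->
  (forall i, i <= j -> 0 <= c i) -> (forall i x, i <= j -> S i x -> f x = c i) ->
  (forall i, i <= j -> c i * (Q ^ i - Q ^ (i - 1)) = F i - F (i - 1)) ->
  F (j - m%:Z) @[m --> \oo] --> 0 ->
  (\int[mu]_(x in B j 0) (f x)%:E = (F j)%:E)%E.
Proof.
move=> mf c0 fc cF F0.
have mEf : measurable_fun [set: T] (EFin \o f) by exact/measurable_EFinP.
have m0 : measurable ([set (0 : V)] : set T) by exact: (measurable_set1_un hN).
have mB : measurable (B j 0) by exact: measurable_uball.
pose E := (B j 0 `\ (0 : V)).
have mE : measurable E by exact: measurableD.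
(* The point 0 lies on no sphere and [f 0] is unconstrained; it is removed as a null set. *)
rewrite (ae_eq_integral ((EFin \o f) \_ E))//; last 3 first.
- exact: measurable_funTS.
- by apply/measurable_restrict => //; exact: measurable_funTS.
- exists [set (0 : V)]; split=> //; first exact: (uhaar_set1 hN muB).
  move=> x /= h; apply: contrapT => x0; apply: h => xB.
  by rewrite patchE mem_set.
rewrite -integral_mkcondr (_ : B j 0 `&` E = E); last first.
  by apply/seteqP; split=> [x []|x Ex]; [|split=> //; case: Ex].
rewrite /E.
rewrite uball_ushells.
rewrite (@integral_ushells _ (fun m => c (j - m%:Z)) (fun m => F (j - m%:Z)))//.
- by rewrite subr0.
- by move=> a b; lia.
- by move=> m; apply: c0; lia.
- by move=> m x; apply: fc; lia.
- by move=> m; rewrite cF; [congr (_ - F _)|]; lia.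
Qed.

Lemma integral_uout (j : int) (c F : int -> R) f : measurable_fun [set: T] f ->
  (forall i, j <= i -> 0 <= c i) -> (forall i x, j <= i -> S i x -> f x = c i) ->
  (forall i, j <= i -> c i * (Q ^ i - Q ^ (i - 1)) = F i - F (i + 1)) ->
  F (j + m%:Z) @[m --> \oo] --> 0 ->
  (\int[mu]_(x in uout N q j 0) (f x)%:E = (F j)%:E)%E.
Proof.
move=> mf c0 fc cF F0; rewrite uout_ushells.
rewrite (@integral_ushells _ (fun m => c (j + m%:Z)) (fun m => F (j + m%:Z)))//.
- by rewrite addr0.
- by move=> a b; lia.
- by move=> m; apply: c0; lia.
- by move=> m x; apply: fc; lia.
- by move=> m; rewrite cF; [congr (_ - F _)|]; lia.
Qed.

End Radial.

(** * Translations and approximate identities *)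

Section ApproxInvariant.
Context (R : realType) (V : zmodType) (N : V -> R) (q : nat).
Hypothesis hN : ultranorm N q.
Local Notation T := (borel N).
Local Notation B := (uball N q).
Variable mu : {sigma_finite_measure set T -> \bar R}.

Definition ball_invariant (k : nat) (C : set T) : Prop :=
  forall x u : V, N u <= q%:R ^ (- k%:Z) -> C x -> C (x + u).

Lemma ball_invariant_le (k l : nat) C : (k <= l)%N ->
  ball_invariant k C -> ball_invariant l C.
Proof.
move=> kl hC x u ul; apply: hC; apply: le_trans ul _.
by rewrite (qX_le hN) lerN2 lez_nat.
Qed.

(* For D of finite measure these sets form a sigma-algebra containing the open
   sets, hence are all the Borel sets. *)
Definition almost_invariant (D : set T) (E : set T) : Prop :=
  measurable E /\ forall e : R, 0 < e -> exists (k : nat) (C : set T),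
    [/\ measurable C, ball_invariant k C & (mu ((E `+` C) `&` D) < e%:E)%E].

Variables (D : set T).
Hypotheses (mD : measurable D) (muD : (mu D < +oo)%E).

Let mI (E C : set T) : measurable E -> measurable C -> measurable ((E `+` C) `&` D).
Proof.
by move=> mE mC; apply: measurableI => //; rewrite setY_def;
  apply: measurableU; exact: measurableD.
Qed.

Lemma almost_invariantC E : almost_invariant D E -> almost_invariant D (~` E).
Proof.
move=> [mE hE]; split; first exact: measurableC.
move=> e /hE[k [C [mC Ck EC]]]; exists k, (~` C); split.
- exact: measurableC.
- move=> x u uk Cx Cxu; apply: Cx.
  have := Ck (x + u) (- u); rewrite (un_opp hN) addrK; exact.
- by rewrite (_ : ~` E `+` ~` C = E `+` C)// setYC !setY_def !setDE !setCK setIC [X in _ `|` X]setIC.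
Qed.

Lemma almost_invariantU E F : almost_invariant D E -> almost_invariant D F ->
  almost_invariant D (E `|` F).
Proof.
move=> [mE hE] [mF hF]; split; first exact: measurableU.
move=> e e0; have e2 : 0 < e / 2 by rewrite divr_gt0.
have [k [C [mC Ck EC]]] := hE _ e2; have [l [C' [mC' Cl FC]]] := hF _ e2.
exists (maxn k l), (C `|` C'); split.
- exact: measurableU.
- move=> x u uk [Cx|Cx]; [left|right].
    exact: (ball_invariant_le (leq_maxl k l) Ck) Cx.
  exact: (ball_invariant_le (leq_maxr k l) Cl) Cx.
- apply: (@le_lt_trans _ _ (mu (((E `+` C) `&` D) `|` ((F `+` C') `&` D)))).
    apply: le_measure; rewrite ?inE.
    + by apply: mI; exact: measurableU.
    + by apply: measurableU; exact: mI.
    + move=> x [+ Dx]; rewrite !setY_def => -[[[Ex|Fx] nC]|[[Cx|Cx] nE]].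
      * by left; split=> //; left; split=> // Cx; apply: nC; left.
      * by right; split=> //; left; split=> // Cx; apply: nC; right.
      * by left; split=> //; right; split=> // Ex; apply: nE; left.
      * by right; split=> //; right; split=> // Ex; apply: nE; right.
  apply: (@le_lt_trans _ _ (mu ((E `+` C) `&` D) + mu ((F `+` C') `&` D))%E).
    by apply: measureU2; exact: mI.
  by rewrite [e]splitr EFinD; apply: lteD.
Qed.

(** Inside [D], of finite measure, the union exceeds [E i] by sets decreasing to the empty set,
    whose measure tends to 0 by continuity from above. An approximation of a single [E i] therefore
    suffices. *)
Lemma almost_invariant_bigcup (E : nat -> set T) :
  (forall i, almost_invariant D (E i)) -> nondecreasing_seq E ->
  almost_invariant D (\bigcup_i E i).
Proof.
move=> hE ndE.
have mU : measurable (\bigcup_i E i) by apply: bigcupT_measurable => i; case: (hE i).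
split=> // e e0; have e2 : 0 < e / 2 by rewrite divr_gt0.
pose F i := (\bigcup_i E i `\` E i) `&` D.
have mF i : measurable (F i).
  by apply: measurableI => //; apply: measurableD => //; case: (hE i).
have F0 : \bigcap_i F i = set0.
  apply/seteqP; split=> // x Fx; have [[[i _ Eix] _] _] := Fx 0%N I.
  by have [[_ +] _] := Fx i I; apply.
have : mu (F i) @[i --> \oo] --> mu (\bigcap_i F i).
  apply: nonincreasing_cvg_mu => //.
  - apply: le_lt_trans muD; apply: le_measure; rewrite ?inE//; exact: subIsetr.
  - by rewrite F0.
  - move=> i j ij; apply/subsetPset; apply: setSI; apply: setDS.
    by have /subsetPset := ndE _ _ ij.
rewrite F0 measure0 => /fine_cvgP[Ffin /cvgrPdist_lt/(_ _ e2)].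
move: Ffin => [i0 _ Ffin] [i1 _ Fsm].
pose i := maxn i0 i1.
have Fi : (mu (F i) < (e / 2)%:E)%E.
  have := Fsm i (leq_maxr _ _); rewrite /= sub0r normrN ger0_norm ?fine_ge0// => h.
  by rewrite -(fineK (Ffin i (leq_maxl _ _))) lte_fin.
have [k [C [mC Ck EC]]] := (hE i).2 _ e2; exists k, C; split=> //.
apply: (@le_lt_trans _ _ (mu (((E i `+` C) `&` D) `|` F i))).
  apply: le_measure; rewrite ?inE.
  + exact: mI.
  + by apply: measurableU => //; apply: mI => //; case: (hE i).
  + move=> x [+ Dx]; rewrite !setY_def => -[[[j _ Ejx] nC]|[Cx nE]].
      have [Eix|nEix] := pselect (E i x); first by left; split=> //; left.
      by right; split=> //; split=> //; exists j.
    by left; split=> //; right; split=> // Eix; apply: nE; exists i.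
apply: (@le_lt_trans _ _ (mu ((E i `+` C) `&` D) + mu (F i))%E).
  by apply: measureU2 => //; apply: mI => //; case: (hE i).
by rewrite [e]splitr EFinD; apply: lteD.
Qed.

(** An open set is the increasing union of the sets of points whose ball of radius q^(-k) it
    contains, and these sets are exactly invariant under translations of norm at most q^(-k). *)
Lemma almost_invariant_open U : normopen N U -> almost_invariant D U.
Proof.
move=> oU; pose E (k : nat) : set T := [set x | B (- k%:Z) x `<=` U].
have Einv k : ball_invariant k (E k).
  move=> x u uk; rewrite /E/= (uball_sub hN (x := x + u) (a := x))//.
  by rewrite /uball/= addrC addKr.
have Eopen k : normopen N (E k).
  move=> x Ex; exists (q%:R ^ (- k%:Z)); first exact: (qX_gt0 hN).
  by move=> y yx; rewrite -(subrK x y) addrC; apply: Einv => //; exact: ltW.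
have -> : U = \bigcup_k E k.
  apply/seteqP; split=> [x Ux|x [k _ Ex]].
    have [r r0 xr] := oU _ Ux; have [k kr] := small_qX hN r0.
    by exists k => // y yx; apply: xr; exact: le_lt_trans kr.
  by apply: Ex; rewrite /uball/= subrr (un0 hN) ltW// (qX_gt0 hN).
apply: almost_invariant_bigcup => [k|k l kl].
  split=> [|e e0]; first exact: normopen_measurable.
  exists k, (E k); split=> //; first exact: normopen_measurable.
  by rewrite setYK set0I measure0 lte_fin.
apply/subsetPset => x Ex; apply: subset_trans Ex; apply: (uball_le hN).
by rewrite lerN2 lez_nat.
Qed.

Lemma measurable_almost_invariant (E : set T) : measurable E -> almost_invariant D E.
Proof.
apply: smallest_sub => [|U]; last exact: almost_invariant_open.
have a0 : almost_invariant D set0.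
  by apply: almost_invariant_open => x.
split=> //.
- by move=> F hF; rewrite setTD; exact: almost_invariantC.
(* A countable union is the increasing union of its finite partial unions. *)
- move=> F hF; rewrite -bigcup_bigsetU_bigcup; apply: almost_invariant_bigcup.
    move=> i; elim: i => [|i ih]; first by rewrite big_ord1.
    by rewrite big_ord_recr/=; exact: almost_invariantU.
  by move=> i j ij; apply/subsetPset; exact: subset_bigsetU.
Qed.

End ApproxInvariant.

Lemma powRD_le (R : realType) (p s t : R) : 1 <= p -> 0 <= s -> 0 <= t ->
  (s + t) `^ p <= 2 `^ p * (s `^ p + t `^ p).
Proof.
move=> p1 s0 t0; have p0 : 0 <= p by rewrite (le_trans ler01).
wlog st : s t s0 t0 / s <= t.
  move=> H; have [st|ts] := leP s t; first exact: H.
  by rewrite addrC [s `^ p + _]addrC; apply: H => //; exact: ltW.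
apply: (@le_trans _ _ ((2 * t) `^ p)).
  apply: ge0_ler_powR; rewrite ?nnegrE ?addr_ge0 ?mulr_ge0//.
  by rewrite mulr_natl mulr2n lerD2r.
by rewrite powRM// ler_wpM2l ?powR_ge0// lerDr powR_ge0.
Qed.

(** The graph of t^p lies above its tangent at s, that is t^p >= s^p + p s^(p - 1) (t - s). For p >
    1 it is Young's inequality for t and s^(p - 1) with the exponents p and p / (p - 1). *)
Lemma powR_tangent (R : realType) (p s t : R) : 1 <= p -> 0 <= s -> 0 <= t ->
  p * s `^ (p - 1) * t <= t `^ p + (p - 1) * s `^ p.
Proof.
rewrite le_eqVlt => /orP[/eqP <-|p1] s0 t0.
  by rewrite subrr powRr0 !mul1r mul0r addr0 powRr1.
have p0 : 0 < p by rewrite (lt_trans ltr01).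
have pm : 0 < p - 1 by rewrite subr_gt0.
have q0 : 0 < p / (p - 1) by rewrite divr_gt0.
have pq : p^-1 + (p / (p - 1))^-1 = 1.
  rewrite invf_div; have := gt_eqF p0; move=> h; field; by rewrite h.
have := conjugate_powR t0 (powR_ge0 s (p - 1)) p0 q0 pq.
rewrite -powRrM mulrCA divff ?gt_eqF// mulr1 -(ler_pM2l p0) => h.
have -> : p * s `^ (p - 1) * t = p * (t * s `^ (p - 1)) by ring.
apply: le_trans h _; rewrite le_eqVlt; apply/orP; left; apply/eqP.
have p0' := gt_eqF p0; have pm' := gt_eqF pm; field.
by rewrite p0' pm'.
Qed.

Section Translation.
Context (R : realType) (V : zmodType) (N : V -> R) (q n : nat).
Hypothesis hN : ultranorm N q.
Local Notation T := (borel N).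
Local Notation B := (uball N q).
Variable mu : {sigma_finite_measure set T -> \bar R}.
Hypothesis muB : forall k a, mu (uball N q k a) = ((q%:R ^+ n) ^ k)%:E.
Lemma measurable_conv_kernel (g : T -> R) : measurable_fun [set: T] g ->
  measurable_fun [set: T * T] (fun z : T * T => g ((z.1 : V) - (z.2 : V))).
Proof. by move=> mg; exact: (measurableT_comp mg (measurable_sub_un hN)). Qed.

Lemma subl_sim (x y z : V) : N (x - y - (x - z)) = q%:R ^ 0 * N (y - z).
Proof. by rewrite expr0z mul1r subrACA subrr sub0r (un_opp hN). Qed.

Lemma subr_sim (x y z : V) : N (y - x - (z - x)) = q%:R ^ 0 * N (y - z).
Proof. by rewrite expr0z mul1r subrACA subrr subr0. Qed.

Lemma measurable_subl (x : V) : measurable_fun [set: T] (fun y : T => x - (y : V) : T).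
Proof. exact: measurable_sim (subl_sim x). Qed.

Lemma measurable_subr (x : V) : measurable_fun [set: T] (fun y : T => (y : V) - x : T).
Proof. exact: measurable_sim (subr_sim x). Qed.

Variable p : R.
Hypothesis p1 : 1 <= p.
Implicit Types (f g rho : T -> R) (u : V).

Let p0 : 0 < p. Proof. by rewrite (lt_le_trans ltr01). Qed.

(** The L^p distance between [f] and its translate, to the power p: without the root it is a plain
    integral, to which Tonelli's theorem applies. *)
Definition shift_modulus f u : \bar R :=
  (\int[mu]_x (`|f ((x : V) - u) - f x| `^ p)%:E)%E.

Definition shift_continuous f : Prop := forall e : R, 0 < e ->
  exists k : nat, forall u, N u <= q%:R ^ (- k%:Z) -> (shift_modulus f u <= e%:E)%E.

Lemma measurable_powabs f : measurable_fun [set: T] f ->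
  measurable_fun [set: T] (fun x => (`|f x| `^ p)%:E).
Proof.
move=> mf; apply/measurable_EFinP; apply: (measurableT_comp (measurable_powR p)).
exact: measurableT_comp.
Qed.

Lemma measurable_shift f u : measurable_fun [set: T] f ->
  measurable_fun [set: T] (fun x : T => f ((x : V) - u)).
Proof. by move=> mf; exact: (measurableT_comp mf (measurable_subr u)). Qed.

Lemma integral_shift (g : T -> \bar R) u : measurable_fun [set: T] g ->
  (forall x, 0 <= g x)%E -> (\int[mu]_x g ((x : V) - u)%R = \int[mu]_x g x)%E.
Proof.
move=> mg g0.
by rewrite (ge0_integral_sim hN muB (subr_sim u) (addrK u))// oppr0 expr0z mul1e.
Qed.

Let le3 (a b c d : R) : 0 <= a -> 0 <= b -> 0 <= c -> d <= a + b + c ->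
  0 <= d -> d `^ p <= 4 `^ p * (a `^ p + b `^ p + c `^ p).
Proof.
move=> a0 b0 c0 dabc d0; apply: (@le_trans _ _ ((a + b + c) `^ p)).
  by apply: ge0_ler_powR; rewrite ?nnegrE ?addr_ge0// ltW.
apply: le_trans (powRD_le p1 _ c0) _; first by rewrite addr_ge0.
have -> : 4 = 2 * 2 :> R by rewrite -natrM.
rewrite powRM// -mulrA ler_wpM2l ?powR_ge0// mulrDr lerD ?powRD_le//.
by rewrite ler_peMl ?powR_ge0// -[leLHS](powRr0 2) ler_powR ?ler1n// ltW.
Qed.

Lemma shift_continuous_closed f : measurable_fun [set: T] f ->
  (forall e : R, 0 < e -> exists g, [/\ measurable_fun [set: T] g,
     shift_continuous g & (\int[mu]_x (`|f x - g x| `^ p)%:E <= e%:E)%E]) ->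
  shift_continuous f.
Proof.
move=> mf H e e0; pose c : R := 4 `^ p.
have c0 : 0 < c by rewrite powR_gt0.
(* Three errors, each multiplied by c = 4^p: f - g at the translated point, the modulus of g, and f
   - g itself. The first equals the third by invariance of the measure. *)
have d0 : 0 < e / (3 * c) by rewrite divr_gt0// mulr_gt0.
have [g [mg /(_ _ d0) [k hk] fg]] := H _ d0; exists k => u /hk uk.
have mfg : measurable_fun [set: T] (fun x => f x - g x) by exact: measurable_funB.
have m1 : measurable_fun [set: T] (fun x : T => (`|f ((x : V) - u) - g ((x : V) - u)| `^ p)%:E).
  by apply: measurable_powabs; apply: measurable_funB; exact: measurable_shift.
have m2 : measurable_fun [set: T] (fun x : T => (`|g ((x : V) - u) - g x| `^ p)%:E).
  by apply: measurable_powabs; apply: measurable_funB => //; exact: measurable_shift.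
have m3 := measurable_powabs mfg.
apply: (@le_trans _ _ (\int[mu]_x (c%:E * ((`|f ((x : V) - u) - g ((x : V) - u)| `^ p)%:E +
   (`|g ((x : V) - u) - g x| `^ p)%:E + (`|f x - g x| `^ p)%:E)))%E).
  apply: ge0_le_integral => //.
  - by apply: measurable_powabs; apply: measurable_funB => //; exact: measurable_shift.
  - exact: measurable_funeM (emeasurable_funD (emeasurable_funD m1 m2) m3).
  - move=> x _; rewrite -!EFinD -EFinM lee_fin; apply: le3 => //.
    rewrite [X in _ + _ + X]distrC; apply: le_trans (lerD (ler_normD _ _) (lexx _)).
    by apply: le_trans (ler_normD _ _); rewrite le_eqVlt; apply/orP; left; apply/eqP;
       congr (`| _ |); ring.
rewrite ge0_integralZl_EFin ?(ltW c0)//; last 2 first.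
- by move=> x _; rewrite !adde_ge0// lee_fin powR_ge0.
- exact: emeasurable_funD (emeasurable_funD m1 m2) m3.
rewrite ge0_integralD//; last 2 first.
- by move=> x _; rewrite !adde_ge0// lee_fin powR_ge0.
- exact: emeasurable_funD m1 m2.
rewrite ge0_integralD//.
have -> := integral_shift u m3 (fun x => powR_ge0 _ _ : (0 <= _%:E)%E).
have -> : e%:E = (c%:E * ((e / (3 * c))%:E + (e / (3 * c))%:E + (e / (3 * c))%:E))%E.
  by rewrite -!EFinD -EFinM; congr EFin; have := gt_eqF c0 => h; field; rewrite h.
apply: lee_wpmul2l; first by rewrite lee_fin ltW.
by apply: leeD => //; apply: leeD.
Qed.

Lemma shift_continuousD f g : measurable_fun [set: T] f -> measurable_fun [set: T] g ->
  shift_continuous f -> shift_continuous g -> shift_continuous (fun x => f x + g x).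
Proof.
move=> mf mg Pf Pg e e0; pose c : R := 2 `^ p.
have c0 : 0 < c by rewrite powR_gt0.
have d0 : 0 < e / (2 * c) by rewrite divr_gt0// mulr_gt0.
have [k hk] := Pf _ d0; have [l hl] := Pg _ d0.
exists (maxn k l) => u uk.
have uk1 : N u <= q%:R ^ (- k%:Z).
  by apply: le_trans uk _; rewrite (qX_le hN) lerN2 lez_nat leq_maxl.
have uk2 : N u <= q%:R ^ (- l%:Z).
  by apply: le_trans uk _; rewrite (qX_le hN) lerN2 lez_nat leq_maxr.
have m1 : measurable_fun [set: T] (fun x : T => (`|f ((x : V) - u) - f x| `^ p)%:E).
  by apply: measurable_powabs; apply: measurable_funB => //; exact: measurable_shift.
have m2 : measurable_fun [set: T] (fun x : T => (`|g ((x : V) - u) - g x| `^ p)%:E).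
  by apply: measurable_powabs; apply: measurable_funB => //; exact: measurable_shift.
apply: (@le_trans _ _ (\int[mu]_x (c%:E * ((`|f ((x : V) - u) - f x| `^ p)%:E +
   (`|g ((x : V) - u) - g x| `^ p)%:E)))%E).
  apply: ge0_le_integral => //.
  - apply: measurable_powabs; apply: measurable_funB; last exact: measurable_funD.
    by apply: measurable_funD; exact: measurable_shift.
  - exact: measurable_funeM (emeasurable_funD m1 m2).
  - move=> x _; rewrite -!EFinD -EFinM lee_fin; apply: le_trans (powRD_le p1 _ _) => //.
    apply: ge0_ler_powR; rewrite ?nnegrE ?addr_ge0// ?(ltW p0)//.
    by apply: le_trans (ler_normD _ _); rewrite opprD addrACA.
rewrite ge0_integralZl_EFin ?(ltW c0)//; last 2 first.
- by move=> x _; rewrite !adde_ge0// lee_fin powR_ge0.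
- exact: emeasurable_funD m1 m2.
rewrite ge0_integralD//.
have -> : e%:E = (c%:E * ((e / (2 * c))%:E + (e / (2 * c))%:E))%E.
  by rewrite -!EFinD -EFinM; congr EFin; have := gt_eqF c0 => h; field; rewrite h.
apply: lee_wpmul2l; first by rewrite lee_fin ltW.
by apply: leeD; [exact: hk|exact: hl].
Qed.

Lemma shift_continuousZ (c : R) f : measurable_fun [set: T] f ->
  shift_continuous f -> shift_continuous (fun x => c * f x).
Proof.
move=> mf Pf e e0; pose d : R := `|c| `^ p + 1.
have d0 : 0 < d by rewrite ltr_wpDl ?powR_ge0.
have [k hk] := Pf _ (divr_gt0 e0 d0); exists k => u uk; have h := hk u uk.
have m1 : measurable_fun [set: T] (fun x : T => (`|f ((x : V) - u) - f x| `^ p)%:E).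
  by apply: measurable_powabs; apply: measurable_funB => //; exact: measurable_shift.
rewrite /shift_modulus.
under eq_integral do rewrite -mulrBr normrM powRM// EFinM.
rewrite ge0_integralZl_EFin ?powR_ge0//.
apply: (@le_trans _ _ (d%:E * (e / d)%:E)%E); last by rewrite -EFinM mulrCA divff ?mulr1// gt_eqF.
apply: lee_pmul => //; rewrite ?lee_fin ?powR_ge0 ?lerDl//.
by apply: integral_ge0 => x _; rewrite lee_fin powR_ge0.
Qed.

(** Let [C] be a ball-invariant approximation of [E], and [W] the set where they differ inside the
    ball. A small translation preserves [C] and the ball, so the indicator can change at x only if x
    or x - u lies in [W]; each event has measure less than e / 2. *)
Lemma shift_continuous_indic (E : set T) (j : nat) : measurable E ->
  shift_continuous (\1_(E `&` B j%:Z 0)).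
Proof.
move=> mE e e0; have e2 : 0 < e / 2 by rewrite divr_gt0.
have mD : measurable (B j%:Z 0) by exact: measurable_uball.
have muD : (mu (B j%:Z 0) < +oo)%E by rewrite muB ltry.
have [_ /(_ _ e2)[k [C [mC Ck EC]]]] := measurable_almost_invariant hN mD muD mE.
exists k => u uk; pose W := (E `+` C) `&` B j%:Z 0.
have mW : measurable W.
  by apply: measurableI => //; rewrite setY_def; apply: measurableU; exact: measurableD.
have mW1 : measurable_fun [set: T] (\1_W : T -> R) by exact: measurable_indic.
have m1 : measurable_fun [set: T] (fun x => (\1_W x)%:E : \bar R).
  exact/measurable_EFinP.
(* As N u <= q^(-k) <= 1 <= q^j, the translation preserves the ball. *)
have Du x : B j%:Z 0 (x - u) = B j%:Z 0 x.
  have uj : N u <= q%:R ^ j%:Z by apply: le_trans uk _; rewrite (qX_le hN) (le_trans (y := 0))// oppr_le0.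
  apply/propext; rewrite /uball/= !subr0; split=> h; last exact: (un_leB hN).
  by rewrite -(subrK u x); apply: (un_le hN).
have one : 1 `^ p = 1 :> R by rewrite powR1.
have Cu x : C ((x : V) - u) <-> C x.
  split=> h; last by apply: Ck => //; rewrite (un_opp hN).
  by rewrite -(subrK u x); exact: Ck.
have mS : measurable_fun [set: T] (\1_(E `&` B j%:Z 0) : T -> R).
  by apply: measurable_indic; exact: measurableI.
apply: (@le_trans _ _ (\int[mu]_x ((\1_W ((x : V) - u))%:E + (\1_W x)%:E))%E).
  apply: ge0_le_integral => //.
  - apply: measurable_powabs; apply: measurable_funB => //; exact: measurable_shift.
  - apply: emeasurable_funD => //.
    by apply/measurable_EFinP; exact: (measurable_shift u mW1).
  - move=> x _; rewrite -EFinD lee_fin.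
    have [Wu|nWu] := pselect (W ((x : V) - u)).
      apply: (@le_trans _ _ 1); last by rewrite !indicE mem_set// lerDl.
      rewrite -[leRHS]one; apply: ge0_ler_powR; rewrite ?nnegrE// ?(ltW p0)//.
      by rewrite !indicE; do 2 case: (_ \in _); rewrite ?subrr ?subr0 ?sub0r ?normrN ?normr0 ?normr1.
    have [Wx|nWx] := pselect (W x).
      apply: (@le_trans _ _ 1); last by rewrite [X in _ + X]indicE mem_set// lerDr.
      rewrite -[leRHS]one; apply: ge0_ler_powR; rewrite ?nnegrE// ?(ltW p0)//.
      by rewrite !indicE; do 2 case: (_ \in _); rewrite ?subrr ?subr0 ?sub0r ?normrN ?normr0 ?normr1.
    suff -> : \1_(E `&` B j%:Z 0) ((x : V) - u) = \1_(E `&` B j%:Z 0) x :> R.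
      by rewrite subrr normr0 powR0 ?gt_eqF// addr_ge0.
    have EC' y : B j%:Z 0 y -> ~ W y -> E y <-> C y.
      move=> Dy nW; split=> h; apply: contrapT => h'; apply: nW; split=> //; rewrite setY_def.
        by left.
      by right.
    rewrite !indicE; have -> // : ((x : V) - u : T) \in E `&` B j%:Z 0 = (x \in E `&` B j%:Z 0).
    apply/idP/idP => /set_mem [Ex Dx]; apply/mem_set; split.
    + by rewrite Du in Dx; apply/(EC' _ Dx nWx)/Cu; apply/EC' => //; rewrite Du.
    + by rewrite Du in Dx.
    + have Dxu : B j%:Z 0 (x - u) by rewrite Du.
      by apply/(EC' _ Dxu nWu)/Cu; apply/EC'.
    + by rewrite Du.
rewrite ge0_integralD//; last first.
  by apply/measurable_EFinP; exact: (measurable_shift u mW1).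
have -> := integral_shift u m1 (fun x => _ : (0 <= _)%E); last first.
  by move=> x; rewrite lee_fin.
rewrite integral_indic// setIT [e]splitr EFinD.
by apply: leeD; exact: ltW.
Qed.

Lemma shift_continuous0 : shift_continuous (fun=> 0).
Proof.
move=> e e0; exists 0%N => u _; rewrite /shift_modulus.
under eq_integral do rewrite subrr normr0 powR0 ?gt_eqF//.
by rewrite integral0 lee_fin ltW.
Qed.

Lemma shift_continuous_sum (I : Type) (s : seq I) (c : I -> R) (E : I -> set T) (j : nat) :
  (forall i, measurable (E i)) ->
  measurable_fun [set: T] (fun x => \sum_(i <- s) c i * \1_(E i `&` B j%:Z 0) x) /\
  shift_continuous (fun x => \sum_(i <- s) c i * \1_(E i `&` B j%:Z 0) x).
Proof.
move=> mE; elim: s => [|i s [ih1 ih2]].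
  under eq_fun do rewrite big_nil.
  by split; [exact: measurable_cst|exact: shift_continuous0].
have m1 : measurable_fun [set: T] (\1_(E i `&` B j%:Z 0) : T -> R).
  by apply: measurable_indic; apply: measurableI => //; exact: measurable_uball.
have m2 : measurable_fun [set: T] (fun x => c i * \1_(E i `&` B j%:Z 0) x).
  by apply: measurable_funM => //; exact: measurable_cst.
under eq_fun do rewrite big_cons.
split; first exact: measurable_funD.
have c2 := shift_continuousZ (c i) m1 (shift_continuous_indic j (mE i)).
exact: (shift_continuousD m2 ih1 c2 ih2).
Qed.

Import HBNNSimple.

Lemma shift_continuous_nnsfun (g : {nnsfun T >-> R}) (j : nat) :
  measurable_fun [set: T] (fun x => g x * \1_(B j%:Z 0) x) /\
  shift_continuous (fun x => g x * \1_(B j%:Z 0) x).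
Proof.
have -> : (fun x => g x * \1_(B j%:Z 0) x) = (fun x =>
    \sum_(y <- finmap.enum_fset (fset_set (range g))) y * \1_((g @^-1` [set y]) `&` B j%:Z 0) x).
  apply/funext => x; rewrite {1}(fimfunE g x) fsbig_finite//= mulr_suml.
  by apply: eq_bigr => y _; rewrite indicI /= mulrA.
by apply: shift_continuous_sum => y; exact: measurable_sfunP.
Qed.

(** Simple functions increasing to [f] converge to it in L^p by dominated convergence. They are cut
    off by growing balls, which keeps their level sets within finite measure; at each point the
    cut-off is eventually inactive. *)
Lemma shift_continuous_ge0 f : measurable_fun [set: T] f -> (forall x, 0 <= f x) ->
  (\int[mu]_x (`|f x| `^ p)%:E < +oo)%E -> shift_continuous f.
Proof.
move=> mf f0 foo; apply: (shift_continuous_closed mf) => e e0.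
have mEf : measurable_fun [set: T] (EFin \o f) by exact/measurable_EFinP.
pose h := nnsfun_approx measurableT mEf.
pose g (i : nat) (x : T) := h i x * \1_(B i%:Z 0) x.
have g0 i x : 0 <= g i x by rewrite mulr_ge0.
have hf x : h i x @[i --> \oo] --> f x.
  have /fine_cvgP[_] : (EFin \o (h ^~ x)) i @[i --> \oo] --> (f x)%:E.
    by apply: (cvg_nnsfun_approx measurableT mEf) => // y _; rewrite lee_fin.
  by [].
have hle i x : h i x <= f x.
  have nd : nondecreasing_seq (h ^~ x).
    by move=> a b ab; have /lefP := nd_nnsfun_approx measurableT mEf ab.
  have cv : cvgn (h ^~ x) by apply/cvg_ex; exists (f x); exact: hf.
  by have := nondecreasing_cvgn_le nd cv i; rewrite (cvg_lim _ (hf x)).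
have gf i x : g i x <= f x.
  apply: le_trans (hle i x); rewrite /g indicE ler_piMr//.
  by case: (_ \in _).
have gcvg x : g i x @[i --> \oo] --> f x.
  apply: cvg_trans (hf x); apply: near_eq_cvg.
  have [l xl] := large_qX hN (N x); exists l => // i /= li.
  rewrite /g indicE mem_set ?mulr1// /uball/= subr0 (le_trans (ltW xl))// (qX_le hN) lez_nat//.
have mg i : measurable_fun [set: T] (g i) := (shift_continuous_nnsfun (h i) i).1.
have mfg i : measurable_fun [set: T] (fun x => (`|f x - g i x| `^ p)%:E).
  by apply: measurable_powabs; exact: measurable_funB.
have mp := measurable_powabs mf.
have [||||_ _ +] := @dominated_convergence _ _ _ mu setT measurableT
  (fun i x => (`|f x - g i x| `^ p)%:E) (cst 0%E) (fun x => (`|f x| `^ p)%:E) mfg.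
- exact: measurable_cst.
- apply/aeW => x _; apply: cvg_EFin; first exact: nearW.
  (* For 0 <= g <= f one has (f - g)^p <= (f - g) f^(p - 1), and the right-hand side tends to 0
     linearly in f - g. *)
  have C0 : (f x - g i x) * (f x `^ (p - 1)) @[i --> \oo] --> 0.
    rewrite -[X in _ --> X](mul0r (f x `^ (p - 1))); apply: cvgMl.
    rewrite -[X in _ --> X](subrr (f x)); apply: cvgB => //; exact: cvg_cst.
  move: C0; apply: squeeze_cvgr; [|exact: cvg_cst].
  apply: nearW => i; rewrite powR_ge0 /= ger0_norm ?subr_ge0//.
  rewrite -mulr_powRB1 ?subr_ge0// ler_wpM2l ?subr_ge0//.
  apply: ge0_ler_powR; rewrite ?nnegrE ?subr_ge0//.
  by rewrite lerBlDr lerDl.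
- apply/integrableP; split=> //; rewrite (eq_integral (fun x => (`|f x| `^ p)%:E))// => x _.
  by rewrite gee0_abs// lee_fin powR_ge0.
- apply/aeW => x i _; rewrite gee0_abs ?lee_fin ?powR_ge0//.
  apply: ge0_ler_powR; rewrite ?nnegrE ?(ltW p0)// !ger0_norm ?subr_ge0//.
  by rewrite lerBlDr lerDl.
rewrite integral0 => /fine_cvgP[[i0 _ hfin] /cvgrPdist_le/(_ _ e0)[i1 _ hi1]].
pose i := maxn i0 i1; exists (g i); split=> //; first exact: (shift_continuous_nnsfun (h i) i).2.
have := hi1 i (leq_maxr _ _); rewrite /= sub0r normrN => h1.
have /= h2 := hfin i (leq_maxl _ _); rewrite -(fineK h2) lee_fin.
exact: le_trans (ler_norm _) h1.
Qed.

Lemma shift_continuous_Lp f : measurable_fun [set: T] f ->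
  (\int[mu]_x (`|f x| `^ p)%:E < +oo)%E -> shift_continuous f.
Proof.
move=> mf foo.
have part (g : T -> R) : measurable_fun [set: T] g -> (forall x, 0 <= g x <= `|f x|) -> shift_continuous g.
  move=> mg gf; apply: (shift_continuous_ge0 mg); first by move=> x; case/andP: (gf x).
  apply: le_lt_trans foo; apply: ge0_le_integral => //; try exact: measurable_powabs.
  move=> x _; rewrite lee_fin; case/andP: (gf x) => g0 g1.
  by apply: ge0_ler_powR; rewrite ?nnegrE ?(ltW p0)// ger0_norm.
pose fp x : R := Num.max (f x) 0; pose fm x : R := Num.max (- f x) 0.
have mfp : measurable_fun [set: T] fp by apply: measurable_maxr => //; exact: measurable_cst.
have mfm : measurable_fun [set: T] fm.
  by apply: measurable_maxr; [exact: measurableT_comp|exact: measurable_cst].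
have -> : f = (fun x => fp x + (-1) * fm x).
  apply/funext => x; rewrite /fp /fm mulN1r; have [h|/ltW h] := leP 0 (f x).
    by rewrite max_r ?oppr_le0// subr0.
  by rewrite max_l ?oppr_ge0// sub0r opprK.
have mfm' : measurable_fun [set: T] (fun x => (-1) * fm x).
  by apply: measurable_funM => //; exact: measurable_cst.
have cp : shift_continuous fp.
  by apply: part => // x; rewrite /fp le_max lexx orbT ge_max normr_ge0 ler_norm.
have cm : shift_continuous fm.
  by apply: part => // x; rewrite /fm le_max lexx orbT ge_max normr_ge0 -normrN ler_norm.
exact: (shift_continuousD mfp mfm' cp (shift_continuousZ (-1) mfm cm)).
Qed.

Lemma integral_reflect (g : T -> \bar R) (x : V) : measurable_fun [set: T] g ->
  (forall y, 0 <= g y)%E -> (\int[mu]_y g (x - (y : V))%R = \int[mu]_y g y)%E.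
Proof.
move=> mg g0.
by rewrite (ge0_integral_sim hN muB (subl_sim x) (subKr x))// oppr0 expr0z mul1e.
Qed.

(** By Tonelli's theorem the integral of the convolution is the product of the two integrals, hence
    finite; so the convolution is finite almost everywhere. *)
Lemma conv_ae_finite g f : measurable_fun [set: T] g -> measurable_fun [set: T] f ->
  (forall x, 0 <= g x) -> (forall x, 0 <= f x) ->
  (\int[mu]_x (g x)%:E < +oo)%E -> (\int[mu]_x (f x)%:E < +oo)%E ->
  {ae mu, forall x : T, (\int[mu]_y (g ((x : V) - y) * f y)%:E < +oo)%E}.
Proof.
move=> mg mf g0 f0 goo foo.
pose F (z : T * T) := (g ((z.1 : V) - (z.2 : V)) * f z.2)%:E.
have mF : measurable_fun [set: T * T] F.
  apply/measurable_EFinP; apply: measurable_funM; last exact: (measurableT_comp mf measurable_snd).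
  exact: measurable_conv_kernel.
have F0 z : (0 <= F z)%E by rewrite lee_fin mulr_ge0.
pose G (x : T) := (\int[mu]_y F (x, y))%E.
have G0 x : (0 <= G x)%E by apply: integral_ge0.
have mG : measurable_fun [set: T] G by exact: measurable_fun_fubini_tonelli_F.
have mgE : measurable_fun [set: T] (fun x => (g x)%:E) by exact/measurable_EFinP.
have mfE : measurable_fun [set: T] (fun x => (f x)%:E) by exact/measurable_EFinP.
have iG : (\int[mu]_x G x < +oo)%E.
  rewrite /G (fubini_tonelli F mF F0).
  have e y : (\int[mu]_x F (x, y) = (\int[mu]_x (g x)%:E) * (f y)%:E)%E.
    rewrite /F /=; under eq_integral do rewrite EFinM.
    have mgy : measurable_fun [set: T] (fun x : T => (g ((x : V) - y))%:E).
      by apply/measurable_EFinP; exact: (measurable_shift y mg).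
    rewrite ge0_integralZr//; [|by move=> x _; rewrite lee_fin|by rewrite lee_fin].
    by rewrite (integral_shift y mgE)// => x; rewrite lee_fin.
  under eq_integral do rewrite e.
  rewrite ge0_integralZl//; last 2 first.
  - by move=> x _; rewrite lee_fin.
  - by apply: integral_ge0 => x _; rewrite lee_fin.
  rewrite lte_mul_pinfty//; first by apply: integral_ge0 => x _; rewrite lee_fin.
  by rewrite ge0_fin_numE//; apply: integral_ge0 => x _; rewrite lee_fin.
have /integrable_ae : mu.-integrable [set: T] G.
  by apply/integrableP; split=> //; under eq_integral do rewrite gee0_abs//.
move=> /(_ measurableT) H; apply: filterS H => x /(_ I).
by rewrite ge0_fin_numE.
Qed.

(* The first inequality of powR_tangent at the mean: Jensen for t |-> t^p. *)
Lemma jensen_powR (w f : T -> R) (c : R) : measurable_fun [set: T] w ->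
  measurable_fun [set: T] f -> (forall y, 0 <= w y) ->
  (\int[mu]_y (w y)%:E = 1)%E ->
  mu.-integrable [set: T] (fun y => (w y * f y)%:E) ->
  ((`|\int[mu]_y (w y * f y) - c| `^ p)%:E <=
   \int[mu]_y (w y * `|f y - c| `^ p)%:E)%E.
Proof.
move=> mw mf w0 w1 wf.
set m := \int[mu]_y (w y * f y); set s := `|m - c|.
have s0 : 0 <= s by rewrite /s.
have mwE : measurable_fun [set: T] (fun y => (w y)%:E) by exact/measurable_EFinP.
have wint : mu.-integrable [set: T] (fun y => (w y)%:E).
  apply/integrableP; split=> //; rewrite (eq_integral (fun y => (w y)%:E)) ?w1 ?ltry// => y _.
  by rewrite gee0_abs// lee_fin.
have wcint : mu.-integrable [set: T] (fun y => (w y * c)%:E).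
  by under eq_fun do rewrite EFinM; exact: integrableZr.
have mfc : measurable_fun [set: T] (fun y => f y - c).
  by apply: measurable_funB => //; exact: measurable_cst.
have e1 : m - c = \int[mu]_y (w y * (f y - c)).
  under eq_Rintegral do rewrite mulrBr.
  rewrite RintegralB// -/m RintegralZr// /Rintegral w1/= mul1r//.
have wfc : mu.-integrable [set: T] (fun y => (w y * (f y - c))%:E).
  by under eq_fun do rewrite mulrBr EFinB; exact: integrableB.
have sle : (s%:E <= \int[mu]_y (w y * `|f y - c|)%:E)%E.
  rewrite /s e1 EFin_normr_Rintegral//; apply: le_trans (le_abse_integral _ _ _) _ => //.
    by case/integrableP: wfc.
  by under eq_integral do rewrite /= normrM (ger0_norm (w0 _)).
have mwabs : measurable_fun [set: T] (fun y => (w y * `|f y - c|)%:E).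
  by apply/measurable_EFinP; apply: measurable_funM => //; exact: measurableT_comp.
have mwp : measurable_fun [set: T] (fun y => (w y * `|f y - c| `^ p)%:E).
  apply/measurable_EFinP; apply: measurable_funM => //.
  apply: (measurableT_comp (measurable_powR p)); exact: measurableT_comp.
pose a := p * s `^ (p - 1).
have a0 : 0 <= a by rewrite mulr_ge0 ?powR_ge0// ltW.
have pm : 0 <= p - 1 by rewrite subr_ge0.
have b0 : 0 <= (p - 1) * s `^ p by rewrite mulr_ge0 ?powR_ge0.
have key : (a%:E * \int[mu]_y (w y * `|f y - c|)%:E <=
    \int[mu]_y (w y * `|f y - c| `^ p)%:E + ((p - 1) * s `^ p)%:E)%E.
  rewrite -ge0_integralZl_EFin//; last by move=> y _; rewrite lee_fin mulr_ge0.
  have -> : ((p - 1) * s `^ p)%:E = (\int[mu]_y (((p - 1) * s `^ p)%:E * (w y)%:E))%E.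
    by rewrite ge0_integralZl_EFin// ?w1 ?mule1// => y _; rewrite lee_fin.
  rewrite -ge0_integralD//; last 3 first.
  - by move=> y _; rewrite lee_fin mulr_ge0 ?powR_ge0.
  - by move=> y _; rewrite -EFinM lee_fin mulr_ge0.
  - exact: measurable_funeM.
  apply: ge0_le_integral => //.
  - by move=> y _; rewrite -EFinM lee_fin mulr_ge0// mulr_ge0.
  - exact: measurable_funeM.
  - by apply: emeasurable_funD => //; exact: measurable_funeM.
  - move=> y _; rewrite -!EFinM -EFinD lee_fin.
    have := ler_wpM2l (w0 y) (powR_tangent p1 s0 (normr_ge0 (f y - c))).
    rewrite mulrDr; have -> : w y * (p * s `^ (p - 1) * `|f y - c|) = a * (w y * `|f y - c|).
      by rewrite /a; ring.
    by rewrite [w y * ((p - 1) * _)]mulrC.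
have I0 : (0 <= \int[mu]_y (w y * `|f y - c| `^ p)%:E)%E.
  by apply: integral_ge0 => y _; rewrite lee_fin mulr_ge0 ?powR_ge0.
have : (a%:E * s%:E <= \int[mu]_y (w y * `|f y - c| `^ p)%:E + ((p - 1) * s `^ p)%:E)%E.
  by apply: le_trans key; apply: lee_wpmul2l => //; rewrite lee_fin.
have -> : (a%:E * s%:E = (p * s `^ p)%:E)%E.
  by rewrite -EFinM /a -mulrA [s `^ _ * s]mulrC mulr_powRB1.
move: I0; case: (\int[mu]_y _)%E => [r| |] //; last by move=> _ _; rewrite leey.
rewrite -EFinD !lee_fin => r0; rewrite mulrBl mul1r; lra.
Qed.

(** For almost every x Jensen's inequality, for the probability density rho (x - .), bounds the p-th
    power of the error by an average of |f y - f x|^p. After y = x - u, Tonelli's theorem turns its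
    integral into the average of the moduli [shift_modulus f u] against rho, and only u in the
    support of rho counts. *)
Lemma approximate_identity rho f (conv : T -> R) (e : R) (k : nat) :
  measurable_fun [set: T] rho -> measurable_fun [set: T] f ->
  measurable_fun [set: T] conv ->
  (forall x, 0 <= rho x) -> (\int[mu]_x (rho x)%:E = 1)%E ->
  (forall x, q%:R ^ (- k%:Z) < N x -> rho x = 0) ->
  (forall u, N u <= q%:R ^ (- k%:Z) -> (shift_modulus f u <= e%:E)%E) ->
  {ae mu, forall x : T,
     mu.-integrable [set: T] (fun y => (rho ((x : V) - y) * f y)%:E) /\
     conv x = \int[mu]_y (rho ((x : V) - y) * f y)} ->
  (\int[mu]_x (`|conv x - f x| `^ p)%:E <= e%:E)%E.
Proof.
move=> mrho mf mconv rho0 rho1 supp mod hconv.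
have mrhoE : measurable_fun [set: T] (fun x => (rho x)%:E) by exact/measurable_EFinP.
pose J (x y : T) := (rho ((x : V) - y) * `|f y - f x| `^ p)%:E.
have mpow (g : T * T -> R) : measurable_fun [set: T * T] g ->
    measurable_fun [set: T * T] (fun z => `|g z| `^ p).
  move=> mg; apply: (measurableT_comp (measurable_powR p)).
  exact: measurableT_comp.
have mJ : measurable_fun [set: T * T] (fun z => J z.1 z.2).
  apply/measurable_EFinP; apply: measurable_funM; first exact: measurable_conv_kernel.
  apply: mpow; apply: measurable_funB.
    exact: (measurableT_comp mf measurable_snd).
  exact: (measurableT_comp mf measurable_fst).
have J0 x y : (0 <= J x y)%E by rewrite lee_fin mulr_ge0 ?powR_ge0.
pose F (z : T * T) := (rho z.2 * `|f ((z.1 : V) - z.2) - f z.1| `^ p)%:E.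
have mF : measurable_fun [set: T * T] F.
  apply/measurable_EFinP; apply: measurable_funM; first exact: (measurableT_comp mrho measurable_snd).
  apply: mpow; apply: measurable_funB; first exact: measurable_conv_kernel.
  exact: (measurableT_comp mf measurable_fst).
have F0 z : (0 <= F z)%E by rewrite lee_fin mulr_ge0 ?powR_ge0.
have JF x : (\int[mu]_y J x y = \int[mu]_u F (x, u))%E.
  have mFx : measurable_fun [set: T] (fun u => F (x, u)).
    exact: measurableT_comp mF (measurable_pair1 x).
  have <- := integral_reflect x mFx (fun u => F0 (x, u)).
  apply: eq_integral => y _; rewrite /J /F /=; congr (_ * `|f _ - _| `^ p)%:E.
  by rewrite subKr.
apply: (@le_trans _ _ (\int[mu]_x \int[mu]_u F (x, u))%E).
  apply: ae_ge0_le_integral => //.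
  - by apply: measurable_powabs; exact: measurable_funB.
  - by move=> x _; exact: integral_ge0.
  - exact: measurable_fun_fubini_tonelli_F.
  - apply: filterS hconv => x [xi ->] _; rewrite -JF.
    apply: (jensen_powR (w := fun y : T => rho ((x : V) - y))) => //.
      exact: (measurableT_comp mrho (measurable_subl x)).
    by rewrite (integral_reflect (g := fun u => (rho u)%:E) x)// => y; rewrite lee_fin.
rewrite (fubini_tonelli F mF F0).
apply: (@le_trans _ _ (\int[mu]_u ((rho u)%:E * e%:E))%E); last first.
  rewrite ge0_integralZr//; last 2 first.
  - by move=> x _; rewrite lee_fin.
  - have := mod 0; rewrite (un0 hN) (ltW (qX_gt0 hN _)) => /(_ isT); apply: le_trans.
    by apply: integral_ge0 => x _; rewrite lee_fin powR_ge0.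
  by rewrite rho1 mul1e.
have e0 : (0 <= e%:E)%E.
  have := mod 0; rewrite (un0 hN) (ltW (qX_gt0 hN _)) => /(_ isT); apply: le_trans.
  by apply: integral_ge0 => x _; rewrite lee_fin powR_ge0.
apply: ge0_le_integral => //.
- by move=> u _; exact: integral_ge0.
- exact: measurable_fun_fubini_tonelli_G.
- by under eq_fun do rewrite muleC; exact: measurable_funeM.
- move=> u _; have [uk|uk] := leP (N u) (q%:R ^ (- k%:Z)); last first.
    rewrite (supp _ uk) mul0e /F /=; under eq_integral do rewrite (supp _ uk) mul0r.
    by rewrite integral0.
  rewrite /F /=; under eq_integral do rewrite EFinM.
  rewrite ge0_integralZl_EFin//; last first.
  + apply: measurable_powabs; apply: measurable_funB => //.
    exact: measurable_shift.
  by apply: lee_wpmul2l; [rewrite lee_fin|exact: mod].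
Qed.

End Translation.

(** * Truncated inversion of radial potentials *)

(** The integrals of the two parts of [G] are measurable by Tonelli's theorem, and [fine] is
    measurable on all extended reals, so divergence at some points does no harm. *)
Lemma measurable_Rintegral_param d1 d2 (T1 : measurableType d1)
    (T2 : measurableType d2) (R : realType)
    (m2 : {sigma_finite_measure set T2 -> \bar R}) (G : T1 * T2 -> R) :
  measurable_fun [set: T1 * T2] G ->
  measurable_fun [set: T1] (fun x => \int[m2]_y G (x, y)).
Proof.
move=> mG; have mEG : measurable_fun [set: T1 * T2] (EFin \o G).
  exact/measurable_EFinP.
apply: (measurableT_comp (fine_measurable measurableT)).
rewrite (_ : (fun x => _) = (fun x => (\int[m2]_y (EFin \o G)^\+ (x, y)) -
    (\int[m2]_y (EFin \o G)^\- (x, y)))%E); last first.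
  apply/funext => x; rewrite integralE; congr (_ - _)%E.
    by apply: eq_integral => y _; rewrite !funeposE.
  by apply: eq_integral => y _; rewrite !funenegE.
apply: emeasurable_funB.
  by apply: measurable_fun_fubini_tonelli_F => //; exact: measurable_funepos.
by apply: measurable_fun_fubini_tonelli_F => //; exact: measurable_funeneg.
Qed.

Lemma ae_eq_integrable d (T : measurableType d) (R : realType)
    (mu : {measure set T -> \bar R}) (f g : T -> \bar R) :
  measurable_fun [set: T] g -> {ae mu, forall x, f x = g x} ->
  mu.-integrable [set: T] f -> mu.-integrable [set: T] g.
Proof.
move=> mg fg /integrableP[mf foo]; apply/integrableP; split=> //.
rewrite (ae_eq_integral (fun x => `|f x|%E))//; try exact: measurableT_comp.
by apply: filterS fg => x e _; rewrite e.
Qed.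

Lemma subzS (i : int) (p : nat) : i - p.+1%:Z = i - 1 - p%:Z.
Proof. lia. Qed.

Lemma int_leP (i j : int) : i <= j -> exists p : nat, j = i + p%:Z.
Proof. by move=> ij; exists `|j - i|%N; lia. Qed.

(* kap takes the value k i on the sphere N = q^i, and k has geometric increments.
   Both Riesz kernels are of this form, with A = q^alpha: - N^(alpha - n), where
   D = 1 - q^(alpha - n), and log N^n, where alpha = n and D = log q^n. The weight
   h is N^(- n - alpha), the kernel of the hypersingular integral. *)
Record radial_kernel (R : realType) (V : zmodType) (N : V -> R) (q n : nat)
    (A D : R) (k : int -> R) (kap h : borel N -> R) : Prop := RadialKernel {
  rk_A_gt1 : 1 < A;
  rk_A_le : A <= q%:R ^+ n;
  rk_D_gt0 : 0 < D;
  rk_step : forall i : int, k (i + 1) = k i + D * A ^ i / (q%:R ^+ n) ^ i;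
  rk_measurable : measurable_fun [set: borel N] kap;
  rk_shell : forall i x, ushell N q i x -> kap x = k i;
  rk_weight_measurable : measurable_fun [set: borel N] h;
  rk_weight_shell : forall i x, ushell N q i x ->
    h x = (A ^ i)^-1 * ((q%:R ^+ n) ^ i)^-1 }.

Arguments radial_kernel {R V} N q n A D k kap h.

Section Inversion.
Context (R : realType) (V : zmodType) (N : V -> R) (q n : nat).
Hypothesis (n_gt0 : (0 < n)%N) (hN : ultranorm N q).
Local Notation T := (borel N).
Local Notation B := (uball N q).
Local Notation S := (ushell N q).
Variable mu : {sigma_finite_measure set T -> \bar R}.
Hypothesis muB : forall k a, mu (B k a) = ((q%:R ^+ n) ^ k)%:E.
Local Notation Q := (q%:R ^+ n : R).

Variables (A D : R) (k : int -> R) (kap h : T -> R).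
Hypothesis hk : radial_kernel N q n A D k kap h.
Implicit Types (i j m : int) (f : T -> R).

Let A_gt1 : 1 < A. Proof. by case: hk. Qed.
Let AQ : A <= Q. Proof. by case: hk. Qed.
Let D_gt0 : 0 < D. Proof. by case: hk. Qed.
Let kD : forall i, k (i + 1) = k i + D * A ^ i / Q ^ i. Proof. by case: hk. Qed.
Let mkap : measurable_fun [set: T] kap. Proof. by case: hk. Qed.
Let kapE : forall i x, S i x -> kap x = k i. Proof. by case: hk. Qed.
Let mh : measurable_fun [set: T] h. Proof. by case: hk. Qed.
Let hE : forall i x, S i x -> h x = (A ^ i)^-1 * (Q ^ i)^-1.
Proof. by case: hk. Qed.
Let Q1 : 1 < Q. Proof. exact: Q_gt1 n_gt0 hN. Qed.
Let Q0 : 0 < Q. Proof. exact: Q_gt0 n_gt0 hN. Qed.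
Let A0 : 0 < A. Proof. exact: lt_trans ltr01 A_gt1. Qed.
Let An0 : A != 0. Proof. by rewrite gt_eqF. Qed.
Let Qn0 : Q != 0. Proof. by rewrite gt_eqF. Qed.
Let Az0 i : 0 < A ^ i. Proof. exact: exprz_gt0. Qed.
Let Qz0 i : 0 < Q ^ i. Proof. exact: exprz_gt0. Qed.

Let XB (x : R) i : x != 0 -> x ^ (i - 1) = x ^ i / x.
Proof. by move=> x0; rewrite expfzDr// exprN1. Qed.

Let XD (x : R) i : x != 0 -> x ^ (i + 1) = x ^ i * x.
Proof. by move=> x0; rewrite expfzDr// expr1z. Qed.

(** With s = sqrt x, Bernoulli's inequality gives m (s - 1) <= s^m, hence m / x^m <= s^(- m) / (s -
    1). *)
Lemma cvg_natM_exprV (x : R) : 1 < x -> m%:R * x ^- m @[m --> \oo] --> 0.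
Proof.
move=> x1; pose s := Num.sqrt x.
have s1 : 1 < s by rewrite -(sqrtr1 R) ltr_sqrt ?(lt_trans ltr01).
have s0 : 0 < s by rewrite (lt_trans ltr01).
have bern (p : nat) : 1 + p%:R * (s - 1) <= s ^+ p.
  elim: p => [|p ih]; first by rewrite mul0r addr0.
  rewrite exprS; apply: le_trans (_ : s * (1 + p%:R * (s - 1)) <= _); last by rewrite ler_wpM2l// ltW.
  rewrite -natr1; have : 0 <= p%:R * (s - 1) * (s - 1).
    by rewrite !mulr_ge0// subr_ge0 ltW.
  by lra.
have : (s - 1)^-1 * s^-1 ^+ m @[m --> \oo] --> (s - 1)^-1 * 0.
  by apply: cvgMr; apply: cvg_expr; rewrite ger0_norm ?invf_lt1// invr_ge0 ltW.
rewrite mulr0; apply: squeeze_cvgr; [|exact: cvg_cst].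
apply: nearW => p; apply/andP; split.
  by rewrite mulr_ge0// invr_ge0 exprn_ge0// ltW// (lt_trans ltr01).
have -> : x = s * s by rewrite -expr2 sqr_sqrtr// ltW// (lt_trans ltr01).
rewrite exprMn invfM mulrA exprVn ler_pM2r ?invr_gt0 ?exprn_gt0//.
rewrite ler_pdivrMr ?exprn_gt0// ler_pdivlMl ?subr_gt0// mulrC.
by apply: le_trans (bern p); rewrite lerDr.
Qed.

Lemma k_step i (p : nat) : k i <= k (i + p%:Z).
Proof.
elim: p => [|p ih]; first by rewrite addr0.
apply: le_trans ih _; have -> : i + p.+1%:Z = i + p%:Z + 1 by lia.
by rewrite kD lerDl divr_ge0 ?ltW// mulr_gt0.
Qed.

Lemma k_le i j : i <= j -> k i <= k j.
Proof. by move=> ij; have [p ->] := int_leP ij; exact: k_step. Qed.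

Lemma AQ_anti i j : i <= j -> A ^ j / Q ^ j <= A ^ i / Q ^ i.
Proof.
move=> ij; have [p ->] := int_leP ij.
elim: p => [|p ih]; first by rewrite addr0.
apply: le_trans ih; have -> : i + p.+1%:Z = i + p%:Z + 1 by lia.
rewrite !XD// invfM mulrACA ger_pMr ?divr_gt0//.
by rewrite ler_pdivrMr// mul1r.
Qed.

(** The increments D (A / Q)^i do not increase with i because A <= Q, so k grows at most linearly in
    i; the logarithm attains this. The limits below then reduce to m / A^m tending to 0. *)
Lemma k_upper i (p : nat) : k (i + p%:Z) <= k i + p%:R * (D * A ^ i / Q ^ i).
Proof.
elim: p => [|p ih]; first by rewrite addr0 mul0r addr0.
have -> : i + p.+1%:Z = i + p%:Z + 1 by lia.
rewrite kD -natr1 mulrDl mul1r addrA lerD// -!mulrA ler_pM2l//.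
by apply: AQ_anti; lia.
Qed.

Lemma cvg_expzB (x : R) i : 1 < x -> x ^ (i - p%:Z) @[p --> \oo] --> 0.
Proof.
move=> x1; have x0 : 0 < x by rewrite (lt_trans ltr01).
have -> : (fun p : nat => x ^ (i - p%:Z)) = (fun p => x ^ i * x^-1 ^+ p).
  by apply/funext => p; rewrite expfzDr ?gt_eqF// -invr_expz exprVn.
rewrite -[X in _ --> X](mulr0 (x ^ i)); apply: cvgMr; apply: cvg_expr.
by rewrite ger0_norm ?invf_lt1// invr_ge0 ltW.
Qed.

Lemma cvg_k_ball j :
  (k j - k (j - p%:Z)) * Q ^ (j - p%:Z) @[p --> \oo] --> 0.
Proof.
have : D * A ^ j * (p%:R * A ^- p) @[p --> \oo] --> D * A ^ j * 0.
  by apply: cvgMr; exact: cvg_natM_exprV.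
rewrite mulr0; apply: squeeze_cvgr; [|exact: cvg_cst].
apply: nearW => p; apply/andP; split.
  by rewrite mulr_ge0 ?(ltW (Qz0 _))// subr_ge0; apply: k_le; lia.
have -> : D * A ^ j * (p%:R * A ^- p) =
    p%:R * (D * A ^ (j - p%:Z) / Q ^ (j - p%:Z)) * Q ^ (j - p%:Z).
  rewrite !mulrA mulfVK ?gt_eqF// expfzDr// -invr_expz -exprnP; ring.
rewrite ler_pM2r// lerBlDr addrC.
by have := k_upper (j - p%:Z) p; rewrite subrK.
Qed.

Lemma cvg_k_out i j : i <= j ->
  (A ^ (j + p%:Z))^-1 * (k (j + p%:Z) - k i) @[p --> \oo] --> 0.
Proof.
move=> ij.
have : (A ^ j)^-1 * ((k j - k i) * A^-1 ^+ p + (D * A ^ j / Q ^ j) * (p%:R * A ^- p))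
    @[p --> \oo] --> (A ^ j)^-1 * ((k j - k i) * 0 + (D * A ^ j / Q ^ j) * 0).
  apply: cvgMr; apply: cvgD; apply: cvgMr; last exact: cvg_natM_exprV.
  by apply: cvg_expr; rewrite ger0_norm ?invf_lt1// invr_ge0 ltW.
rewrite !mulr0 addr0 mulr0; apply: squeeze_cvgr; [|exact: cvg_cst].
apply: nearW => p; apply/andP; split.
  by rewrite mulr_ge0 ?invr_ge0 ?(ltW (Az0 _))// subr_ge0; apply: k_le; lia.
have -> : (A ^ j)^-1 * ((k j - k i) * A^-1 ^+ p + (D * A ^ j / Q ^ j) * (p%:R * A ^- p)) =
    (A ^ (j + p%:Z))^-1 * (k j - k i + p%:R * (D * A ^ j / Q ^ j)).
  rewrite expfzDr// -exprnP exprVn invfM; ring.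
rewrite ler_pM2l ?invr_gt0// -addrA [- k i + _]addrC addrA lerB//.
exact: k_upper.
Qed.

Let Am1 : A - 1 != 0. Proof. by rewrite subr_eq0 gt_eqF. Qed.

Lemma kB i : k (i - 1) = k i - D * (A ^ i / A) / (Q ^ i / Q).
Proof. by rewrite -{2}(subrK 1 i) kD -!XB// addrK. Qed.

(** Summation by parts. The boundary term is (k j - k i) Q^i; the increment of k at l times Q^l is D
    A^l, and the sum of D A^l over l < i is D A^i / (A - 1). *)
Let Fball j i : R := (k j - k i) * Q ^ i + D * A ^ i / (A - 1).

Let Fball_rec j i : (k j - k i) * (Q ^ i - Q ^ (i - 1)) = Fball j i - Fball j (i - 1).
Proof.
rewrite /Fball kB !XB//; have := gt_eqF (Qz0 i); have := gt_eqF (Az0 i).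
move: (Q ^ i) (A ^ i) (k i) (k j) Am1 => x y a b Am1' y0 x0; field.
by rewrite x0 Qn0 An0 Am1'.
Qed.

Let Fball_cvg j : Fball j (j - p%:Z) @[p --> \oo] --> 0.
Proof.
rewrite -[X in _ --> X](addr0 0); apply: cvgD; first exact: cvg_k_ball.
rewrite (_ : (fun p : nat => _) = (fun p : nat => (D / (A - 1)) * A ^ (j - p%:Z))); last first.
  by apply/funext => p; rewrite mulrAC.
by rewrite -[X in _ --> X](mulr0 (D / (A - 1))); apply: cvgMr; exact: cvg_expzB.
Qed.

Lemma integral_ball_kernel j :
  (\int[mu]_(x in B j 0) (k j - kap x)%:E = (D * A ^ j / (A - 1))%:E)%E.
Proof.
rewrite (@integral_uball _ _ _ _ _ n_gt0 hN _ muB _ (fun i => k j - k i) (Fball j)).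
- by rewrite /Fball subrr mul0r add0r.
- by apply: measurable_funB => //; exact: measurable_cst.
- by move=> i ij; rewrite subr_ge0 k_le.
- by move=> i x ij /kapE ->.
- by move=> i _; exact: Fball_rec.
- exact: Fball_cvg.
Qed.

Lemma integral_ball_abs_kernel j :
  (\int[mu]_(x in B j 0) `|k j - kap x|%:E = (D * A ^ j / (A - 1))%:E)%E.
Proof.
rewrite (@integral_uball _ _ _ _ _ n_gt0 hN _ muB _ (fun i => k j - k i) (Fball j)).
- by rewrite /Fball subrr mul0r add0r.
- apply: measurableT_comp => //.
  by apply: measurable_funB => //; exact: measurable_cst.
- by move=> i ij; rewrite subr_ge0 k_le.
- by move=> i x ij /kapE ->; rewrite ger0_norm// subr_ge0 k_le.
- by move=> i _; exact: Fball_rec.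
- exact: Fball_cvg.
Qed.

(** [kerc m] is the integral of h over N >= q^m, and [kerd m] that of (kap - k m) h over the same
    set: the latter is, by summation by parts, the sum over i > m of the increment k i - k (i - 1)
    times [kerc i]. *)
Definition kerc m : R := (A ^ m)^-1 * ((1 - Q^-1) / (1 - A^-1)).
Definition kerd m : R := (Q ^ m)^-1 * (D / (A - 1)).

Lemma kerc_ge0 m : 0 <= kerc m.
Proof.
by rewrite /kerc mulr_ge0 ?invr_ge0 ?(ltW (Az0 _))// divr_ge0 ?subr_ge0 ?invf_le1 ?ltW.
Qed.

Lemma kerd_ge0 m : 0 <= kerd m.
Proof.
by rewrite /kerd mulr_ge0 ?invr_ge0 ?(ltW (Qz0 _))// divr_ge0 ?subr_ge0 ?ltW.
Qed.

Let Fout j i : R := kerc i * (k i - k j) + kerd i.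

Let Am1' : 1 - A^-1 != 0.
Proof. by rewrite subr_eq0 eq_sym invr_eq1 gt_eqF. Qed.

Let Fout_rec j i : (k i - k j) * ((A ^ i)^-1 * (Q ^ i)^-1) * (Q ^ i - Q ^ (i - 1)) =
  Fout j i - Fout j (i + 1).
Proof.
rewrite /Fout /kerc /kerd kD !XD// !XB//; have := gt_eqF (Qz0 i); have := gt_eqF (Az0 i).
move: (Q ^ i) (A ^ i) (k i) (k j) Am1 Am1' => x y a b h1 h2 y0 x0; field.
by rewrite x0 Qn0 An0 h1 y0.
Qed.

Let Fout_cvg i j : j <= i -> Fout j (i + p%:Z) @[p --> \oo] --> 0.
Proof.
move=> ji; rewrite -[X in _ --> X](addr0 0); apply: cvgD.
  rewrite -[X in _ --> X](mulr0 ((1 - Q^-1) / (1 - A^-1))).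
  rewrite (_ : (fun p : nat => _) = (fun p : nat => ((1 - Q^-1) / (1 - A^-1)) *
    ((A ^ (i + p%:Z))^-1 * (k (i + p%:Z) - k j)))); last first.
    by apply/funext => p; rewrite /kerc [X in _ = X]mulrCA mulrA.
  by apply: cvgMr; exact: cvg_k_out.
rewrite -[X in _ --> X](mul0r (D / (A - 1))); apply: cvgMl.
rewrite (_ : (fun p : nat => _) = (fun p : nat => Q ^ (- i - p%:Z))); first exact: cvg_expzB.
by apply/funext => p; rewrite invr_expz opprD.
Qed.

Lemma integral_out_kernel i j : j <= i ->
  (\int[mu]_(x in uout N q i 0) ((kap x - k j) * h x)%:E =
   (kerc i * (k i - k j) + kerd i)%:E)%E.
Proof.
move=> ji; rewrite (@integral_uout _ _ _ _ _ n_gt0 hN _ muB _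
  (fun i => (k i - k j) * ((A ^ i)^-1 * (Q ^ i)^-1)) (Fout j))//.
- apply: measurable_funM => //.
  by apply: measurable_funB => //; exact: measurable_cst.
- move=> l il; rewrite mulr_ge0 ?mulr_ge0 ?invr_ge0 ?(ltW (Az0 _)) ?(ltW (Qz0 _))//.
  by rewrite subr_ge0 k_le// (le_trans ji).
- by move=> l x il xl; rewrite (kapE xl) (hE xl).
- exact: Fout_cvg.
Qed.

(** The ball of radius q^(m - 1) is the set N < q^m, the support of the kernel [kerval m] below. The
    value does not depend on m, so one constant normalizes all truncations. *)
Lemma integral_kernel_mass m :
  (\int[mu]_(x in B (m - 1) 0) (kerc m * (k m - kap x) + kerd m)%:E =
   (D / (A - 1) * ((1 - A^-1 * Q^-1) / (1 - A^-1)))%:E)%E.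
Proof.
have kerc0 := kerc_ge0 m.
have kerd0 := kerd_ge0 m.
pose F i := kerc m * Fball m i + kerd m * Q ^ i.
rewrite (@integral_uball _ _ _ _ _ n_gt0 hN _ muB _
  (fun i => kerc m * (k m - k i) + kerd m) F).
- congr EFin; rewrite /F /Fball /kerc /kerd kB !XB//.
  have := gt_eqF (Qz0 m); have := gt_eqF (Az0 m).
  move: (Q ^ m) (A ^ m) (k m) Am1 Am1' => x y a h1 h2 y0 x0; field.
  by rewrite x0 Qn0 An0 h1 y0.
- apply: measurable_funD; last exact: measurable_cst.
  apply: measurable_funM; first exact: measurable_cst.
  by apply: measurable_funB => //; exact: measurable_cst.
- by move=> i ij; rewrite addr_ge0// mulr_ge0// subr_ge0 k_le//; clear -ij; lia.
- by move=> i x ij /kapE ->.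
- move=> i ij; rewrite mulrDl -mulrA Fball_rec /F; ring.
- rewrite /F -[X in _ --> X](addr0 0); apply: cvgD.
    rewrite -[X in _ --> X](mulr0 (kerc m)); apply: cvgMr.
    (* The spheres start at radius q^(m - 1), while the primitive refers to [k m]: the known limit
       is used with its index shifted by one. *)
    have := Fball_cvg m; rewrite -cvg_shiftS /= => H.
    rewrite (_ : (fun p : nat => _) = (fun p : nat => Fball m (m - p.+1%:Z)))//.
    by apply/funext => p; rewrite subzS.
  by rewrite -[X in _ --> X](mulr0 (kerd m)); apply: cvgMr; exact: cvg_expzB.
Qed.

Definition kerval m (u : T) : R :=
  if N u < q%:R ^ m then kerc m * (k m - kap u) + kerd m else 0.

(* Bounds the absolute integral of kerdiff m u, which does not vanish where its
   integral kerval m u does. *)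
Definition kerbound m (u : T) : R :=
  if N u < q%:R ^ m then kerc m * (k m - kap u) + kerd m
  else (2 * (D / (A - 1))) * (N u ^+ n)^-1.

(** For u = x - y and t = z - x one has t + u = z - y, so this is the function of z to be integrated
    after the exchange of integrals. For u <> 0 its integral is [kerval m u]. *)
Definition kerdiff m (u t : T) : R :=
  (kap ((t : V) + u) - kap u) * h t * \1_(uout N q m 0) t.

Let measurable_addr (u : V) : measurable_fun [set: T] (fun t : T => (t : V) + u : T).
Proof.
apply: (measurable_sim hN (phi := fun x => x + u) (j := 0)) => x y.
by rewrite expr0z mul1r opprD addrACA subrr addr0.
Qed.

Lemma measurable_kerdiff m u : measurable_fun [set: T] (kerdiff m u).
Proof.
apply: measurable_funM; last by apply: measurable_indic; exact: (measurable_uout hN).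
apply: measurable_funM => //; apply: measurable_funB; last exact: measurable_cst.
by apply: (measurableT_comp mkap); exact: measurable_addr.
Qed.

Let uout0E m (t : T) : uout N q m 0 t = (q%:R ^ m <= N t) :> Prop.
Proof. by rewrite /uout/= subr0. Qed.

Let uball0E m (t : T) : B m 0 t = (N t <= q%:R ^ m) :> Prop.
Proof. by rewrite /uball/= subr0. Qed.

Let indE (E : set T) (t : T) (b : bool) : E t = b :> Prop -> \1_E t = b%:R :> R.
Proof.
move=> e; rewrite indicE; have -> // : (t \in E) = b.
by apply/idP/idP => [/set_mem|eb]; [rewrite e|apply/mem_set; rewrite e].
Qed.

(** On the domain N t >= q^m > N u, so N (t + u) = N t: the integrand is radial in t and
    nonnegative, as kap increases with N. *)
Lemma kerdiff_small j m u : S j u -> j < m ->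
  (\int[mu]_t `|kerdiff m u t|%:E = (kerval m u)%:E)%E /\
  \int[mu]_t kerdiff m u t = kerval m u.
Proof.
move=> uj jm.
have mE : measurable (uout N q m 0) by exact: (measurable_uout hN).
have e t : kerdiff m u t = (kap t - k j) * h t * \1_(uout N q m 0) t.
  rewrite /kerdiff (indE (uout0E m t)); case: (leP _ _) => [mt|]; rewrite ?mulr0// !mulr1.
  have ut : N u < N t by rewrite uj; apply: lt_le_trans mt; rewrite (qX_lt hN).
  have t0 : (t : V) <> 0.
    by move=> t0; move: ut; rewrite t0 (un0 hN) ltNge (un_ge0 hN).
  have [i ti] := un_val hN t0.
  by rewrite (kapE uj) (kapE ti) (kapE (i := i))// /ushell/= (un_doml hN).
have e2 t : `|kerdiff m u t| = (kap t - k j) * h t * \1_(uout N q m 0) t.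
  rewrite e (indE (uout0E m t)); case: (leP _ _) => [mt|]; rewrite ?mulr0 ?normr0// !mulr1.
  have t0 : (t : V) <> 0.
    by move=> t0; move: mt; rewrite t0 (un0 hN) leNgt (qX_gt0 hN).
  have [i ti] := un_val hN t0; rewrite (kapE ti) (hE ti) ger0_norm//.
  rewrite mulr_ge0 ?mulr_ge0 ?invr_ge0 ?(ltW (Az0 _)) ?(ltW (Qz0 _))//.
  by rewrite subr_ge0 k_le// ltW// (lt_le_trans jm)// -(qX_le hN) -ti.
have v : kerval m u = kerc m * (k m - k j) + kerd m.
  by rewrite /kerval uj (qX_lt hN) jm (kapE uj).
have I : (\int[mu]_t ((kap t - k j) * h t * \1_(uout N q m 0) t)%:E =
    (kerval m u)%:E)%E.
  by rewrite integral_mul_indic// integral_out_kernel ?ltW// v.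
split; first by rewrite -I; apply: eq_integral => t _; rewrite -e2.
rewrite /Rintegral -[RHS]/(fine (kerval m u)%:E) -I; congr fine.
by apply: eq_integral => t _; rewrite e.
Qed.

(** Compare N t with N u = q^j. Where N t < N u the integrand vanishes, since N (t + u) = N u. Where
    N t > N u it is the radial function (kap t - k j) h t. Where N t = N u the weight h is constant,
    and the integral of kap (t + u) - k j is that of kap - k j over the whole ball of radius q^j.
    The last two contributions are opposite, which gives the value 0 and the factor 2 in
    [kerbound]. *)
Lemma kerdiff_large j m u : S j u -> m <= j ->
  (\int[mu]_t `|kerdiff m u t|%:E <= (kerbound m u)%:E)%E /\
  \int[mu]_t kerdiff m u t = 0.
Proof.
move=> uj mj.
(* The cancellation: on the left the contribution of N t > q^j, on the right the value of h on the
   sphere q^j times the integral of k j - kap over the ball. *)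
have Dj : kerc (j + 1) * (k (j + 1) - k j) + kerd (j + 1) =
    (A ^ j)^-1 * (Q ^ j)^-1 * (D * A ^ j / (A - 1)).
  rewrite /kerc /kerd kD !XD//; have := gt_eqF (Qz0 j); have := gt_eqF (Az0 j).
  move: (Q ^ j) (A ^ j) (k j) Am1 Am1' => x y a h1 h2 y0 x0; field.
  by rewrite x0 Qn0 An0 h1 y0.
have mE : measurable (uout N q (j + 1) 0) by exact: (measurable_uout hN).
have mB : measurable (B j 0) by exact: measurable_uball.
pose I1 (t : T) := (kap t - k j) * h t * \1_(uout N q (j + 1) 0) t.
pose phi (s : T) := (k j - kap s) * \1_(B j 0) s.
pose hj := (A ^ j)^-1 * (Q ^ j)^-1.
have hj0 : 0 < hj by rewrite mulr_gt0 ?invr_gt0.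
(* The condition N (t + u) <= q^j in [phi] also admits N t < q^j, but there N (t + u) = q^j and the
   factor k j - kap (t + u) is 0. *)
have e t : kerdiff m u t = I1 t - hj * phi ((t : V) + u).
  rewrite /kerdiff /I1 /phi (indE (uout0E m t)) (indE (uout0E (j + 1) t)).
  rewrite (indE (uball0E j _)) (kapE uj).
  have [t0|/eqP t0] := eqVneq (t : V) 0.
    rewrite t0 add0r (un0 hN) (kapE uj) subrr !mul0r.
    have -> : (q%:R ^ (j + 1) <= 0 :> R) = false by rewrite leNgt (qX_gt0 hN).
    by rewrite !mulr0 subr0.
  have [i ti] := un_val hN t0; rewrite ti !(qX_le hN).
  have [ij|ji|ij] := ltgtP i j.
  - have tu : N ((t : V) + u) = q%:R ^ j by rewrite (un_domr hN) ?uj// ti (qX_lt hN).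
    rewrite tu lexx (kapE (i := j))// subrr !mul0r mulr0 subr0.
    rewrite lezD1 (lt_gtF ij).
    by rewrite mulr0.
  - have tu : N ((t : V) + u) = q%:R ^ i by rewrite (un_doml hN) ?ti// uj (qX_lt hN).
    rewrite tu (qX_le hN) (kapE (i := i) (x := (t : V) + u))// (kapE ti).
    rewrite (le_trans mj (ltW ji)) lezD1 ji [i <= j]leNgt ji /=.
    by rewrite !mulr1 !mulr0 subr0.
  - have tu : N ((t : V) + u) <= q%:R ^ j by rewrite (un_le hN)// ?ti ?uj ?ij.
    rewrite tu (hE ti) ij mj; rewrite lezD1 ltxx.
    by rewrite mulr0 sub0r !mulr1 /hj -mulrN opprB mulrC.
have m1 : measurable_fun [set: T] I1.
  apply: measurable_funM; last exact/measurable_indic.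
  apply: measurable_funM => //; apply: measurable_funB => //; exact: measurable_cst.
have mphi : measurable_fun [set: T] phi.
  apply: measurable_funM; last exact/measurable_indic.
  apply: measurable_funB => //; exact: measurable_cst.
have sim x y : N (x + u - (y + u)) = q%:R ^ 0 * N (x - y).
  by rewrite expr0z mul1r opprD addrACA subrr addr0.
have I1abs : (\int[mu]_t `|I1 t|%:E = (hj * (D * A ^ j / (A - 1)))%:E)%E.
  rewrite -Dj -integral_out_kernel; last by rewrite lerDl.
  rewrite -[RHS]integral_mul_indic//; apply: eq_integral => t _; congr EFin.
  rewrite /I1 (indE (uout0E (j + 1) t)); case: (leP _ _) => [mt|]; rewrite ?mulr0 ?normr0//.
  have t0 : (t : V) <> 0.
    by move=> t0; move: mt; rewrite t0 (un0 hN) leNgt (qX_gt0 hN).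
  have [i ti] := un_val hN t0; rewrite (kapE ti) (hE ti) mulr1 ger0_norm//.
  rewrite mulr_ge0 ?mulr_ge0 ?invr_ge0 ?(ltW (Az0 _)) ?(ltW (Qz0 _))//.
  by rewrite subr_ge0 k_le//; move: mt; rewrite ti (qX_le hN); lia.
have I1int : mu.-integrable [set: T] (EFin \o I1).
  apply/integrableP; split; first exact/measurable_EFinP.
  by under eq_integral do rewrite /= ; rewrite I1abs ltry.
have I1val : \int[mu]_t I1 t = hj * (D * A ^ j / (A - 1)).
  rewrite /Rintegral /I1 integral_mul_indic// integral_out_kernel; last by rewrite lerDl.
  by rewrite Dj.
have phiabs : (\int[mu]_t `|phi t|%:E = (D * A ^ j / (A - 1))%:E)%E.
  rewrite -integral_ball_abs_kernel -[RHS]integral_mul_indic//; apply: eq_integral => t _.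
  by rewrite /phi normrM [X in _ * X]ger0_norm// indicE.
have phiint : mu.-integrable [set: T] (EFin \o phi).
  apply/integrableP; split; first exact/measurable_EFinP.
  by under eq_integral do rewrite /= ; rewrite phiabs ltry.
have phival : \int[mu]_t phi t = D * A ^ j / (A - 1).
  by rewrite /Rintegral /phi integral_mul_indic// integral_ball_kernel.
pose phiu (t : T) := phi ((t : V) + u).
have phiuint : mu.-integrable [set: T] (EFin \o phiu).
  exact: (integrable_sim hN muB sim (subrK u) mphi).1 phiint.
have phiuval : \int[mu]_t phiu t = D * A ^ j / (A - 1).
  by rewrite /phiu (Rintegral_sim hN muB sim (subrK u))// oppr0 expr0z mul1r.
have phiuabs : (\int[mu]_t `|phiu t|%:E = (D * A ^ j / (A - 1))%:E)%E.
  rewrite /phiu (ge0_integral_sim hN muB sim (subrK u) (f := fun t => `|phi t|%:E))//.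
    by rewrite oppr0 expr0z mul1e.
  by apply/measurable_EFinP; exact: measurableT_comp.
have hphiint : mu.-integrable [set: T] (EFin \o (fun t => hj * phiu t)).
  by rewrite (_ : _ \o _ = (fun t => hj%:E * (EFin \o phiu) t)%E)//; exact: integrableZl.
split; last first.
  have -> : \int[mu]_t kerdiff m u t = \int[mu]_t (I1 t - hj * phiu t).
    by apply: eq_Rintegral => t _; rewrite e.
  rewrite RintegralB//.
  by rewrite RintegralZl// I1val phiuval subrr.
apply: (@le_trans _ _ (\int[mu]_t (`|I1 t|%:E + (hj * `|phiu t|)%:E))%E).
  apply: ge0_le_integral => //.
  - by apply/measurable_EFinP; apply: measurableT_comp => //; exact: measurable_kerdiff.
  - apply: emeasurable_funD; apply/measurable_EFinP.
      exact: measurableT_comp.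
    apply: measurable_funM; first exact: measurable_cst.
    apply: measurableT_comp => //; apply: (measurableT_comp mphi).
    exact: measurable_addr.
  - move=> t _; rewrite -EFinD lee_fin e (le_trans (ler_normB _ _))// lerD2l.
    by rewrite normrM (ger0_norm (ltW hj0)).
have mphiu : measurable_fun [set: T] (fun t => `|phiu t|%:E).
  apply/measurable_EFinP; apply: measurableT_comp => //; apply: (measurableT_comp mphi).
  exact: measurable_addr.
rewrite ge0_integralD//; last 3 first.
- by apply/measurable_EFinP; exact: measurableT_comp.
- by move=> t _; rewrite lee_fin mulr_ge0// ltW.
- by under eq_fun do rewrite EFinM; exact: measurable_funeM.
under [X in (_ + X)%E]eq_integral do rewrite EFinM.
rewrite ge0_integralZl_EFin ?(ltW hj0)// phiuabs I1abs -EFinM -EFinD lee_fin.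
rewrite /kerbound uj (qX_lt hN) ltNge mj /= -mulr2n -mulr_natl -mulrA.
have -> : (q%:R ^ j) ^+ n = Q ^ j :> R by rewrite !exprnP exprz_exp mulrC -exprz_exp.
rewrite /hj; have := gt_eqF (Qz0 j); have := gt_eqF (Az0 j).
move: (Q ^ j) (A ^ j) Am1 => x y h1 y0 x0.
rewrite le_eqVlt; apply/orP; left; apply/eqP; field.
by rewrite x0 h1 y0.
Qed.

Lemma kerval_ge0 m u : u <> 0 :> V -> 0 <= kerval m u.
Proof.
move=> u0; rewrite /kerval; case: ifPn => // um.
have [i ui] := un_val hN u0; rewrite (kapE ui).
rewrite addr_ge0 ?kerd_ge0// mulr_ge0 ?kerc_ge0// subr_ge0 k_le//.
by rewrite ltW// -(qX_lt hN) -ui.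
Qed.

Lemma kerval_le_bound m u : u <> 0 :> V -> `|kerval m u| <= kerbound m u.
Proof.
move=> u0; rewrite ger0_norm ?kerval_ge0// /kerval /kerbound; case: ifPn => // um.
by rewrite mulr_ge0 ?invr_ge0 ?exprn_ge0 ?(un_ge0 hN)// mulr_ge0// divr_ge0 ?subr_ge0 ?ltW.
Qed.

Lemma kerdiffP m u : u <> 0 :> V ->
  (\int[mu]_t `|kerdiff m u t|%:E <= (kerbound m u)%:E)%E /\
  \int[mu]_t kerdiff m u t = kerval m u.
Proof.
move=> u0; have [j uj] := un_val hN u0; have [mj|jm] := leP m j.
  have [I1 ->] := kerdiff_large uj mj; split=> //.
  by rewrite /kerval uj (qX_lt hN) ltNge mj.
have [I1 ->] := kerdiff_small uj jm; split=> //; rewrite I1 lee_fin.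
by rewrite /kerval /kerbound uj (qX_lt hN) jm.
Qed.

Lemma measurable_kerval m : measurable_fun [set: T] (kerval m).
Proof.
apply: measurable_fun_ifT => //.
- by apply: measurable_fun_ltr; [exact: (measurable_un hN)|exact: measurable_cst].
- apply: measurable_funD; last exact: measurable_cst.
  apply: measurable_funM; first exact: measurable_cst.
  by apply: measurable_funB => //; exact: measurable_cst.
Qed.

Definition potential f (x : T) : R := \int[mu]_y (kap ((x : V) - y) * f y).

Lemma measurable_potential f : measurable_fun [set: T] f ->
  measurable_fun [set: T] (potential f).
Proof.
move=> mf.
apply: (@measurable_Rintegral_param _ _ _ _ _ mu
  (fun z : T * T => kap ((z.1 : V) - (z.2 : V)) * f z.2)).
apply: measurable_funM; first exact: (measurable_conv_kernel hN mkap).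
exact: measurableT_comp.
Qed.

(** [radial_kernel] fixes no value of [kap] or [h] at 0, so identities between kernels hold off the
    diagonal only. *)
Lemma ae_sub_neq0 (x : V) : {ae mu, forall y : T, x - (y : V) <> 0}.
Proof.
exists [set x]; split; first exact: (measurable_set1_un hN).
  exact: (uhaar_set1 hN muB).
by move=> y /= /contrapT /eqP; rewrite subr_eq0 => /eqP ->.
Qed.

Lemma ae_neq0 : {ae mu, forall y : T, y <> 0 :> V}.
Proof.
exists [set (0 : V)]; split; first exact: (measurable_set1_un hN).
  exact: (uhaar_set1 hN muB).
by move=> y /= /contrapT ->.
Qed.

Section at_point.
Variables (m : int) (f : T -> R) (x : V).
Hypothesis mf : measurable_fun [set: T] f.
Hypothesis fx : mu.-integrable [set: T] (fun y => (kap (x - (y : V)) * f y)%:E).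
Hypothesis fae : {ae mu, forall z : T,
  mu.-integrable [set: T] (fun y => (kap ((z : V) - y) * f y)%:E)}.
Hypothesis fb : mu.-integrable [set: T]
  (fun y => (kerbound m (x - (y : V)) * f y)%:E).

Let P (w : T * T) : R := kerdiff m (x - (w.2 : V)) ((w.1 : V) - x) * f w.2.

Let mP : measurable_fun [set: T * T] P.
Proof.
have mI : measurable_fun [set: T] (\1_(uout N q m 0) : T -> R).
  by apply: measurable_indic; exact: (measurable_uout hN).
rewrite /P /kerdiff; apply: measurable_funM; last exact: (measurableT_comp mf measurable_snd).
apply: measurable_funM; last first.
  exact: (measurableT_comp (measurableT_comp mI (measurable_subr hN x)) measurable_fst).
apply: measurable_funM; last first.
  exact: (measurableT_comp (measurableT_comp mh (measurable_subr hN x)) measurable_fst).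
apply: measurable_funB.
  rewrite (_ : (fun w => _) = (fun w : T * T => kap ((w.1 : V) - (w.2 : V)))).
    exact: (measurable_conv_kernel hN).
  by apply/funext => w; rewrite addrA subrK.
exact: (measurableT_comp (measurableT_comp mkap (measurable_subl hN x)) measurable_snd).
Qed.

(** The absolute value is integrated first over z, where [kerdiffP] bounds the result by
    [kerbound m (x - y)]; what remains is the hypothesis [fb]. *)
Let P_int : ((mu \x mu)%E).-integrable [set: T * T] (EFin \o P).
Proof.
have mEP : measurable_fun [set: T * T] (EFin \o P) by exact/measurable_EFinP.
have [_ H] := integrable21ltyP mu mu mEP; apply: H.
case/integrableP: fb => mfb; apply: le_lt_trans.
apply: ae_ge0_le_integral => //.
- by move=> y _; exact: integral_ge0.
- by apply: (@measurable_fun_fubini_tonelli_G _ _ _ _ _ mu (fun w => `|(EFin \o P) w|%E)) => //;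
    exact: measurableT_comp.
- exact: measurableT_comp.
apply: filterS (ae_sub_neq0 x) => y xy _.
have [I1 _] := kerdiffP m xy.
rewrite (eq_integral (fun z : T => (`|f y|%:E *
   `|kerdiff m (x - (y : V)) ((z : V) - x)|%:E)%E)); last first.
  by move=> z _; rewrite /P /= normrM mulrC EFinM.
have mk := measurable_kerdiff m (x - y : V).
have mk' : measurable_fun [set: T]
    (fun z : T => `|kerdiff m (x - (y : V)) z|%:E).
  by apply/measurable_EFinP; exact: measurableT_comp.
rewrite ge0_integralZl_EFin//; last first.
  by apply: (measurableT_comp mk'); exact: (measurable_subr hN).
rewrite (ge0_integral_sim hN muB (subr_sim N q x) (addrK x) (f := fun z : T =>
  `|kerdiff m (x - (y : V)) z|%:E))//.
rewrite oppr0 expr0z mul1e EFinM abseM muleC lee_wpmul2r// (le_trans I1)//.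
by rewrite lee_fin ler_norm.
Qed.

Let G (z : T) : R := (potential f z - potential f x) *
  (h ((z : V) - x) * \1_(uout N q m x) z).

Let mG : measurable_fun [set: T] G.
Proof.
apply: measurable_funM.
  by apply: measurable_funB; [exact: measurable_potential|exact: measurable_cst].
apply: measurable_funM; last by apply: measurable_indic; exact: (measurable_uout hN).
exact: (measurableT_comp mh (measurable_subr hN x)).
Qed.

Let indicE_uout (z : T) : \1_(uout N q m 0) ((z : V) - x : T) = \1_(uout N q m x) z :> R.
Proof.
rewrite !indicE; have -> // : ((z : V) - x : T) \in uout N q m 0 = (z \in uout N q m x).
by apply/idP/idP => /set_mem h'; apply/mem_set; move: h'; rewrite /uout/= subr0.
Qed.

Let intP_y : {ae mu, forall z : T, (\int[mu]_y (EFin \o P) (z, y))%E = (G z)%:E}.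
Proof.
apply: filterS fae => z fz; pose c := h ((z : V) - x) * \1_(uout N q m x) z.
pose g1 (y : T) := kap ((z : V) - y) * f y.
pose g2 (y : T) := kap (x - (y : V)) * f y.
have e y : (EFin \o P) (z, y) = (c%:E * (g1 y - g2 y)%:E)%E.
  rewrite /P /kerdiff /= addrA subrK indicE_uout -EFinM; congr EFin.
  by rewrite /c /g1 /g2; ring.
under eq_integral do rewrite e.
have i12 : mu.-integrable [set: T] (fun y => (g1 y - g2 y)%:E).
  by under eq_fun do rewrite EFinB; exact: integrableB.
rewrite integralZl// /G -/c.
have -> : (\int[mu]_y (g1 y - g2 y)%:E)%E = (potential f z - potential f x)%:E.
  rewrite integralB_EFin// EFinB; congr (_ - _)%E.
    by rewrite /potential fineK//; exact: integrable_fin_num.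
  by rewrite /potential fineK//; exact: integrable_fin_num.
by rewrite -EFinM mulrC.
Qed.

Let intP_z : {ae mu, forall y : T, (\int[mu]_z (EFin \o P) (z, y))%E =
  (kerval m (x - (y : V)) * f y)%:E}.
Proof.
apply: filterS (ae_sub_neq0 x) => y xy.
have [I1 I2] := kerdiffP m xy.
have mk := measurable_kerdiff m (x - y : V).
have kint : mu.-integrable [set: T] (EFin \o kerdiff m (x - (y : V))).
  apply/integrableP; split; first exact/measurable_EFinP.
  by apply: le_lt_trans I1 _; rewrite ltry.
have kint' := (integrable_sim hN muB (subr_sim N q x) (addrK x) mk).1 kint.
under eq_integral do rewrite /P /= EFinM.
rewrite integralZr// -(fineK (integrable_fin_num _ kint'))//.
rewrite -/(Rintegral mu setT (fun z : T => kerdiff m (x - (y : V)) ((z : V) - x))).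
by rewrite (Rintegral_sim hN muB (subr_sim N q x) (addrK x) mk kint) oppr0 expr0z mul1r I2.
Qed.

Let mkval : measurable_fun [set: T] (fun y => (kerval m (x - (y : V)) * f y)%:E).
Proof.
apply/measurable_EFinP; apply: measurable_funM => //.
exact: (measurableT_comp (measurable_kerval m) (measurable_subl hN x)).
Qed.

(** Fubini's theorem for [P]. Integration over y gives the truncated integrand for almost every z,
    namely where the potential converges and the difference of kernels can be split; integration
    over z gives [kerval]. *)
Lemma trunc_potential :
  [/\ mu.-integrable (uout N q m x) (fun z : T =>
        ((potential f z - potential f x) * h ((z : V) - x))%:E),
      mu.-integrable [set: T] (fun y => (kerval m (x - (y : V)) * f y)%:E) &
      \int[mu]_(z in uout N q m x) ((potential f z - potential f x) * h ((z : V) - x)) =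
      \int[mu]_y (kerval m (x - (y : V)) * f y)].
Proof.
have mU : measurable (uout N q m x) by exact: (measurable_uout hN).
have eG : (fun z : T => ((potential f z - potential f x) * h ((z : V) - x))%:E)
    \_ (uout N q m x) = EFin \o G.
  apply/funext => z; rewrite patchE /G /= indicE.
  by case: ifPn => zU; rewrite ?mulr1// !mulr0.
split.
- apply/(integrable_mkcond _ mU); rewrite eG.
  apply: ae_eq_integrable (integrable_fubini_F P_int); last exact: intP_y.
  exact/measurable_EFinP.
- apply/integrableP; split=> //; case/integrableP: fb => mfb; apply: le_lt_trans.
  apply: ae_ge0_le_integral => //; [exact: measurableT_comp|exact: measurableT_comp|].
  apply: filterS (ae_sub_neq0 x) => y xy _; rewrite lee_fin !normrM ler_wpM2r//.
  exact: le_trans (kerval_le_bound m xy) (ler_norm _).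
- rewrite /Rintegral integral_mkcond eG; congr fine.
  transitivity (\int[mu]_z \int[mu]_y (EFin \o P) (z, y))%E.
    apply: ae_eq_integral => //; first exact/measurable_EFinP.
      exact: measurable_fubini_F P_int.
    by apply: filterS intP_y => z ->.
  rewrite (Fubini P_int); apply: ae_eq_integral => //.
    exact: measurable_fubini_G P_int.
  by apply: filterS intP_z => y ->.
Qed.

End at_point.

Lemma integrable_ae_le f (g : T -> R) : measurable_fun [set: T] g ->
  mu.-integrable [set: T] (EFin \o f) -> {ae mu, forall y, `|g y| <= `|f y|} ->
  mu.-integrable [set: T] (EFin \o g).
Proof.
move=> mg fi gf; have mf : measurable_fun [set: T] (EFin \o f) by exact: measurable_int fi.
have mgE : measurable_fun [set: T] (EFin \o g) by exact/measurable_EFinP.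
case/integrableP: fi => _ foo; apply/integrableP; split=> //.
apply: le_lt_trans foo; apply: ae_ge0_le_integral => //; try exact: measurableT_comp.
by apply: filterS gf => y h' _; rewrite lee_fin.
Qed.

(** Up to constants [kerbound] is at most |kap| + [kerweight], which replaces the integrability
    needed for Fubini's theorem by two conditions on f that can be checked separately. *)
Definition kerweight m (u : T) : R :=
  if N u < q%:R ^ m then 1 else (N u ^+ n)^-1.

Lemma measurable_kerweight m : measurable_fun [set: T] (kerweight m).
Proof.
apply: measurable_fun_ifT => //.
- by apply: measurable_fun_ltr; [exact: (measurable_un hN)|exact: measurable_cst].
- have -> : (fun u : T => (N u ^+ n)^-1) = (fun u : T => N u `^ (- n%:R)).
    by apply/funext => u; rewrite powR_invn// (un_ge0 hN).
  exact: (measurableT_comp (measurable_powR _) (measurable_un hN)).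
Qed.

Lemma measurable_kerbound m : measurable_fun [set: T] (kerbound m).
Proof.
apply: measurable_fun_ifT => //.
- by apply: measurable_fun_ltr; [exact: (measurable_un hN)|exact: measurable_cst].
- apply: measurable_funD; last exact: measurable_cst.
  apply: measurable_funM; first exact: measurable_cst.
  by apply: measurable_funB => //; exact: measurable_cst.
- apply: measurable_funM; first exact: measurable_cst.
  have -> : (fun u : T => (N u ^+ n)^-1) = (fun u : T => N u `^ (- n%:R)).
    by apply/funext => u; rewrite powR_invn// (un_ge0 hN).
  exact: (measurableT_comp (measurable_powR _) (measurable_un hN)).
Qed.

Lemma integrable_kerbound m f (x : V) : measurable_fun [set: T] f ->
  mu.-integrable [set: T] (fun y => (kap (x - (y : V)) * f y)%:E) ->
  mu.-integrable [set: T] (fun y => (kerweight m (x - (y : V)) * f y)%:E) ->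
  mu.-integrable [set: T] (fun y => (kerbound m (x - (y : V)) * f y)%:E).
Proof.
move=> mf i1 i2.
(* [c2] collects the constant terms of [kerbound] inside the ball and the factor of N^(- n)
   outside. *)
pose c1 := kerc m; pose c2 := c1 * `|k m| + kerd m + 2 * (D / (A - 1)).
have c10 : 0 <= c1 by exact: kerc_ge0.
have d0 : 0 <= kerd m by exact: kerd_ge0.
have e0 : 0 <= 2 * (D / (A - 1)).
  by rewrite mulr_ge0// divr_ge0 ?subr_ge0 ?ltW .
have c20 : 0 <= c2 by rewrite !addr_ge0// mulr_ge0.
pose g (y : T) := c1 * `|kap (x - (y : V)) * f y| + c2 * `|kerweight m (x - (y : V)) * f y|.
apply: (@integrable_ae_le g).
- apply: measurable_funM => //.
  exact: (measurableT_comp (measurable_kerbound m) (measurable_subl hN x)).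
- have j1 := integrable_norm i1; have j2 := integrable_norm i2.
  rewrite (_ : EFin \o g = (fun y => c1%:E * (`|kap (x - (y : V)) * f y|)%:E +
    c2%:E * (`|kerweight m (x - (y : V)) * f y|)%:E)%E)//.
  by apply: integrableD => //; exact: integrableZl.
- apply/aeW => y; have gy0 : 0 <= g y by rewrite /g addr_ge0// mulr_ge0.
  rewrite (ger0_norm gy0).
  rewrite /g !normrM !mulrA -mulrDl ler_wpM2r// /kerbound /kerweight.
  case: ifPn => _.
    rewrite normr1 mulr1; apply: le_trans (ler_normD _ _) _.
    rewrite normrM (ger0_norm c10) (ger0_norm d0).
    have : c1 * `|k m - kap (x - (y : V))| <= c1 * (`|k m| + `|kap (x - (y : V))|).
      by rewrite ler_wpM2l// ler_normB.
    by rewrite /c2; lra.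
  rewrite normrM (ger0_norm e0); set w := `|(_ ^+ n)^-1|.
  have w0 : 0 <= w by rewrite /w.
  apply: (@le_trans _ _ (c2 * w)); last by rewrite lerDr mulr_ge0.
  by apply: ler_wpM2r => //; rewrite /c2 lerDr addr_ge0// mulr_ge0.
Qed.

Section data.
Variables (p C : R) (f : T -> R).
Hypotheses (p1 : 1 <= p) (C0 : 0 < C).
Hypothesis CD : C * (D / (A - 1) * ((1 - A^-1 * Q^-1) / (1 - A^-1))) = 1.
Hypothesis mf : measurable_fun [set: T] f.
Hypothesis fp : (\int[mu]_x (`|f x| `^ p)%:E < +oo)%E.
Hypothesis fpot : {ae mu, forall x : T,
  mu.-integrable [set: T] (fun y => (kap ((x : V) - y) * f y)%:E)}.
Hypothesis fweight : forall m, {ae mu, forall x : T,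
  mu.-integrable [set: T] (fun y => (kerweight m ((x : V) - y) * f y)%:E)}.

Local Notation pot := (potential f).

Definition trunc_op m (x : T) : R :=
  \int[mu]_(z in uout N q m x) ((pot z - pot x) * h ((z : V) - x)).

Lemma trunc_opP m : {ae mu, forall x : T,
  [/\ mu.-integrable (uout N q m x) (fun z : T =>
        ((pot z - pot x) * h ((z : V) - x))%:E),
      mu.-integrable [set: T] (fun y => (kerval m ((x : V) - y) * f y)%:E) &
      trunc_op m x = \int[mu]_y (kerval m ((x : V) - y) * f y)]}.
Proof.
apply: filterS2 fpot (fweight m) => x i1 i2.
by have := trunc_potential mf i1 fpot (integrable_kerbound mf i1 i2).
Qed.

Lemma measurable_trunc_op m : measurable_fun [set: T] (trunc_op m).
Proof.
have mpot := measurable_potential mf.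
pose I0 : T -> R := \1_(uout N q m 0).
have mI : measurable_fun [set: T] I0.
  by apply: measurable_indic; exact: (measurable_uout hN).
rewrite (_ : trunc_op m = (fun x => \int[mu]_z
    ((pot z - pot x) * h ((z : V) - x) * I0 ((z : V) - x)))); last first.
  apply/funext => x; rewrite /trunc_op Rintegral_mkcond; apply: eq_Rintegral => z _.
  rewrite patchE /I0 indicE.
  have -> : ((z : V) - x : T) \in uout N q m 0 = (z \in uout N q m x).
    by apply/idP/idP => /set_mem h'; apply/mem_set; move: h'; rewrite /uout/= subr0.
  by case: ifPn => _; rewrite ?mulr1 ?mulr0.
apply: (measurable_Rintegral_param mu (G := fun w : T * T =>
    (pot w.2 - pot w.1) * h ((w.2 : V) - w.1) * I0 ((w.2 : V) - w.1))).
have msw (g : T -> R) : measurable_fun [set: T] g ->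
    measurable_fun [set: T * T] (fun w : T * T => g ((w.2 : V) - w.1)).
  move=> mg.
  exact: (measurableT_comp (f := fun w : T * T => g ((w.1 : V) - w.2))
    (measurable_conv_kernel hN mg) (measurable_fun_pair measurable_snd measurable_fst)).
apply: measurable_funM; last exact: msw.
apply: measurable_funM; last exact: (msw _ mh).
apply: measurable_funB.
  exact: (measurableT_comp mpot measurable_snd).
exact: (measurableT_comp mpot measurable_fst).
Qed.

(** The absolute value makes the density nonnegative at 0 as well, where the value of [kap] is
    arbitrary; elsewhere it changes nothing. *)
Let rho m (u : T) : R := `|C * kerval m u|.

Let mrho m : measurable_fun [set: T] (rho m).
Proof.
apply: measurableT_comp => //; apply: measurable_funM; first exact: measurable_cst.
exact: measurable_kerval.
Qed.

Lemma kerval_mass m : (\int[mu]_u `|C * kerval m u|%:E = 1)%E.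
Proof.
have mkv := measurable_kerval m.
have mE : measurable (uball N q (m - 1) 0) by exact: measurable_uball.
have -> : (\int[mu]_u `|C * kerval m u|%:E = C%:E * \int[mu]_u `|kerval m u|%:E)%E.
  under eq_integral do rewrite normrM (gtr0_norm C0) EFinM.
  rewrite ge0_integralZl_EFin ?(ltW C0)//.
  by apply/measurable_EFinP; exact: measurableT_comp.
have -> : (\int[mu]_u `|kerval m u|%:E = \int[mu]_u (kerval m u)%:E)%E.
  apply: ae_eq_integral => //; try exact/measurable_EFinP.
    by apply/measurable_EFinP; exact: measurableT_comp.
  apply: filterS ae_neq0 => u u0 _; congr EFin; rewrite ger0_norm//.
  exact: kerval_ge0.
have -> : (\int[mu]_u (kerval m u)%:E = \int[mu]_(u in uball N q (m - 1) 0)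
    (kerc m * (k m - kap u) + kerd m)%:E)%E.
  rewrite -[RHS]integral_mul_indic//; apply: ae_eq_integral => //.
  - exact/measurable_EFinP.
  - apply/measurable_EFinP; apply: measurable_funM; last exact: measurable_indic.
    apply: measurable_funD; last exact: measurable_cst.
    apply: measurable_funM; first exact: measurable_cst.
    by apply: measurable_funB => //; exact: measurable_cst.
  - apply: filterS ae_neq0 => u u0 _; congr EFin; rewrite /kerval indicE.
    have [i ui] := un_val hN u0.
    have -> : u \in uball N q (m - 1) 0 = (N u < q%:R ^ m).
      rewrite ui (qX_lt hN); apply/idP/idP => [/set_mem|im]; last apply/mem_set.
        by rewrite /uball/= subr0 ui (qX_le hN) -ltzD1 subrK.
      by rewrite /uball/= subr0 ui (qX_le hN) -ltzD1 subrK.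
    by case: ifPn => _; rewrite ?mulr1 ?mulr0.
by rewrite integral_kernel_mass -EFinM CD.
Qed.

Lemma trunc_op_conv m : {ae mu, forall x : T,
  mu.-integrable [set: T] (fun y => (rho m ((x : V) - y) * f y)%:E) /\
  C * trunc_op m x = \int[mu]_y (rho m ((x : V) - y) * f y)}.
Proof.
apply: filterS (trunc_opP m) => x [_ i2 ->].
have mkv := measurable_kerval m.
have rE : {ae mu, forall y : T, C * (kerval m ((x : V) - y) * f y) = rho m ((x : V) - y) * f y}.
  apply: filterS (ae_sub_neq0 x) => y xy; rewrite /rho mulrA ger0_norm//.
  by rewrite mulr_ge0 ?(ltW C0)//; exact: kerval_ge0.
have mrf : measurable_fun [set: T] (fun y : T => rho m ((x : V) - y) * f y).
  apply: measurable_funM => //.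
  exact: (measurableT_comp (mrho m) (measurable_subl hN x)).
have i3 : mu.-integrable [set: T] (fun y => (C * (kerval m ((x : V) - y) * f y))%:E).
  by under eq_fun do rewrite EFinM; exact: integrableZl.
split.
  apply: ae_eq_integrable i3; first exact/measurable_EFinP.
  by apply: filterS rE => y ->.
rewrite -RintegralZl//; congr fine; apply: ae_eq_integral => //.
- exact: measurable_int i3.
- exact/measurable_EFinP.
- by apply: filterS rE => y ->.
Qed.

Let mCop m : measurable_fun [set: T] (fun x => C * trunc_op m x).
Proof. by apply: measurable_funM; [exact: measurable_cst|exact: measurable_trunc_op]. Qed.

Let Cop_le (nu : nat) (e : R) :
  (forall u, N u <= q%:R ^ (- nu%:Z) -> (shift_modulus mu p f u <= e%:E)%E) ->
  (\int[mu]_x (`|C * trunc_op (- nu%:Z) x - f x| `^ p)%:E <= e%:E)%E.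
Proof.
move=> he; have mr := mrho (- nu%:Z); have ms := kerval_mass (- nu%:Z).
have mc := mCop (- nu%:Z).
apply: (approximate_identity (k := nu) hN muB p1 mr mf mc) => //.
- by move=> x; rewrite /rho.
- by move=> x xk; rewrite /rho /kerval ltNge (ltW xk) mulr0 normr0.
- exact: trunc_op_conv.
Qed.

Lemma trunc_op_cvg (e : R) : 0 < e -> exists nu0 : nat, forall nu : nat, (nu0 <= nu)%N ->
  (\int[mu]_x (`|C * trunc_op (- nu%:Z) x - f x| `^ p)%:E <= e%:E)%E.
Proof.
move=> e0; have [nu0 h0] := shift_continuous_Lp hN muB p1 mf fp e0.
exists nu0 => nu nu0nu; apply: Cop_le => u uk; apply: h0; apply: le_trans uk _.
by rewrite (qX_le hN) lerN2 lez_nat.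
Qed.

(** The same estimate with the trivial bound on the modulus, valid for all translations: 2^p times
    twice the integral of |f|^p. It yields membership in L^p for every nu, including those for which
    the error is not small. *)
Lemma trunc_op_lty (nu : nat) :
  (\int[mu]_x (`|C * trunc_op (- nu%:Z) x - f x| `^ p)%:E < +oo)%E.
Proof.
have mp := measurable_powabs p mf.
have f0 : (0 <= \int[mu]_x (`|f x| `^ p)%:E)%E.
  by apply: integral_ge0 => x _; rewrite lee_fin powR_ge0.
have ffin : (\int[mu]_x (`|f x| `^ p)%:E)%E \is a fin_num by rewrite ge0_fin_numE.
pose M := fine (\int[mu]_x (`|f x| `^ p)%:E)%E.
apply: (@le_lt_trans _ _ (2 `^ p * (M + M))%:E); last by rewrite ltry.
apply: Cop_le => u _; rewrite /shift_modulus.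
have msh : measurable_fun [set: T] (fun x : T => (`|f ((x : V) - u)| `^ p)%:E).
  by apply: measurable_powabs; exact: (measurable_shift hN).
apply: (@le_trans _ _ (\int[mu]_x ((2 `^ p)%:E *
    ((`|f ((x : V) - u)| `^ p)%:E + (`|f x| `^ p)%:E)))%E).
  apply: ge0_le_integral => //.
  - by apply: measurable_powabs; apply: measurable_funB => //; exact: (measurable_shift hN).
  - exact: measurable_funeM (emeasurable_funD msh mp).
  - move=> x _; rewrite -EFinD -EFinM lee_fin.
    apply: le_trans (powRD_le p1 (normr_ge0 _) (normr_ge0 _)).
    by apply: ge0_ler_powR; rewrite ?nnegrE ?addr_ge0 ?ler_normB// (le_trans ler01).
rewrite ge0_integralZl_EFin ?powR_ge0//; last 2 first.
- by move=> x _; rewrite adde_ge0// lee_fin powR_ge0.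
- exact: emeasurable_funD msh mp.
rewrite ge0_integralD//.
have -> := integral_shift hN muB u mp (fun x => powR_ge0 _ _ : (0 <= _%:E)%E).
by rewrite EFinM EFinD /M fineK.
Qed.

End data.
End Inversion.

(** * Complex-valued functions through their real and imaginary parts *)

Section RintegralScale.
Context d (X : measurableType d) (R : realType).
Variable mu : {measure set X -> \bar R}.
Implicit Types (D : set X) (f : X -> R).

(** A finite value of the integral forces both parts to be finite, hence integrability; [fine] sends
    infinite values to 0. *)
Lemma Rintegral_nonintegrable D f : measurable D -> measurable_fun D f ->
  ~ mu.-integrable D (EFin \o f) -> \int[mu]_(x in D) f x = 0.
Proof.
move=> mD mf nf; have mfE : measurable_fun D (EFin \o f) by exact/measurable_EFinP.
rewrite /Rintegral; set I := (\int[mu]_(x in D) _)%E.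
have [fin|] := boolP (I \is a fin_num); last by rewrite fin_numE; case: I => // r /andP[].
exfalso; apply: nf; apply/integrableP; split=> //.
move: fin; rewrite /I integralE fin_numB => /andP[fp fm].
rewrite -[X in integral _ _ X]/(abse \o (EFin \o f)) fune_abse ge0_integralD//.
- by rewrite lte_add_pinfty// ltey_eq ?fp ?fm.
- exact: measurable_funepos.
- exact: measurable_funeneg.
Qed.

(* No integrability is required because [fine] maps the infinite values to 0. *)
Lemma RintegralMl D f (c : R) : measurable D -> measurable_fun D f ->
  \int[mu]_(x in D) (c * f x) = c * \int[mu]_(x in D) f x.
Proof.
move=> mD mf; have [fi|nf] := pselect (mu.-integrable D (EFin \o f)).
  by rewrite RintegralZl.
rewrite (Rintegral_nonintegrable mD mf nf) mulr0; have [->|c0] := eqVneq c 0.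
  by under eq_Rintegral do rewrite mul0r; rewrite /Rintegral integral0.
apply: Rintegral_nonintegrable => //; first by apply: measurable_funM.
move=> cfi; apply: nf.
have -> : EFin \o f = (fun x => (c^-1)%:E * (c * f x)%:E)%E.
  by apply/funext => x; rewrite -EFinM mulKf.
exact: integrableZl.
Qed.

End RintegralScale.

Section ComplexLp.
Context d (X : measurableType d) (R : realType).
Variable mu : {measure set X -> \bar R}.
Local Notation normc := (@ComplexField.Normc.normc R).
Implicit Types (g : X -> R[i]) (z : R[i]).

Lemma cRe_mulr z (r : R) : @complex.Re R (z * r%:C) = complex.Re z * r.
Proof. by case: z => a b /=; rewrite mulr0 subr0. Qed.

Lemma cIm_mulr z (r : R) : @complex.Im R (z * r%:C) = complex.Im z * r.
Proof. by case: z => a b /=; rewrite mulr0 add0r. Qed.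

Lemma cRe_mull z (r : R) : @complex.Re R (r%:C * z) = r * complex.Re z.
Proof. by rewrite mulrC cRe_mulr mulrC. Qed.

Lemma cIm_mull z (r : R) : @complex.Im R (r%:C * z) = r * complex.Im z.
Proof. by rewrite mulrC cIm_mulr mulrC. Qed.

Lemma cReB z z' : @complex.Re R (z - z') = complex.Re z - complex.Re z'.
Proof. by case: z; case: z'. Qed.

Lemma cImB z z' : @complex.Im R (z - z') = complex.Im z - complex.Im z'.
Proof. by case: z; case: z'. Qed.

Lemma normc_ge0 z : 0 <= normc z. Proof. by case: z => a b; exact: sqrtr_ge0. Qed.

Lemma Re_le_normc z : `|complex.Re z| <= normc z.
Proof.
by case: z => a b /=; rewrite -sqrtr_sqr ler_wsqrtr// lerDl sqr_ge0.
Qed.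

Lemma Im_le_normc z : `|complex.Im z| <= normc z.
Proof.
by case: z => a b /=; rewrite -sqrtr_sqr ler_wsqrtr// lerDr sqr_ge0.
Qed.

Lemma normc_le z : normc z <= `|complex.Re z| + `|complex.Im z|.
Proof.
case: z => a b /=; rewrite -[leRHS]ger0_norm ?addr_ge0// -sqrtr_sqr ler_wsqrtr//.
by rewrite sqrrD !real_normK ?num_real// lerD2r lerDl mulrn_wge0// mulr_ge0.
Qed.

Lemma measurable_normc g : cmeasurable g -> measurable_fun setT (normc \o g).
Proof.
move=> [mr mi]; rewrite (_ : _ \o _ = (fun x =>
    Num.sqrt (complex.Re (g x) ^+ 2 + complex.Im (g x) ^+ 2))); last first.
  by apply/funext => x /=; case: (g x).
under eq_fun do rewrite -powR12_sqrt ?addr_ge0 ?sqr_ge0//.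
apply: (measurableT_comp (measurable_powR _)).
by apply: measurable_funD; exact: measurable_funX.
Qed.

Lemma cLnormE p g :
  cLnorm mu p g = ((\int[mu]_x (normc (g x) `^ p)%:E) `^ p^-1)%E.
Proof.
rewrite /cLnorm unlock; congr (_ `^ _)%E; apply: eq_integral => x _.
by rewrite abse_EFin ger0_norm ?normc_ge0.
Qed.

Variable p : R.
Hypothesis p1 : 1 <= p.

Let p0 : 0 < p. Proof. exact: lt_le_trans ltr01 p1. Qed.

Let mpow (f : X -> R) : measurable_fun setT f ->
  measurable_fun setT (fun x => (f x `^ p)%:E).
Proof. by move=> mf; apply/measurable_EFinP; exact: measurableT_comp (measurable_powR _) mf. Qed.

Lemma in_Lp_int g : in_Lp mu p g -> (\int[mu]_x (normc (g x) `^ p)%:E < +oo)%E.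
Proof.
move=> [_]; rewrite cLnormE ltey => h; rewrite ltey; apply: contra h => /eqP h.
by apply/eqP/eqy_poweR => //; rewrite invr_gt0.
Qed.

Lemma in_Lp_int_le g (f : X -> R) : in_Lp mu p g -> measurable_fun setT f ->
  (forall x, `|f x| <= normc (g x)) -> (\int[mu]_x (`|f x| `^ p)%:E < +oo)%E.
Proof.
move=> gp mf fg; apply: le_lt_trans (in_Lp_int gp); apply: ge0_le_integral => //.
- by apply: mpow; exact: measurableT_comp.
- by apply: mpow; exact: (measurable_normc gp.1).
- by move=> x _; rewrite lee_fin ge0_ler_powR ?nnegrE ?normc_ge0 ?(ltW p0).
Qed.

Lemma in_Lp_Re g : in_Lp mu p g -> (\int[mu]_x (`|complex.Re (g x)| `^ p)%:E < +oo)%E.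
Proof. by move=> gp; apply: (in_Lp_int_le gp) => [|x]; [exact: gp.1.1|exact: Re_le_normc]. Qed.

Lemma in_Lp_Im g : in_Lp mu p g -> (\int[mu]_x (`|complex.Im (g x)| `^ p)%:E < +oo)%E.
Proof. by move=> gp; apply: (in_Lp_int_le gp) => [|x]; [exact: gp.1.2|exact: Im_le_normc]. Qed.

Lemma cLnorm_le g (e : R) : cmeasurable g ->
  (\int[mu]_x (`|complex.Re (g x)| `^ p)%:E <= e%:E)%E ->
  (\int[mu]_x (`|complex.Im (g x)| `^ p)%:E <= e%:E)%E ->
  (cLnorm mu p g <= ((2 `^ p * (e + e)) `^ p^-1)%:E)%E.
Proof.
move=> mg re ie; rewrite cLnormE.
have mr : measurable_fun setT (fun x => (`|complex.Re (g x)| `^ p)%:E).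
  by apply: mpow; apply: measurableT_comp => //; exact: mg.1.
have mi : measurable_fun setT (fun x => (`|complex.Im (g x)| `^ p)%:E).
  by apply: mpow; apply: measurableT_comp => //; exact: mg.2.
have : (\int[mu]_x (normc (g x) `^ p)%:E <= (2 `^ p * (e + e))%:E)%E.
  apply: (@le_trans _ _ (\int[mu]_x ((2 `^ p)%:E *
      ((`|complex.Re (g x)| `^ p)%:E + (`|complex.Im (g x)| `^ p)%:E)))%E).
    apply: ge0_le_integral => //.
    - by move=> x _; rewrite lee_fin powR_ge0.
    - by apply/mpow/measurable_normc.
    - exact: measurable_funeM (emeasurable_funD mr mi).
    - move=> x _; rewrite -EFinD -EFinM lee_fin.
      apply: le_trans (powRD_le p1 (normr_ge0 _) (normr_ge0 _)).
      by rewrite ge0_ler_powR ?nnegrE ?normc_ge0 ?addr_ge0 ?normc_le ?(ltW p0).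
  rewrite ge0_integralZl_EFin ?powR_ge0//; last 2 first.
  - by move=> x _; rewrite adde_ge0// lee_fin powR_ge0.
  - exact: emeasurable_funD mr mi.
  rewrite ge0_integralD// EFinM lee_pmul2l ?lte_fin ?powR_gt0//.
  by rewrite EFinD; exact: leeD.
have : (0 <= \int[mu]_x (normc (g x) `^ p)%:E)%E.
  by apply: integral_ge0 => x _; rewrite lee_fin powR_ge0.
case: (\int[mu]_x _)%E => [r| |] //; rewrite !lee_fin => r0 re'.
by rewrite ge0_ler_powR ?nnegrE ?invr_ge0 ?(ltW p0)// (le_trans r0).
Qed.

Lemma cvg_Lp_ReIm (F : nat -> X -> R[i]) :
  (forall nu, cmeasurable (F nu)) ->
  (forall nu, (\int[mu]_x (`|complex.Re (F nu x)| `^ p)%:E < +oo)%E) ->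
  (forall nu, (\int[mu]_x (`|complex.Im (F nu x)| `^ p)%:E < +oo)%E) ->
  (forall e : R, 0 < e -> exists nu0 : nat, forall nu : nat, (nu0 <= nu)%N ->
    (\int[mu]_x (`|complex.Re (F nu x)| `^ p)%:E <= e%:E)%E) ->
  (forall e : R, 0 < e -> exists nu0 : nat, forall nu : nat, (nu0 <= nu)%N ->
    (\int[mu]_x (`|complex.Im (F nu x)| `^ p)%:E <= e%:E)%E) ->
  (forall nu, in_Lp mu p (F nu)) /\ cLnorm mu p (F nu) @[nu --> \oo] --> 0%E.
Proof.
move=> mF rF iF rc ic; have L0 nu : (0 <= cLnorm mu p (F nu))%E by exact: Lnorm_ge0.
have Lfin nu : (cLnorm mu p (F nu) < +oo)%E.
  have fin (f : X -> R) : (\int[mu]_x (`|f x| `^ p)%:E < +oo)%E ->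
      exists2 r, 0 <= r & (\int[mu]_x (`|f x| `^ p)%:E = r%:E)%E.
    have : (0 <= \int[mu]_x (`|f x| `^ p)%:E)%E.
      by apply: integral_ge0 => x _; rewrite lee_fin powR_ge0.
    by case: (integral _ _ _) => // r r0 _; exists r.
  have [r r0 hr] := fin _ (rF nu); have [s s0 hs] := fin _ (iF nu).
  apply: (@le_lt_trans _ _ ((2 `^ p * (Num.max r s + Num.max r s)) `^ p^-1)%:E); last by rewrite ltry.
  by apply: cLnorm_le; rewrite ?hr ?hs ?lee_fin ?le_max ?lexx ?orbT.
split=> [nu|]; first by split.
apply/fine_cvgP; split; first by near=> nu; rewrite ge0_fin_numE.
apply/cvgrPdist_le => /= e e0.
(* Solves (2^p (e' + e'))^(1 / p) = e, the bound of [cLnorm_le]. *)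
pose e' := e `^ p / (2 `^ p * 2).
have e'0 : 0 < e' by rewrite divr_gt0 ?mulr_gt0 ?powR_gt0.
have ee : (2 `^ p * (e' + e')) `^ p^-1 = e.
  have -> : 2 `^ p * (e' + e') = e `^ p by rewrite /e'; field; rewrite gt_eqF ?powR_gt0.
  by rewrite -powRrM divff ?gt_eqF// powRr1// ltW.
have [n1 h1] := rc _ e'0; have [n2 h2] := ic _ e'0.
near=> nu; rewrite sub0r normrN ger0_norm ?fine_ge0//.
rewrite -lee_fin fineK ?ge0_fin_numE// -ee; apply: cLnorm_le => //.
  by apply: h1; near: nu; exact: nbhs_infty_ge.
by apply: h2; near: nu; exact: nbhs_infty_ge.
Unshelve. all: by end_near. Qed.

End ComplexLp.

Section ComplexInversion.
Context (R : realType) (K : fieldType) (abs : K -> R) (kbar : fieldType)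
  (res : K -> kbar) (q n : nat).
Hypotheses (n_gt0 : (0 < n)%N) (hK : local_field abs res q).
Local Notation Kn := 'rV[K]_n.
Local Notation N := (@supnorm R K abs n).
Local Notation T := (borel N).
Variable mu : {sigma_finite_measure set T -> \bar R}.
Hypothesis muB : forall k a, mu (uball N q k a) = ((q%:R ^+ n) ^ k)%:E.
Variables (A D : R) (k : int -> R) (kap h : T -> R).
Hypothesis hk : radial_kernel N q n A D k kap h.
Local Notation Q := (q%:R ^+ n : R).
(** The Riesz potential is [dd] times the potential of [kap], and [C'] is the constant of the stated
    representation. For the power kernel, taken with a minus sign, dd = - d and C' = c d; for the
    logarithm dd = d. The positive constant is always [cc * dd]. *)
Variables (p alpha dd C' : R) (ker : Kn -> R).
Local Notation cc := (c_coef q n alpha).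
Hypotheses (p1 : 1 <= p) (C0 : 0 < cc * dd) (C'0 : C' != 0).
Hypothesis CD : cc * dd * (D / (A - 1) * ((1 - A^-1 * Q^-1) / (1 - A^-1))) = 1.
Hypothesis hE : h = (fun t => N t `^ (- (n%:R + alpha))).
Hypothesis mker : measurable_fun [set: T] (ker : T -> R).
Hypothesis kerE : forall m (u t : Kn), t <> 0 -> N u = q%:R ^ m * N t ->
  cc * dd * @kerval R _ N q n A D k kap m u = C' * (Q ^ m)^-1 * ker t.

Let hN := supnorm_ultranorm n hK.

Lemma uout_ball (nu : nat) (x : Kn) :
  [set z : T | q%:R ^- nu <= N ((z : Kn) - x)] = uout N q (- nu%:Z) x.
Proof. by rewrite /uout -invr_expz. Qed.

Section real_part.
Variables (f G : T -> R).
Hypothesis mf : measurable_fun [set: T] f.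
Hypothesis fpot : {ae mu, forall x : T,
  mu.-integrable [set: T] (fun y => (kap ((x : Kn) - y) * f y)%:E)}.
Hypothesis fweight : forall m, {ae mu, forall x : T,
  mu.-integrable [set: T] (fun y => (@kerweight R _ N q n m ((x : Kn) - y) * f y)%:E)}.
Hypothesis GE : forall x, G x = dd * potential mu kap f x.

Let mG : measurable_fun [set: T] G.
Proof.
rewrite (_ : G = (fun x => dd * potential mu kap f x)); last exact/funext.
by apply: measurable_funM; [exact: measurable_cst|exact: (measurable_potential hN mu hk mf)].
Qed.

Let GP x z : (G z - G x) * h ((z : Kn) - x) =
  dd * ((potential mu kap f z - potential mu kap f x) * h ((z : Kn) - x)).
Proof. by rewrite !GE -mulrBr mulrA. Qed.

(** Scalars are taken out with [RintegralMl], so the identity holds at every x and measurability of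
    the operator can be deduced from it. *)
Lemma trunc_part m (x : T) :
  cc * (\int[mu]_(z in uout N q m x) ((G z - G x) * h ((z : Kn) - x))) =
  cc * dd * trunc_op q mu kap h f m x.
Proof.
have mpot := measurable_potential hN mu hk mf.
under eq_Rintegral do rewrite GP.
rewrite RintegralMl ?mulrA//; first exact: (measurable_uout hN).
apply: measurable_funTS; apply: measurable_funM.
  by apply: measurable_funB => //; exact: measurable_cst.
exact: (measurableT_comp (rk_weight_measurable hk) (measurable_subr hN x)).
Qed.

Lemma trunc_part_integrable m : {ae mu, forall x : T,
  mu.-integrable (uout N q m x) (fun z : T => ((G z - G x) * h ((z : Kn) - x))%:E)}.
Proof.
apply: filterS (trunc_opP n_gt0 hN muB hk mf fpot fweight m) => x [i1 _ _].
under eq_fun do rewrite GP EFinM; apply: integrableZl => //.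
exact: (measurable_uout hN).
Qed.

(** The substitution y = x - s t has Jacobian Q^m, which cancels the factor Q^(- m) in the
    homogeneity relation [kerE] between [kerval m] and [ker]. *)
Lemma representation_part m (s : K) : abs s = q%:R ^ m -> {ae mu, forall x : T,
  mu.-integrable [set: T] (fun t : T => (ker t * f ((x : Kn) - s *: (t : Kn)))%:E) /\
  cc * dd * trunc_op q mu kap h f m x =
    C' * \int[mu]_t (ker t * f ((x : Kn) - s *: (t : Kn)))}.
Proof.
move=> sm; have q0 := qX_gt0 hN m.
have s0 : s != 0 by rewrite -(abs_gt0 hK) sm.
have Qm0 : Q ^ m != 0 :> R by rewrite gt_eqF// exprz_gt0// (Q_gt0 n_gt0 hN).
have c1 : cc * dd != 0 by rewrite gt_eqF.
apply: filterS (trunc_opP n_gt0 hN muB hk mf fpot fweight m) => x [_ i2 ->].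
pose phi (t : Kn) := x - s *: t; pose psi (y : Kn) := s^-1 *: (x - y).
have phi_sim t t' : N (phi t - phi t') = q%:R ^ m * N (t - t').
  rewrite /phi opprB addrC addrA subrK -scalerBr (supnorm_scale hK) sm.
  by rewrite (un_sub hN).
have phiK : cancel psi phi.
  by move=> y; rewrite /phi /psi scalerA divff// scale1r opprB addrC subrK.
pose g (y : T) := @kerval R _ N q n A D k kap m ((x : Kn) - y) * f y.
have mg : measurable_fun [set: T] g.
  apply: measurable_funM => //.
  exact: (measurableT_comp (measurable_kerval hN hk m) (measurable_subl hN x)).
have gphi (t : Kn) : t <> 0 -> ker t * f (x - s *: t) = (cc * dd * Q ^ m / C') * g (phi t).
  move=> t0; rewrite /g /phi subKr.
  have := @kerE m (s *: t) t t0; rewrite (supnorm_scale hK) sm => /(_ erefl) e.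
  rewrite [RHS]mulrA; congr (_ * _); apply: (mulfI C'0).
  move: e; set kv := kerval _ _ _ _ _ _ _ _; move: (Q ^ m) Qm0 => Qm Qm0 e.
  have -> : C' * (cc * dd * Qm / C' * kv) = cc * dd * kv * Qm by field.
  by rewrite e; field.
have mphi : measurable_fun [set: T] (phi : T -> T).
  exact: (measurable_sim hN phi_sim).
have i3 := (integrable_sim hN muB phi_sim phiK mg).1 i2.
have i4 : mu.-integrable [set: T] (fun t : T => ((cc * dd * Q ^ m / C') * g (phi t))%:E).
  by under eq_fun do rewrite EFinM; exact: integrableZl.
have mk : measurable_fun [set: T] (fun t : T => ker t * f ((x : Kn) - s *: (t : Kn))).
  by apply: measurable_funM => //; exact: (measurableT_comp mf mphi).
have ae : {ae mu, forall t : T, cc * dd * Q ^ m / C' * g (phi t) =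
    ker t * f ((x : Kn) - s *: (t : Kn))}.
  by apply: filterS (ae_neq0 n_gt0 hN muB) => t /gphi ->.
split.
  apply: ae_eq_integrable i4; first exact/measurable_EFinP.
  by apply: filterS ae => t ->.
have -> : \int[mu]_t (ker t * f ((x : Kn) - s *: (t : Kn))) =
    \int[mu]_t ((cc * dd * Q ^ m / C') * g (phi t)).
  congr fine; apply: ae_eq_integral => //.
  - exact/measurable_EFinP.
  - exact: measurable_int i4.
  - by apply: filterS ae => t ->.
rewrite RintegralZl// (Rintegral_sim hN muB phi_sim phiK mg i2) -/g.
by rewrite -invr_expz; move: (Q ^ m) Qm0 => Qm Qm0; field; rewrite Qm0 C'0.
Qed.

End real_part.

Variables (phi Phi : Kn -> R[i]).
Hypotheses (phip : in_Lp (mu : {measure set T -> \bar R}) p phi).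
Let f1 (x : T) := complex.Re (phi x).
Let f2 (x : T) := complex.Im (phi x).
Hypotheses (pot1 : {ae mu, forall x : T,
  mu.-integrable [set: T] (fun y => (kap ((x : Kn) - y) * f1 y)%:E)})
 (pot2 : {ae mu, forall x : T,
  mu.-integrable [set: T] (fun y => (kap ((x : Kn) - y) * f2 y)%:E)})
 (weight1 : forall m, {ae mu, forall x : T,
  mu.-integrable [set: T] (fun y => (@kerweight R _ N q n m ((x : Kn) - y) * f1 y)%:E)})
 (weight2 : forall m, {ae mu, forall x : T,
  mu.-integrable [set: T] (fun y => (@kerweight R _ N q n m ((x : Kn) - y) * f2 y)%:E)}).
Hypotheses (Phi1 : forall x, complex.Re (Phi x) = dd * potential mu kap f1 x)
  (Phi2 : forall x, complex.Im (Phi x) = dd * potential mu kap f2 x).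
Local Notation F nu := (frac_Kn_trunc q mu (q%:R ^- nu) alpha Phi).

Let mf1 : measurable_fun [set: T] f1. Proof. exact: phip.1.1. Qed.
Let mf2 : measurable_fun [set: T] f2. Proof. exact: phip.1.2. Qed.

Let ReH x z : complex.Re (hypersing_integrand abs alpha Phi x z) =
  (complex.Re (Phi z) - complex.Re (Phi x)) * h (z - x).
Proof. by rewrite /hypersing_integrand cRe_mulr cReB hE. Qed.

Let ImH x z : complex.Im (hypersing_integrand abs alpha Phi x z) =
  (complex.Im (Phi z) - complex.Im (Phi x)) * h (z - x).
Proof. by rewrite /hypersing_integrand cIm_mulr cImB hE. Qed.

Let ReF nu x : complex.Re (F nu x) = cc * dd * trunc_op q mu kap h f1 (- nu%:Z) x.
Proof.
rewrite /frac_Kn_trunc cRe_mull /cintegral /= uout_ball.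
under eq_Rintegral do rewrite ReH.
exact: (@trunc_part f1 (fun x => complex.Re (Phi x)) mf1 Phi1).
Qed.

Let ImF nu x : complex.Im (F nu x) = cc * dd * trunc_op q mu kap h f2 (- nu%:Z) x.
Proof.
rewrite /frac_Kn_trunc cIm_mull /cintegral /= uout_ball.
under eq_Rintegral do rewrite ImH.
exact: (@trunc_part f2 (fun x => complex.Im (Phi x)) mf2 Phi2).
Qed.

Lemma inversion_integrable (nu : nat) : \forall x \ae mu,
  cintegrable mu [set z | q%:R ^- nu <= N (z - x)] (hypersing_integrand abs alpha Phi x).
Proof.
apply: filterS2 (trunc_part_integrable (G := fun x => complex.Re (Phi x))
    mf1 pot1 weight1 Phi1 (- nu%:Z))
  (trunc_part_integrable (G := fun x => complex.Im (Phi x))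
    mf2 pot2 weight2 Phi2 (- nu%:Z)) => x i1 i2.
rewrite /cintegrable uout_ball; split.
  by under eq_fun do rewrite ReH.
by under eq_fun do rewrite ImH.
Qed.

Lemma inversion_cvg : cvg_Lp mu p (fun nu => F nu) phi.
Proof.
have ReD nu x : complex.Re (F nu x - phi x) =
    cc * dd * trunc_op q mu kap h f1 (- nu%:Z) x - f1 x by rewrite cReB ReF.
have ImD nu x : complex.Im (F nu x - phi x) =
    cc * dd * trunc_op q mu kap h f2 (- nu%:Z) x - f2 x by rewrite cImB ImF.
have fp1 := in_Lp_Re p1 phip; have fp2 := in_Lp_Im p1 phip.
apply: (cvg_Lp_ReIm p1) => [nu|nu|nu|e e0|e e0].
- split.
    under eq_fun do rewrite ReD.
    apply: measurable_funB => //; apply: measurable_funM; first exact: measurable_cst.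
    exact: (measurable_trunc_op hN mu hk mf1).
  under eq_fun do rewrite ImD.
  apply: measurable_funB => //; apply: measurable_funM; first exact: measurable_cst.
  exact: (measurable_trunc_op hN mu hk mf2).
- under eq_integral do rewrite ReD.
  exact: (trunc_op_lty n_gt0 hN muB hk p1 C0 CD mf1 fp1 pot1 weight1).
- under eq_integral do rewrite ImD.
  exact: (trunc_op_lty n_gt0 hN muB hk p1 C0 CD mf2 fp2 pot2 weight2).
- have [nu0 H] := trunc_op_cvg n_gt0 hN muB hk p1 C0 CD mf1 fp1 pot1 weight1 e0.
  by exists nu0 => nu nu0n; under eq_integral do rewrite ReD; exact: H.
- have [nu0 H] := trunc_op_cvg n_gt0 hN muB hk p1 C0 CD mf2 fp2 pot2 weight2 e0.
  by exists nu0 => nu nu0n; under eq_integral do rewrite ImD; exact: H.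
Qed.

Lemma inversion_representation (nu : nat) :
  kernel_representation mu (q%:R ^- nu) C' ker (F nu) phi.
Proof.
move=> s hs; have sm : abs s = q%:R ^ (- nu%:Z) by rewrite -invr_expz.
apply: filterS2 (representation_part mf1 pot1 weight1 sm)
  (representation_part mf2 pot2 weight2 sm) => x [i1 e1] [i2 e2].
split; first by split; [under eq_fun do rewrite cRe_mull|under eq_fun do rewrite cIm_mull].
apply/eqP; rewrite eq_complex; apply/andP; split; apply/eqP.
  rewrite ReF cRe_mull e1 /=; congr (_ * _); apply: eq_Rintegral => t _.
  by rewrite cRe_mull.
rewrite ImF cIm_mull e2 /=; congr (_ * _); apply: eq_Rintegral => t _.
by rewrite cIm_mull.
Qed.

End ComplexInversion.

(** * The power and logarithmic kernels *)

Lemma powR_expz (R : realType) (x b : R) (i : int) : 0 < x -> (x ^ i) `^ b = (x `^ b) ^ i.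
Proof.
move=> x0; rewrite -!powR_intmul ?powR_ge0 ?(ltW x0)//.
by rewrite -!powRrM mulrC.
Qed.

Lemma ltr_powR (R : realType) (x a b : R) : 1 < x -> (x `^ a < x `^ b) = (a < b).
Proof.
move=> x1; have x0 : 0 < x by rewrite (lt_trans ltr01).
by rewrite /powR gt_eqF// ltr_expR ltr_pM2r// ln_gt0.
Qed.

Section KernelIntegrability.
Context (R : realType) (V : zmodType) (N : V -> R) (q n : nat).
Hypothesis (n_gt0 : (0 < n)%N) (hN : ultranorm N q).
Local Notation T := (borel N).
Variable mu : {sigma_finite_measure set T -> \bar R}.
Hypothesis muB : forall k a, mu (uball N q k a) = ((q%:R ^+ n) ^ k)%:E.
Local Notation Q := (q%:R ^+ n : R).

Let q0 : 0 < q%:R :> R. Proof. exact: q_gt0 hN. Qed.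
Let Q0 : 0 < Q. Proof. exact: Q_gt0 n_gt0 hN. Qed.

Lemma powR_shell b i (x : T) : ushell N q i x -> N x `^ b = (q%:R `^ b) ^ i.
Proof. by move=> ->; rewrite powR_expz. Qed.

Lemma measurable_powR_un b : measurable_fun [set: T] (fun x : T => N x `^ b).
Proof. exact: (measurableT_comp (measurable_powR _) (measurable_un hN)). Qed.

Lemma powR_mulQ b : q%:R `^ b * Q = q%:R `^ (b + n%:R).
Proof. by rewrite powRD ?(gt_eqF q0) ?implybT// powR_mulrn// ltW. Qed.

Let expz_rec (r : R) i : 0 < r -> r ^ (i - 1) = r ^ i / r.
Proof. by move=> r0; rewrite expfzDr ?gt_eqF// exprN1. Qed.

(** Up to a constant the sphere of radius q^i contributes (q^(b + n))^i, a geometric progression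
    summable towards 0 exactly when b > - n. The integral over the complement of a ball is the case
    b < - n. *)
Lemma integral_powR_uball b j : - n%:R < b ->
  (\int[mu]_(x in uball N q j 0) (N x `^ b)%:E < +oo)%E.
Proof.
move=> nb; pose s : R := q%:R `^ b; have s0 : 0 < s by rewrite powR_gt0.
have r1 : 1 < s * Q.
  by rewrite powR_mulQ -[ltLHS](powRr0 q%:R) ltr_powR ?(q_gt1 hN)// -ltrBlDr sub0r.
have r0 : 0 < s * Q by rewrite (lt_trans ltr01).
pose F i := (s * Q) ^ i * ((1 - Q^-1) / (1 - (s * Q)^-1)).
rewrite (@integral_uball _ _ _ _ _ n_gt0 hN _ muB _ (fun i => s ^ i) F) ?ltry//.
- exact: measurable_powR_un.
- by move=> i _; rewrite exprz_ge0 ?ltW.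
- by move=> i x _; exact: powR_shell.
- move=> i _; rewrite /F !expz_rec// exprzMl ?unitfE ?gt_eqF//.
  move: (s ^ i) (Q ^ i) => si Qi; move: Q Q0 r0 r1 => Q' Q'0 r0 r1.
  by field; rewrite !gt_eqF//= ?subr_gt0.
- rewrite -[X in _ --> X](mul0r ((1 - Q^-1) / (1 - (s * Q)^-1))).
  by apply: cvgMl; exact: cvg_expzB.
Qed.

Lemma integral_powR_uout b j : b < - n%:R ->
  (\int[mu]_(x in uout N q j 0) (N x `^ b)%:E < +oo)%E.
Proof.
move=> nb; pose s : R := q%:R `^ b; have s0 : 0 < s by rewrite powR_gt0.
have r1 : s * Q < 1.
  by rewrite powR_mulQ -[ltRHS](powRr0 q%:R) ltr_powR ?(q_gt1 hN)// -ltrBrDr sub0r.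
have r0 : 0 < s * Q by rewrite mulr_gt0.
pose F i := (s * Q) ^ i * ((1 - Q^-1) / (1 - s * Q)).
rewrite (@integral_uout _ _ _ _ _ n_gt0 hN _ muB _ (fun i => s ^ i) F) ?ltry//.
- exact: measurable_powR_un.
- by move=> i _; rewrite exprz_ge0 ?ltW.
- by move=> i x _; exact: powR_shell.
- move=> i _; rewrite /F expz_rec// !expfzDr ?gt_eqF// expr1z exprzMl ?unitfE ?gt_eqF//.
  move: (s ^ i) (Q ^ i) => si Qi; move: Q Q0 r0 r1 => Q' Q'0 r0 r1.
  by field; rewrite !gt_eqF//= ?subr_gt0.
- rewrite -[X in _ --> X](mul0r ((1 - Q^-1) / (1 - s * Q))); apply: cvgMl.
  rewrite (_ : (fun m : nat => _) = (fun m : nat => (s * Q)^-1 ^ (- j - m%:Z))); last first.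
    by apply/funext => m; rewrite exprz_inv opprD !opprK.
  by apply: cvg_expzB; rewrite invf_gt1.
Qed.

(** The bound separates a part [G x] integrable for every x from a convolution of two integrable
    functions, which is finite for almost every x only. *)
Lemma integrable_kernel_ae (kap f g F : T -> R) (G : V -> T -> R) :
  measurable_fun [set: T] kap -> measurable_fun [set: T] f ->
  measurable_fun [set: T] g -> measurable_fun [set: T] F ->
  (forall x, measurable_fun [set: T] (G x)) ->
  (forall x, 0 <= g x) -> (forall x, 0 <= F x) -> (forall x y, 0 <= G x y) ->
  (\int[mu]_x (g x)%:E < +oo)%E -> (\int[mu]_x (F x)%:E < +oo)%E ->
  (forall x, \int[mu]_y (G x y)%:E < +oo)%E ->
  (forall x y : V, `|kap (x - y) * f y| <= G x y + g (x - y) * F y) ->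
  {ae mu, forall x : T, mu.-integrable [set: T] (fun y => (kap ((x : V) - y) * f y)%:E)}.
Proof.
move=> mk mf mg mF mG g0 F0 G0 gi Fi Gi le.
apply: filterS (conv_ae_finite hN muB mg mF g0 F0 gi Fi) => x gF.
have mkf : measurable_fun [set: T] (fun y : T => kap ((x : V) - y) * f y).
  by apply: measurable_funM => //; exact: (measurableT_comp mk (measurable_subl hN x)).
have mgF : measurable_fun [set: T] (fun y : T => (g ((x : V) - y) * F y)%:E).
  apply/measurable_EFinP; apply: measurable_funM => //.
  exact: (measurableT_comp mg (measurable_subl hN x)).
have mGE : measurable_fun [set: T] (fun y : T => (G x y)%:E) by exact/measurable_EFinP.
apply/integrableP; split; first exact/measurable_EFinP.
apply: (@le_lt_trans _ _ (\int[mu]_y ((G x y)%:E + (g ((x : V) - y) * F y)%:E))%E).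
  apply: ge0_le_integral => //.
  - by apply: measurableT_comp => //; exact/measurable_EFinP.
  - exact: emeasurable_funD.
  - by move=> y _; rewrite -EFinD lee_fin.
rewrite ge0_integralD//; first by rewrite lte_add_pinfty.
- by move=> y _; rewrite lee_fin.
- by move=> y _; rewrite lee_fin mulr_ge0.
Qed.

End KernelIntegrability.

Section PowerKernel.
Context (R : realType) (V : zmodType) (N : V -> R) (q n : nat).
Hypothesis (n_gt0 : (0 < n)%N) (hN : ultranorm N q).
Local Notation T := (borel N).
Variable alpha : R.
Hypothesis alpha_n : 0 < alpha < n%:R.
Local Notation Q := (q%:R ^+ n : R).
Local Notation A := (q%:R `^ alpha : R).
Local Notation b := (alpha - n%:R).

(* The sign makes the kernel increasing in N, as for the logarithm. *)
Definition power_kernel (x : T) : R := - N x `^ b.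
Definition power_kernel_shell (i : int) : R := - (q%:R `^ b) ^ i.

Let q0 : 0 < q%:R :> R. Proof. exact: q_gt0 hN. Qed.
Let q1 : 1 < q%:R :> R. Proof. exact: q_gt1 hN. Qed.
Let Q0 : 0 < Q. Proof. exact: Q_gt0 n_gt0 hN. Qed.
Let A0 : 0 < A. Proof. exact: powR_gt0. Qed.

Lemma powR_AQ : q%:R `^ b = A / Q.
Proof. by rewrite powRB ?(gt_eqF q0) ?implybT// powR_mulrn// ltW. Qed.

Lemma powR_base_gt1 : 1 < A.
Proof. by rewrite -[ltLHS](powRr0 q%:R) ltr_powR//; case/andP: alpha_n. Qed.

Lemma powR_base_lt : A < Q.
Proof. by rewrite -powR_mulrn ?ltW// ltr_powR//; case/andP: alpha_n. Qed.

Lemma radial_kernel_power :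
  radial_kernel N q n A (1 - A / Q) power_kernel_shell power_kernel
    (fun t => N t `^ (- (n%:R + alpha))).
Proof.
split.
- exact: powR_base_gt1.
- exact: ltW powR_base_lt.
- by rewrite subr_gt0 ltr_pdivrMr// mul1r powR_base_lt.
- move=> i; rewrite /power_kernel_shell expfzDr ?gt_eqF ?powR_gt0// expr1z powR_AQ.
  rewrite exprzMl ?unitfE ?invr_eq0 ?gt_eqF// exprz_inv -invr_expz; ring.
- by apply: measurableT_comp => //; exact: (measurable_powR_un hN).
- by move=> i x xi; rewrite /power_kernel (powR_shell hN _ xi).
- exact: (measurable_powR_un hN).
- move=> i x xi; rewrite (powR_shell hN _ xi) powRN powRD ?(gt_eqF q0) ?implybT//.
  rewrite powR_mulrn ?ltW// exprz_inv -invr_expz exprzMl ?unitfE ?gt_eqF//.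
  by rewrite invfM mulrC.
Qed.

(** In units of Q^(- m) the constants are - (1 - 1 / Q) / (1 - 1 / A) from [kerc] and (1 - A / Q) /
    (A - 1) from [kerd]; they add up to - 1. The sign is that of [power_kernel]. *)
Lemma power_kerval m (u : T) (t : R) : 0 <= t -> N u = q%:R ^ m * t ->
  kerval q n A (1 - A / Q) power_kernel_shell power_kernel m u =
  - (Q ^ m)^-1 * (if t < 1 then
      1 - (1 - Q^-1) / (1 - q%:R `^ (- alpha)) * t `^ b else 0).
Proof.
move=> t0 ut; have qm := qX_gt0 hN m.
rewrite /kerval ut gtr_pMr//; case: ifPn => _; last by rewrite mulr0.
rewrite /kerc /kerd /power_kernel /power_kernel_shell ut powRM ?(ltW qm)//.
rewrite powR_expz// powRN powR_AQ exprzMl ?unitfE ?invr_eq0 ?gt_eqF// exprz_inv -invr_expz.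
have := powR_base_gt1; have : 0 < A ^ m by rewrite exprz_gt0.
have : 0 < Q ^ m by rewrite exprz_gt0.
move: (A ^ m) (Q ^ m) (t `^ b) A A0 (Q) Q0 => Am Qm tb A' A'0 Q' Q'0 Qm0 Am0 A'1.
by field; rewrite !gt_eqF//= subr_gt0.
Qed.

Variable mu : {sigma_finite_measure set T -> \bar R}.
Hypothesis muB : forall k a, mu (uball N q k a) = ((q%:R ^+ n) ^ k)%:E.
Variable p : R.
Hypothesis pn : 1 <= p < n%:R / alpha.

Let p1 : 1 <= p. Proof. by case/andP: pn. Qed.
Let a0 : 0 < alpha. Proof. by case/andP: alpha_n. Qed.
Let b0 : b < 0. Proof. by rewrite subr_lt0; case/andP: alpha_n. Qed.

(** Young's inequality with the dual exponent p': N^(b p') is integrable at infinity because p < n /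
    alpha. For p = 1 the dual exponent is infinite, and N^b <= 1 outside the unit ball is enough. *)
Lemma power_tail : exists2 w : T -> R, measurable_fun [set: T] w /\ (forall x, 0 <= w x) &
  (\int[mu]_x (w x)%:E < +oo)%E /\
  forall (u : T) (t : R), 0 <= t -> uout N q 1 0 u -> N u `^ b * t <= w u + t `^ p.
Proof.
have [pE|pne] := eqVneq p 1.
  exists (fun=> 0); split=> //; first by rewrite integral0.
  move=> u t t0; rewrite /uout/= subr0 expr1z => qu.
  rewrite pE powRr1// add0r -[leRHS]mul1r ler_wpM2r//.
  rewrite -[leRHS](powRr0 (N u)) ltW// ltr_powR//; exact: lt_le_trans q1 qu.
have p1' : 1 < p by rewrite lt_neqAle eq_sym pne.
pose p' := p / (p - 1); have p'0 : 0 < p' by rewrite divr_gt0 ?subr_gt0// (lt_trans ltr01).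
have bp' : b * p' < - n%:R.
  have pa : p * alpha < n%:R by rewrite -ltr_pdivlMr//; case/andP: pn.
  (* With b = alpha - n, the inequality b p < - n (p - 1) amounts to p alpha < n. *)
  rewrite /p' mulrA ltr_pdivrMr ?subr_gt0//; rewrite mulrBl mulNr; lra.
have mE : measurable (uout N q 1 (0 : V)) by exact: (measurable_uout hN).
exists (fun u : T => N u `^ (b * p') * \1_(uout N q 1 0) u).
  split; last by move=> x; rewrite mulr_ge0 ?powR_ge0.
  by apply: measurable_funM; [exact: (measurable_powR_un hN)|exact: measurable_indic].
split.
  by rewrite integral_mul_indic// (integral_powR_uout n_gt0 hN muB).
move=> u t t0 uu; rewrite indicE mem_set// mulr1.
have pp : p'^-1 + p^-1 = 1 by rewrite /p'; field; rewrite subr_eq0 pne gt_eqF// (lt_trans ltr01).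
apply: le_trans (conjugate_powR (powR_ge0 _ _) t0 p'0 (lt_trans ltr01 p1') pp) _.
rewrite -powRrM; apply: lerD.
  rewrite ler_pdivrMr// ler_peMr ?powR_ge0// /p' ler_pdivlMr ?subr_gt0//; lra.
by rewrite ler_pdivrMr ?(lt_trans ltr01)// ler_peMr ?powR_ge0.
Qed.

Variable f : T -> R.
Hypotheses (mf : measurable_fun [set: T] f) (fp : (\int[mu]_x (`|f x| `^ p)%:E < +oo)%E).

(** In the unit ball N^b is integrable and |f| <= 1 + |f|^p: the 1 gives a finite integral for every
    x, and |f|^p an L^1 convolution. Outside it [power_tail] applies. *)
Lemma power_potential_ae : {ae mu, forall x : T,
  mu.-integrable [set: T] (fun y => (power_kernel ((x : V) - y) * f y)%:E)}.
Proof.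
have [w [mw w0] [wi hw]] := power_tail.
have mB : measurable (uball N q 0 (0 : V)) by exact: (measurable_uball hN).
pose g (u : T) := N u `^ b * \1_(uball N q 0 0) u.
have mg : measurable_fun [set: T] g.
  by apply: measurable_funM; [exact: (measurable_powR_un hN)|exact: measurable_indic].
have g0 u : 0 <= g u by rewrite mulr_ge0 ?powR_ge0.
have gi : (\int[mu]_x (g x)%:E < +oo)%E.
  rewrite integral_mul_indic//; apply: (integral_powR_uball n_gt0 hN muB).
  by rewrite ltrBrDr addNr.
have mF : measurable_fun [set: T] (fun y : T => `|f y| `^ p).
  by apply: (measurableT_comp (measurable_powR _)); exact: measurableT_comp.
have ms (e : T -> R) x : measurable_fun [set: T] e ->
    measurable_fun [set: T] (fun y : T => e ((x : V) - y)).
  by move=> me; exact: (measurableT_comp me (measurable_subl hN x)).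
pose G (x : V) (y : T) := g (x - (y : V)) + (w (x - (y : V)) + `|f y| `^ p).
apply: (integrable_kernel_ae hN muB (g := g) (F := fun y => `|f y| `^ p) (G := G)) => //.
- by apply: measurableT_comp => //; exact: (measurable_powR_un hN).
- by move=> x; apply: measurable_funD; [exact: ms|apply: measurable_funD => //; exact: ms].
- by move=> x y; rewrite !addr_ge0// powR_ge0.
- move=> x; under eq_integral do rewrite 2!EFinD.
  rewrite ge0_integralD//; last 4 first.
  + by move=> y _; rewrite lee_fin.
  + by apply/measurable_EFinP; exact: ms.
  + by move=> y _; rewrite -EFinD lee_fin addr_ge0// powR_ge0.
  + by apply: emeasurable_funD; apply/measurable_EFinP => //; exact: ms.
  rewrite ge0_integralD//; last 3 first.
  + by move=> y _; rewrite lee_fin.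
  + by apply/measurable_EFinP; exact: ms.
  + exact/measurable_EFinP.
  have r (e : T -> R) : measurable_fun [set: T] e -> (forall y, 0 <= e y) ->
      (\int[mu]_y (e ((x : V) - y))%:E = \int[mu]_y (e y)%:E)%E.
    move=> me e0; apply: (integral_reflect hN muB x (g := fun y => (e y)%:E)).
      exact/measurable_EFinP.
    by move=> y; rewrite lee_fin.
  by rewrite (r _ mg g0) (r _ mw w0); apply: lte_add_pinfty => //; exact: lte_add_pinfty.
- move=> x y; set u := x - y; set t := `|f y|.
  have t0 : 0 <= t by exact: normr_ge0.
  have tp : 0 <= t `^ p by exact: powR_ge0.
  rewrite normrM normrN (ger0_norm (powR_ge0 _ _)) -/t /G -/u -/t.
  have t1 : t <= 1 + t `^ p.
    have [tle|t1] := leP t 1; first by rewrite (le_trans tle)// lerDl.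
    by apply: ler_wpDl => //; rewrite -[leLHS]powRr1// ler_powR// ltW.
  have [ub|ub] := leP (N u) 1.
    have -> : g u = N u `^ b.
      by rewrite /g indicE mem_set ?mulr1// /uball/= subr0 expr0z.
    apply: (@le_trans _ _ (N u `^ b * (1 + t `^ p))).
      by apply: ler_wpM2l => //; exact: powR_ge0.
    by rewrite mulrDr mulr1 lerD2r lerDl addr_ge0.
  have uu : uout N q 1 0 u.
    have u0 : u <> 0 by move=> u0; move: ub; rewrite u0 (un0 hN) ltr10.
    have [i ui] := un_val hN u0; move: ub; rewrite /uout/= subr0 ui.
    by rewrite -(expr0z q%:R) (qX_lt hN) (qX_le hN) -gtz0_ge1.
  apply: le_trans (hw _ _ t0 uu) _.
  by rewrite -[leLHS]add0r -addrA lerD// lerDl mulr_ge0.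
Qed.

(** The weight is at most a constant times N^b on both branches: as b < 0, N^b is bounded below for
    N < q^m, and N^(- n) = N^(- alpha) N^b for N >= q^m. The integrability of the potential thus
    carries over. *)
Lemma power_weight_ae m : {ae mu, forall x : T,
  mu.-integrable [set: T] (fun y => (@kerweight R V N q n m ((x : V) - y) * f y)%:E)}.
Proof.
pose c1 : R := (q%:R ^ m) `^ (- b); pose c2 : R := (q%:R ^ m) `^ (- alpha).
have c10 : 0 <= c1 by exact: powR_ge0.
have c20 : 0 <= c2 by exact: powR_ge0.
apply: filterS power_potential_ae => x ix.
have i2 : mu.-integrable [set: T]
    (fun y : T => ((c1 + c2) * (power_kernel ((x : V) - y) * f y))%:E).
  by under eq_fun do rewrite EFinM; exact: integrableZl.
apply: integrable_ae_le i2 _.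
- apply: measurable_funM => //.
  exact: (measurableT_comp (measurable_kerweight n hN m) (measurable_subl hN x)).
- apply: filterS (ae_sub_neq0 n_gt0 hN muB x) => y u0.
  rewrite !normrM mulrA ler_wpM2r// normrN (ger0_norm (powR_ge0 _ _)).
  rewrite (ger0_norm (addr_ge0 c10 c20)).
  have Nu : 0 < N ((x : V) - y) by rewrite (un_gt0 hN); exact/eqP.
  move: Nu; rewrite /kerweight; set r := N _ => r0.
  have rb : 0 <= r `^ b by exact: powR_ge0.
  have qm := qX_gt0 hN m.
  rewrite mulrDl; case: ifPn => [rm|]; last rewrite -leNgt => mr.
    rewrite normr1; apply: (@le_trans _ _ (c1 * r `^ b)); last by rewrite lerDl mulr_ge0.
    rewrite -[b in r `^ b]opprK powRN -ler_pdivrMr ?invr_gt0 ?powR_gt0// mul1r invrK.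
    by rewrite ge0_ler_powR ?nnegrE ?oppr_ge0 ?ltW.
  have rn : 0 <= (r ^+ n)^-1 by rewrite invr_ge0 exprn_ge0// ltW.
  rewrite (ger0_norm rn).
  apply: (@le_trans _ _ (c2 * r `^ b)); last by rewrite lerDr mulr_ge0.
  have -> : (r ^+ n)^-1 = r `^ (- alpha) * r `^ b.
    by rewrite -powRD ?(gt_eqF r0) ?implybT// addKr powR_invn// ltW.
  apply: ler_wpM2r => //; rewrite /c2 !powRN lef_pV2 ?posrE ?powR_gt0//.
  by rewrite ge0_ler_powR ?nnegrE ?(ltW a0) ?(ltW qm) ?(ltW r0).
Qed.

End PowerKernel.

Section LogKernel.
Context (R : realType) (V : zmodType) (N : V -> R) (q n : nat).
Hypothesis (n_gt0 : (0 < n)%N) (hN : ultranorm N q).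
Local Notation T := (borel N).
Local Notation Q := (q%:R ^+ n : R).

Definition log_kernel (x : T) : R := ln (N x ^+ n).
Definition log_kernel_shell (i : int) : R := i%:~R * ln Q.

Let q0 : 0 < q%:R :> R. Proof. exact: q_gt0 hN. Qed.
Let q1 : 1 < q%:R :> R. Proof. exact: q_gt1 hN. Qed.
Let Q0 : 0 < Q. Proof. exact: Q_gt0 n_gt0 hN. Qed.
Let Q1 : 1 < Q. Proof. exact: Q_gt1 n_gt0 hN. Qed.

Lemma ln_expz (x : R) (i : int) : 0 < x -> ln (x ^ i) = i%:~R * ln x.
Proof. by move=> x0; rewrite -powR_intmul ?ltW// ln_powR. Qed.

Lemma ln_qX i : ln ((q%:R ^ i) ^+ n) = log_kernel_shell i.
Proof.
by rewrite lnXn ?(qX_gt0 hN)// ln_expz// /log_kernel_shell lnXn// mulrnAr.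
Qed.

Lemma measurable_log_kernel : measurable_fun [set: T] log_kernel.
Proof.
apply: (measurableT_comp (@measurable_ln R)); apply: measurable_funX.
exact: (measurable_un hN).
Qed.

Lemma radial_kernel_log :
  radial_kernel N q n Q (ln Q) log_kernel_shell log_kernel
    (fun t => N t `^ (- (n%:R + n%:R))).
Proof.
split=> //.
- exact: ln_gt0.
- move=> i; rewrite mulfK ?gt_eqF ?exprz_gt0//.
  by rewrite /log_kernel_shell intrD mulrDl mul1r.
- exact: measurable_log_kernel.
- by move=> i x xi; rewrite /log_kernel xi ln_qX.
- exact: (measurable_powR_un hN).
- move=> i x xi; rewrite (powR_shell hN _ xi) powRN powRD ?(gt_eqF q0) ?implybT//.
  by rewrite powR_mulrn ?ltW// exprz_inv -invr_expz exprzMl ?unitfE ?gt_eqF// invfM.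
Qed.

Lemma log_kerval m (u : T) (t : R) : 0 < t -> N u = q%:R ^ m * t ->
  kerval q n Q (ln Q) log_kernel_shell log_kernel m u =
  (Q ^ m)^-1 * (if t < 1 then ln Q / (Q - 1) - ln (t ^+ n) else 0).
Proof.
move=> t0 ut; have qm := qX_gt0 hN m.
rewrite /kerval ut gtr_pMr//; case: ifPn => _; last by rewrite mulr0.
rewrite /kerc /kerd /log_kernel ut exprMn lnM ?posrE ?exprn_gt0// ln_qX.
rewrite opprD addNKr divff ?mulr1; last by rewrite subr_eq0 eq_sym invr_eq1 gt_eqF.
by rewrite -mulrDr addrC.
Qed.

Variable mu : {sigma_finite_measure set T -> \bar R}.
Hypothesis muB : forall k a, mu (uball N q k a) = ((q%:R ^+ n) ^ k)%:E.

(** A bounded part in the ball, and outside it N^(e - beta) with e - beta < - n. The case e = 0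
    gives integrability of f, a positive e the room for the logarithm. *)
Lemma decay_integrable (f : T -> R) (M C beta e : R) (j : int) :
  measurable_fun [set: T] f ->
  {ae mu, forall t : T, N t <= q%:R ^ j -> `|f t| <= M} ->
  {ae mu, forall t : T, q%:R ^ j <= N t -> `|f t| <= C * N t `^ (- beta)} ->
  0 <= e < beta - n%:R ->
  (\int[mu]_t (N t `^ e * `|f t|)%:E < +oo)%E.
Proof.
move=> mf fM fC /andP[e0 eb].
have mB : measurable (uball N q j (0 : V)) by exact: (measurable_uball hN).
have mU : measurable (uout N q j (0 : V)) by exact: (measurable_uout hN).
pose a : R := (q%:R ^ j) `^ e * `|M|.
have a0 : 0 <= a by rewrite mulr_ge0 ?powR_ge0.
pose g1 (t : T) : R := a * \1_(uball N q j 0) t.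
pose g2 (t : T) : R := N t `^ (e - beta) * \1_(uout N q j 0) t.
have m1 : measurable_fun [set: T] g1.
  by apply: measurable_funM; [exact: measurable_cst|exact: measurable_indic].
have m2 : measurable_fun [set: T] g2.
  by apply: measurable_funM; [exact: (measurable_powR_un hN)|exact: measurable_indic].
have g10 t : 0 <= g1 t by rewrite mulr_ge0.
have g20 t : 0 <= g2 t by rewrite mulr_ge0 ?powR_ge0.
have mF : measurable_fun [set: T] (fun t : T => N t `^ e * `|f t|).
  by apply: measurable_funM; [exact: (measurable_powR_un hN)|exact: measurableT_comp].
apply: (@le_lt_trans _ _ (\int[mu]_t ((g1 t)%:E + `|C|%:E * (g2 t)%:E))%E).
  apply: ae_ge0_le_integral => //.
  - by move=> t _; rewrite lee_fin mulr_ge0 ?powR_ge0.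
  - exact/measurable_EFinP.
  - by move=> t _; rewrite -EFinM -EFinD lee_fin addr_ge0// mulr_ge0.
  - by apply: emeasurable_funD; [|apply: measurable_funeM]; exact/measurable_EFinP.
  - apply: filterS2 fM fC => t tM tC _; rewrite -EFinM -EFinD lee_fin.
    have [tj|jt] := leP (N t) (q%:R ^ j).
      apply: (@le_trans _ _ (g1 t)); last by rewrite lerDl mulr_ge0.
      rewrite /g1 indicE mem_set ?mulr1; last by rewrite /uball/= subr0.
      apply: ler_pM; rewrite ?powR_ge0//; last by rewrite (le_trans (tM tj)) ?ler_norm.
      by rewrite ge0_ler_powR ?nnegrE ?(un_ge0 hN) ?(ltW (qX_gt0 hN j)).
    have t0 : 0 < N t by rewrite (lt_trans _ jt)// (qX_gt0 hN).
    apply: (@le_trans _ _ (`|C| * g2 t)); last by rewrite lerDr.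
    rewrite /g2 indicE mem_set ?mulr1; last by rewrite /uout/= subr0 ltW.
    rewrite [e - beta]addrC powRD ?(gt_eqF t0) ?implybT// mulrA [leLHS]mulrC.
    apply: ler_wpM2r; first exact: powR_ge0.
    by rewrite (le_trans (tC (ltW jt)))// ler_wpM2r ?powR_ge0 ?ler_norm.
rewrite ge0_integralD//; last 4 first.
- by move=> t _; rewrite lee_fin.
- exact/measurable_EFinP.
- by move=> t _; rewrite -EFinM lee_fin mulr_ge0.
- by apply: measurable_funeM; exact/measurable_EFinP.
rewrite ge0_integralZl_EFin//; last 2 first.
- by move=> t _; rewrite lee_fin.
- exact/measurable_EFinP.
apply: lte_add_pinfty.
  rewrite (integral_mul_indic mu (fun=> a) mB) integral_cst// -[mu _]/(mu (uball N q j 0)).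
  by rewrite muB -EFinM ltry.
apply: lte_mul_pinfty => //; rewrite integral_mul_indic//.
by apply: (integral_powR_uout n_gt0 hN muB); lra.
Qed.

Variables (f : T -> R) (delta : R).
Hypothesis mf : measurable_fun [set: T] f.
Hypothesis fi : (\int[mu]_t `|f t|%:E < +oo)%E.
Hypothesis d0 : 0 < delta.
Hypothesis fd : (\int[mu]_t (N t `^ delta * `|f t|)%:E < +oo)%E.

(** From ln r = ln (r^delta) / delta and ln s < s. *)
Lemma log_le_powR (r : R) : 1 <= r -> `|ln (r ^+ n)| <= n%:R / delta * r `^ delta.
Proof.
move=> r1; have r0 : 0 < r by rewrite (lt_le_trans ltr01).
have l0 : 0 <= ln r by exact: ln_ge0.
rewrite lnXn// ger0_norm ?mulrn_wge0// -[ln r *+ n]mulr_natl -mulrA.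
apply: ler_wpM2l => //.
by rewrite mulrC ler_pdivlMr// mulrC -ln_powR ltW// ln_sublinear// powR_gt0.
Qed.

(** In the unit ball the logarithm is integrable and f is too, which gives an L^1 convolution.
    Outside, the logarithm is at most a multiple of N (x - y)^delta, and N (x - y) <= max (N x, N y)
    separates the variables: [f] is integrable against 1 and against N^delta. *)
Lemma log_potential_ae : {ae mu, forall x : T,
  mu.-integrable [set: T] (fun y => (log_kernel ((x : V) - y) * f y)%:E)}.
Proof.
have mB : measurable (uball N q 0 (0 : V)) by exact: (measurable_uball hN).
have mk := measurable_log_kernel.
pose g (u : T) := `|log_kernel_shell 0 - log_kernel u| * \1_(uball N q 0 0) u.
have mg : measurable_fun [set: T] g.
  apply: measurable_funM; last exact: measurable_indic.
  by apply: measurableT_comp => //; apply: measurable_funB => //; exact: measurable_cst.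
have g0 u : 0 <= g u by rewrite mulr_ge0.
have gi : (\int[mu]_x (g x)%:E < +oo)%E.
  rewrite integral_mul_indic//.
  by rewrite (integral_ball_abs_kernel n_gt0 hN muB radial_kernel_log) ltry.
have mF : measurable_fun [set: T] (fun y : T => `|f y|) by exact: measurableT_comp.
have mP := measurable_powR_un hN delta.
have mNF : measurable_fun [set: T] (fun y : T => N y `^ delta * `|f y|).
  exact: measurable_funM.
have c0 : 0 <= n%:R / delta by rewrite divr_ge0// ltW.
pose G (x : V) (y : T) := n%:R / delta * (N x `^ delta * `|f y| + N y `^ delta * `|f y|).
apply: (integrable_kernel_ae hN muB (g := g) (F := fun y => `|f y|) (G := G)) => //.
- move=> x; apply: measurable_funM; first exact: measurable_cst.
  by apply: measurable_funD => //; apply: measurable_funM => //; exact: measurable_cst.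
- by move=> x y; rewrite mulr_ge0// addr_ge0// mulr_ge0 ?powR_ge0.
- move=> x; have -> : (fun y => (G x y)%:E) = (fun y => (n%:R / delta)%:E *
      ((N x `^ delta)%:E * `|f y|%:E + (N y `^ delta * `|f y|)%:E))%E.
    by [].
  have mFE : measurable_fun [set: T] (fun y : T => `|f y|%:E) by exact/measurable_EFinP.
  have mNFE : measurable_fun [set: T] (fun y : T => (N y `^ delta * `|f y|)%:E).
    exact/measurable_EFinP.
  have nn y : (0 <= (N y `^ delta * `|f y|)%:E)%E by rewrite lee_fin mulr_ge0 ?powR_ge0.
  have nx y : (0 <= (N x `^ delta)%:E * `|f y|%:E)%E.
    by rewrite -EFinM lee_fin mulr_ge0 ?powR_ge0.
  rewrite ge0_integralZl_EFin//; last 2 first.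
  + by move=> y _; exact: adde_ge0 (nx y) (nn y).
  + by apply: emeasurable_funD => //; exact: measurable_funeM.
  rewrite ge0_integralD//; last exact: measurable_funeM.
  rewrite ge0_integralZl_EFin ?powR_ge0//.
  apply: lte_mul_pinfty => //; apply: lte_add_pinfty => //.
  by apply: lte_mul_pinfty => //; rewrite lee_fin powR_ge0.
- move=> x y; set u := x - y; rewrite normrM.
  have [ub|ub] := leP (N u) 1.
    have -> : g u = `|log_kernel u|.
      rewrite /g indicE mem_set ?mulr1; last by rewrite /uball/= subr0 expr0z.
      by rewrite /log_kernel_shell mul0r sub0r normrN.
    by rewrite lerDr mulr_ge0// addr_ge0// mulr_ge0 ?powR_ge0.
  apply: (@le_trans _ _ (G x y)); last by rewrite lerDl mulr_ge0.
  rewrite /G -mulrDl mulrA ler_wpM2r//.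
  apply: (le_trans (log_le_powR (ltW ub))); rewrite ler_wpM2l//.
  have Nxy : N u <= Num.max (N x) (N y).
    by rewrite /u (le_trans (un_ultra hN _ _))// (un_opp hN).
  apply: (@le_trans _ _ (Num.max (N x) (N y) `^ delta)).
    have mx0 : 0 <= Num.max (N x) (N y) by rewrite le_max (un_ge0 hN).
    by rewrite ge0_ler_powR ?nnegrE ?(un_ge0 hN) ?(ltW d0).
  by case: (leP (N x) (N y)) => _; rewrite ?lerDl ?lerDr powR_ge0.
Qed.

Lemma log_weight_ae m : {ae mu, forall x : T,
  mu.-integrable [set: T] (fun y => (@kerweight R V N q n m ((x : V) - y) * f y)%:E)}.
Proof.
have fint : mu.-integrable [set: T] (EFin \o f).
  by apply/integrableP; split; [exact/measurable_EFinP|].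
pose c : R := 1 + ((q%:R ^ m) ^+ n)^-1; have qm := qX_gt0 hN m.
have qn : 0 <= ((q%:R ^ m) ^+ n)^-1 :> R by rewrite invr_ge0 exprn_ge0// ltW.
have c0 : 0 <= c by rewrite addr_ge0.
apply/aeW => x.
have i2 : mu.-integrable [set: T] (fun y : T => (c * f y)%:E).
  by under eq_fun do rewrite EFinM; exact: integrableZl.
apply: integrable_ae_le i2 _.
- apply: measurable_funM => //.
  exact: (measurableT_comp (measurable_kerweight n hN m) (measurable_subl hN x)).
- apply/aeW => y; rewrite !normrM ler_wpM2r// (ger0_norm c0) /kerweight.
  set r := N _; have r0 : 0 <= r by exact: un_ge0 hN _.
  case: ifPn => [_|]; first by rewrite normr1 lerDl.
  rewrite -leNgt => mr; have rp : 0 < r by rewrite (lt_le_trans qm).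
  rewrite ger0_norm ?invr_ge0 ?exprn_ge0//.
  apply: (@le_trans _ _ ((q%:R ^ m) ^+ n)^-1); last by rewrite lerDr.
  by rewrite lef_pV2 ?posrE ?exprn_gt0// lerXn2r// nnegrE ltW.
Qed.

End LogKernel.

(** * Inversion of the two Riesz potentials *)

Section RieszInversion.
Context (R : realType) (K : fieldType) (abs : K -> R) (kbar : fieldType)
  (res : K -> kbar) (q n : nat).
Hypotheses (n_gt0 : (0 < n)%N) (hK : local_field abs res q).
Local Notation Kn := 'rV[K]_n.
Local Notation N := (@supnorm R K abs n).
Local Notation T := (borel N).
Variable mu : {sigma_finite_measure set T -> \bar R}.
Hypothesis muB : forall k a, mu (uball N q k a) = ((q%:R ^+ n) ^ k)%:E.
Local Notation Q := (q%:R ^+ n : R).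
Local Notation normc := (@ComplexField.Normc.normc R).

Let hN := supnorm_ultranorm n hK.
Let q0 : 0 < q%:R :> R. Proof. exact: q_gt0 hN. Qed.
Let q1 : 1 < q%:R :> R. Proof. exact: q_gt1 hN. Qed.
Let Q0 : 0 < Q. Proof. exact: Q_gt0 n_gt0 hN. Qed.
Let Q1 : 1 < Q. Proof. exact: Q_gt1 n_gt0 hN. Qed.

Lemma c_coefE alpha : c_coef q n alpha = (1 - q%:R `^ alpha) / (1 - (q%:R `^ alpha)^-1 * Q^-1).
Proof.
rewrite /c_coef powRD ?(gt_eqF q0) ?implybT// !powRN powR_mulrn// ltW//.
Qed.

Section power.
Variables (alpha p : R) (phi : Kn -> R[i]).
Hypotheses (alpha_n : 0 < alpha < n%:R) (pn : 1 <= p < n%:R / alpha).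
Hypothesis phip : in_Lp (mu : {measure set T -> \bar R}) p phi.

Local Notation A := (q%:R `^ alpha : R).
Let A1 : 1 < A. Proof. exact (powR_base_gt1 hN alpha_n). Qed.
Let AQ : A < Q. Proof. exact (powR_base_lt hN alpha_n). Qed.
Let p1 : 1 <= p. Proof. by case/andP: pn. Qed.
Let hk := radial_kernel_power n_gt0 hN alpha_n.
Let cE := c_coefE alpha.

Let dE : d_coef q n alpha = (1 - A^-1) / (1 - A / Q).
Proof. by rewrite /d_coef powRN (powR_AQ _ hN). Qed.

(** For 0 < alpha < n the constant c is negative and d is positive; the sign of [power_kernel] makes
    up for this. *)
Let C0 : 0 < c_coef q n alpha * - d_coef q n alpha.
Proof.
rewrite cE dE mulrN -mulNr -mulNr opprB.
have A0 : 0 < A by rewrite (lt_trans ltr01).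
have AiQi : A^-1 * Q^-1 < 1.
  by rewrite mulr_ilt1 ?invr_ge0 ?invf_lt1 ?(ltW A0) ?(ltW Q0).
apply: mulr_gt0; first by rewrite divr_gt0 ?subr_gt0.
by rewrite divr_gt0 ?subr_gt0 ?invf_lt1// ltr_pdivrMr ?mul1r.
Qed.

Let C'0 : c_coef q n alpha * d_coef q n alpha != 0.
Proof. by have := C0; rewrite mulrN oppr_gt0 => /lt_eqF ->. Qed.

Let CD : c_coef q n alpha * - d_coef q n alpha *
  ((1 - A / Q) / (A - 1) * ((1 - A^-1 * Q^-1) / (1 - A^-1))) = 1.
Proof.
rewrite cE dE; move: A (Q) A1 AQ Q1 => a Q' a1 aQ Q'1.
have a0 : 0 < a by rewrite (lt_trans ltr01).
have Q'0 : 0 < Q' by rewrite (lt_trans ltr01).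
have aQ1 : 1 < a * Q' by rewrite mulr_egt1.
by field; rewrite !gt_eqF//= ?subr_gt0.
Qed.

Let mker : measurable_fun [set: T] (riesz_kernel abs q alpha (n:=n) : T -> R).
Proof.
apply: measurable_fun_ifT => //.
- by apply: measurable_fun_ltr; [exact: (measurable_un hN)|exact: measurable_cst].
- apply: measurable_funB; first exact: measurable_cst.
  apply: measurable_funM; first exact: measurable_cst.
  exact: (measurable_powR_un hN).
Qed.

Let kerE m (u t : Kn) : t <> 0 -> N u = q%:R ^ m * N t ->
  c_coef q n alpha * - d_coef q n alpha *
    kerval q n A (1 - A / Q) (power_kernel_shell q n alpha)
      (@power_kernel R Kn N n alpha) m u =
  c_coef q n alpha * d_coef q n alpha * (Q ^ m)^-1 * riesz_kernel abs q alpha t.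
Proof.
move=> _ ut; rewrite (power_kerval n_gt0 hN alpha_n (supnorm_ge0 _ _) ut).
rewrite -/(riesz_kernel abs q alpha t) mulrA; congr (_ * _).
by rewrite !mulrN mulNr opprK.
Qed.

Let pot1 := power_potential_ae n_gt0 hN alpha_n muB pn phip.1.1 (in_Lp_Re p1 phip).
Let pot2 := power_potential_ae n_gt0 hN alpha_n muB pn phip.1.2 (in_Lp_Im p1 phip).
Let weight1 := power_weight_ae n_gt0 hN alpha_n muB pn phip.1.1 (in_Lp_Re p1 phip).
Let weight2 := power_weight_ae n_gt0 hN alpha_n muB pn phip.1.2 (in_Lp_Im p1 phip).

Let potE (f : T -> R) x : measurable_fun [set: T] f ->
  d_coef q n alpha * (\int[mu]_y (N (x - (y : Kn)) `^ (alpha - n%:R) * f y)) =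
  - d_coef q n alpha * potential mu (@power_kernel R Kn N n alpha) f x.
Proof.
move=> mf; rewrite mulNr -mulrN; congr (_ * _); rewrite -[RHS]mulN1r /potential -RintegralMl//.
  by apply: eq_Rintegral => y _; rewrite /power_kernel mulN1r mulNr opprK.
have mk := rk_measurable hk; apply: measurable_funM => //.
exact: (measurableT_comp mk (measurable_subl hN x)).
Qed.

Let Phi1 x : complex.Re (riesz q mu alpha phi x) =
  - d_coef q n alpha * potential mu (@power_kernel R Kn N n alpha)
     (fun y => complex.Re (phi y)) x.
Proof.
rewrite -potE; last exact: phip.1.1.
rewrite /riesz cRe_mull /cintegral /=; congr (_ * _); apply: eq_Rintegral => y _.
by rewrite /riesz_integrand cRe_mull.
Qed.

Let Phi2 x : complex.Im (riesz q mu alpha phi x) =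
  - d_coef q n alpha * potential mu (@power_kernel R Kn N n alpha)
     (fun y => complex.Im (phi y)) x.
Proof.
rewrite -potE; last exact: phip.1.2.
rewrite /riesz cIm_mull /cintegral /=; congr (_ * _); apply: eq_Rintegral => y _.
by rewrite /riesz_integrand cIm_mull.
Qed.

Lemma riesz_inversion :
  [/\ (\forall x \ae mu, cintegrable mu setT (riesz_integrand abs alpha phi x)),
      (forall nu : nat, \forall x \ae mu,
         cintegrable mu [set z | q%:R ^- nu <= N (z - x)]
           (hypersing_integrand abs alpha (riesz q mu alpha phi) x)),
      cvg_Lp mu p
        (fun nu => frac_Kn_trunc q mu (q%:R ^- nu) alpha (riesz q mu alpha phi)) phi
    & forall nu : nat,
      kernel_representation mu (q%:R ^- nu)
        (c_coef q n alpha * d_coef q n alpha) (riesz_kernel abs q alpha)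
        (frac_Kn_trunc q mu (q%:R ^- nu) alpha (riesz q mu alpha phi)) phi].
Proof.
split.
- have neg (f : T -> R) (x : Kn) :
      mu.-integrable [set: T] (fun y : T => (@power_kernel R Kn N n alpha (x - (y : Kn)) * f y)%:E) ->
      mu.-integrable [set: T] (fun y : T => (N (x - (y : Kn)) `^ (alpha - n%:R) * f y)%:E).
    move=> i; rewrite (_ : (fun y => _) =
      (fun y => (-1)%:E * (@power_kernel R Kn N n alpha (x - (y : Kn)) * f y)%:E)%E).
      exact: integrableZl.
    by apply/funext => y; rewrite -EFinM /power_kernel mulN1r mulNr opprK.
  apply: filterS2 pot1 pot2 => x /neg i1 /neg i2; split.
    by under eq_fun do rewrite /riesz_integrand cRe_mull.
  by under eq_fun do rewrite /riesz_integrand cIm_mull.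
- move=> nu.
  exact: (inversion_integrable n_gt0 hK muB hk erefl phip pot1 pot2 weight1 weight2 Phi1 Phi2).
- exact: (inversion_cvg n_gt0 hK muB hk p1 C0 CD erefl phip pot1 pot2 weight1 weight2 Phi1 Phi2).
- move=> nu; exact: (inversion_representation n_gt0 hK muB hk C0 C'0 erefl mker kerE
    phip pot1 pot2 weight1 weight2 Phi1 Phi2).
Qed.

End power.

Section log.
Variables (beta : R) (phi : Kn -> R[i]) (ker : Kn -> R).
Hypothesis nbeta : n%:R < beta.
Hypothesis phi_loc : Linfty_loc (mu : {measure set T -> \bar R}) phi.
Hypothesis phi_O : bigO_at_infty (mu : {measure set T -> \bar R}) beta phi.
Hypothesis kerlog : ker = (fun t => if N t < 1 then
  ln Q / (Q - 1) - ln (N t ^+ n) else 0).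

(** Half of the margin beta - n: [N^delta * phi] is still integrable, and [N^delta] dominates the
    logarithm at infinity. *)
Let delta := (beta - n%:R) / 2.
Let d0 : 0 < delta. Proof. by rewrite divr_gt0// subr_gt0. Qed.
Let mphi : cmeasurable (phi : T -> R[i]). Proof. exact: phi_loc.1. Qed.

Let decay (f : T -> R) (e : R) : measurable_fun [set: T] f ->
  (forall x, `|f x| <= normc (phi x)) -> 0 <= e < beta - n%:R ->
  (\int[mu]_t (N t `^ e * `|f t|)%:E < +oo)%E.
Proof.
move=> mf fphi eb; have [C [r hC']] := phi_O;
have hC : {ae mu, forall t : T, r <= N t -> normc (phi t) <= C * N t `^ (- beta)} := hC'.
(* A radius q^j beyond [r]: the decay estimate holds outside this ball and the local bound inside
   it. *)
have [j rj] := large_qX hN r.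
have [M hM'] := phi_loc.2 (q%:R ^ j%:Z).
have hM : {ae mu, forall t : T, N t <= q%:R ^ j%:Z -> normc (phi t) <= M} := hM'.
apply: (decay_integrable (M := M) (C := C) (j := j%:Z) n_gt0 hN muB mf _ _ eb).
- by apply: filterS hM => t h /h; exact: le_trans.
- apply: filterS hC => t h jt; apply: le_trans (fphi t) _; apply: h.
  by rewrite (le_trans _ jt)// ltW.
Qed.

Let decay0 (f : T -> R) : measurable_fun [set: T] f ->
  (forall x, `|f x| <= normc (phi x)) -> (\int[mu]_t `|f t|%:E < +oo)%E.
Proof.
move=> mf fphi; have := decay (e := 0) mf fphi.
rewrite lexx subr_gt0 nbeta => /(_ isT); under eq_integral do rewrite powRr0 mul1r.
by [].
Qed.

Let decayd (f : T -> R) : measurable_fun [set: T] f ->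
  (forall x, `|f x| <= normc (phi x)) ->
  (\int[mu]_t (N t `^ delta * `|f t|)%:E < +oo)%E.
Proof.
move=> mf fphi; apply: decay => //; rewrite (ltW d0)/= /delta.
by rewrite ltr_pdivrMr// mulr_natr mulr2n ltrDl subr_gt0.
Qed.

Let phip : in_Lp (mu : {measure set T -> \bar R}) 1 phi.
Proof.
split=> //; rewrite cLnormE invr1 poweRe1; last first.
  by apply: integral_ge0 => x _; rewrite lee_fin powR_ge0.
have mn : measurable_fun [set: T] (normc \o phi : T -> R) by exact: measurable_normc.
have -> : (\int[mu]_x (normc (phi x) `^ 1)%:E = \int[mu]_x `|(normc \o phi) x|%:E)%E.
  by apply: eq_integral => x _; rewrite powRr1 ?normc_ge0// ger0_norm// normc_ge0.
by apply: decay0 => // x; rewrite /= ger0_norm ?normc_ge0.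
Qed.

Let hk := radial_kernel_log n_gt0 hN.

Let cE : c_coef q n n%:R = (1 - Q) / (1 - Q^-1 * Q^-1).
Proof. by rewrite c_coefE powR_mulrn// ltW. Qed.

Let lnQ : 0 < ln Q. Proof. exact: ln_gt0. Qed.

Let C0 : 0 < c_coef q n n%:R * d_coef_log R q n.
Proof.
rewrite cE /d_coef_log -[1 - Q]opprB !mulNr mulrN opprK.
have QiQi : Q^-1 * Q^-1 < 1.
  by rewrite mulr_ilt1 ?invr_ge0 ?invf_lt1 ?(ltW Q0).
by rewrite mulr_gt0// divr_gt0 ?subr_gt0// mulr_gt0.
Qed.

Let C'0 : c_coef q n n%:R * d_coef_log R q n != 0.
Proof. by rewrite gt_eqF. Qed.

Let CD : c_coef q n n%:R * d_coef_log R q n *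
  (ln Q / (Q - 1) * ((1 - Q^-1 * Q^-1) / (1 - Q^-1))) = 1.
Proof.
rewrite cE /d_coef_log; move: (Q) Q1 (ln Q) lnQ => Q' Q'1 l l0.
have Q'0 : 0 < Q' by rewrite (lt_trans ltr01).
have QQ1 : 1 < Q' * Q' by rewrite mulr_egt1.
by field; rewrite !gt_eqF//= ?subr_gt0.
Qed.

Let mker : measurable_fun [set: T] (ker : T -> R).
Proof.
rewrite kerlog; apply: measurable_fun_ifT => //.
- by apply: measurable_fun_ltr; [exact: (measurable_un hN)|exact: measurable_cst].
- by apply: measurable_funB; [exact: measurable_cst|exact: (measurable_log_kernel n hN)].
Qed.

Let kerE m (u t : Kn) : t <> 0 -> N u = q%:R ^ m * N t ->
  c_coef q n n%:R * d_coef_log R q n *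
    kerval q n Q (ln Q) (log_kernel_shell R q n) (@log_kernel R Kn N n) m u =
  c_coef q n n%:R * d_coef_log R q n * (Q ^ m)^-1 * ker t.
Proof.
move=> t0 ut; have Nt : 0 < N t by rewrite (un_gt0 hN); exact/eqP.
by rewrite (log_kerval n_gt0 hN Nt ut) kerlog mulrA.
Qed.

Let Re_le x : `|complex.Re (phi x)| <= normc (phi x). Proof. exact: Re_le_normc. Qed.
Let Im_le x : `|complex.Im (phi x)| <= normc (phi x). Proof. exact: Im_le_normc. Qed.

Let pot1 := log_potential_ae n_gt0 hN muB mphi.1 (decay0 mphi.1 Re_le) d0 (decayd mphi.1 Re_le).
Let pot2 := log_potential_ae n_gt0 hN muB mphi.2 (decay0 mphi.2 Im_le) d0 (decayd mphi.2 Im_le).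
Let weight1 := log_weight_ae n hN mphi.1 (decay0 mphi.1 Re_le).
Let weight2 := log_weight_ae n hN mphi.2 (decay0 mphi.2 Im_le).

Let Phi1 x : complex.Re (riesz_log q mu phi x) =
  d_coef_log R q n * potential mu (@log_kernel R Kn N n) (fun y => complex.Re (phi y)) x.
Proof.
rewrite /riesz_log cRe_mull /cintegral /=; congr (_ * _); apply: eq_Rintegral => y _.
by rewrite /riesz_log_integrand cRe_mull.
Qed.

Let Phi2 x : complex.Im (riesz_log q mu phi x) =
  d_coef_log R q n * potential mu (@log_kernel R Kn N n) (fun y => complex.Im (phi y)) x.
Proof.
rewrite /riesz_log cIm_mull /cintegral /=; congr (_ * _); apply: eq_Rintegral => y _.
by rewrite /riesz_log_integrand cIm_mull.
Qed.

Lemma riesz_log_inversion :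
  [/\ (\forall x \ae mu, cintegrable mu setT (riesz_log_integrand abs phi x)),
      (forall nu : nat, \forall x \ae mu,
         cintegrable mu [set z | q%:R ^- nu <= N (z - x)]
           (hypersing_integrand abs n%:R (riesz_log q mu phi) x)),
      cvg_Lp mu 1
        (fun nu => frac_Kn_trunc q mu (q%:R ^- nu) n%:R (riesz_log q mu phi)) phi
    & forall nu : nat,
      kernel_representation mu (q%:R ^- nu)
        (c_coef q n n%:R * d_coef_log R q n) ker
        (frac_Kn_trunc q mu (q%:R ^- nu) n%:R (riesz_log q mu phi)) phi].
Proof.
split.
- apply: filterS2 pot1 pot2 => x i1 i2; split.
    by under eq_fun do rewrite /riesz_log_integrand cRe_mull.
  by under eq_fun do rewrite /riesz_log_integrand cIm_mull.
- move=> nu.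
  exact: (inversion_integrable n_gt0 hK muB hk erefl phip pot1 pot2 weight1 weight2 Phi1 Phi2).
- exact: (inversion_cvg n_gt0 hK muB hk (lexx 1) C0 CD erefl phip pot1 pot2 weight1 weight2 Phi1 Phi2).
- move=> nu; exact: (inversion_representation n_gt0 hK muB hk C0 C'0 erefl mker kerE
    phip pot1 pot2 weight1 weight2 Phi1 Phi2).
Qed.

End log.
End RieszInversion.

Theorem mainTheorem5 (R : realType) (q n : nat) (n_gt0 : (0 < n)%N)
    (K : fieldType) (absK : K -> R) (Kbar : fieldType) (resK : K -> Kbar)
    (localK : local_field absK resK q)
    (L : fieldExtType K) (absL : L -> R)
    (Lbar : fieldExtType Kbar) (resL : L -> Lbar)
    (unramL : unramified_extension absK resK absL resL q n)
    (e : n.-tuple L) (canon_e : canonical_basis absL resL e)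
    (mu : {measure set (borel (@supnorm R K absK n)) -> \bar R})
    (haar_mu : normalized_Haar mu)
    (muL : {measure set (borel absL) -> \bar R})
    (haar_muL : normalized_Haar muL) :
  (* (i) *)
  (forall alpha gamma : R, 0 < alpha -> gamma = alpha / n%:R ->
     [/\ basis_of {:L} e,
         linear (coordinates e),
         cancel (coordinates e) (of_coordinates e) /\
         cancel (of_coordinates e) (coordinates e),
         (forall x : L, supnorm absK (coordinates e x) = absL x `^ n%:R^-1)
       & forall (v : 'rV[K]_n -> R[i]) (x : L),
         (cintegrable muL setT
            (frac_L_integrand absL gamma (v \o coordinates e) x) <->
          cintegrable mu setT
            (hypersing_integrand absK alpha v (coordinates e x))) /\
         (cintegrable mu setT
            (hypersing_integrand absK alpha v (coordinates e x)) ->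
          frac_L q n muL gamma (v \o coordinates e) x =
          frac_Kn q mu alpha v (coordinates e x))]) /\
  (* (ii) *)
  (forall (alpha p : R) (phi : 'rV[K]_n -> R[i]),
     0 < alpha < n%:R -> 1 <= p < n%:R / alpha -> in_Lp mu p phi ->
     [/\ (\forall x \ae mu,
            cintegrable mu setT (riesz_integrand absK alpha phi x)),
         (forall nu : nat, \forall x \ae mu,
            cintegrable mu [set z | q%:R ^- nu <= supnorm absK (z - x)]
              (hypersing_integrand absK alpha (riesz q mu alpha phi) x)),
         cvg_Lp mu p
           (fun nu => frac_Kn_trunc q mu (q%:R ^- nu) alpha
                        (riesz q mu alpha phi)) phi
       & forall nu : nat,
         kernel_representation mu (q%:R ^- nu)
           (c_coef q n alpha * d_coef q n alpha)
           (riesz_kernel absK q alpha)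
           (frac_Kn_trunc q mu (q%:R ^- nu) alpha (riesz q mu alpha phi))
           phi]) /\
  (* (iii) *)
  (forall (beta : R) (phi : 'rV[K]_n -> R[i]),
     n%:R < beta -> Linfty_loc mu phi -> bigO_at_infty mu beta phi ->
     [/\ (\forall x \ae mu,
            cintegrable mu setT (riesz_log_integrand absK phi x)),
         (forall nu : nat, \forall x \ae mu,
            cintegrable mu [set z | q%:R ^- nu <= supnorm absK (z - x)]
              (hypersing_integrand absK n%:R (riesz_log q mu phi) x)),
         cvg_Lp mu 1
           (fun nu => frac_Kn_trunc q mu (q%:R ^- nu) n%:R
                        (riesz_log q mu phi)) phi
       & forall nu : nat,
         kernel_representation mu (q%:R ^- nu)
           (c_coef q n n%:R * d_coef_log R q n)
           (fun tau => riesz_log_kernel absL q n (of_coordinates e tau))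
           (frac_Kn_trunc q mu (q%:R ^- nu) n%:R (riesz_log q mu phi))
           phi]).
Proof.
have hN := supnorm_ultranorm n localK.
have muB := haar_uball localK haar_mu.
split; [|split].
- move=> alpha gamma a0 ga; split.
  + exact: (canonical_basis_basis localK unramL canon_e).
  + exact: coordinates_linear.
  + split.
      exact: (coordinatesK localK unramL canon_e).
    exact: (of_coordinatesK localK unramL canon_e).
  + exact: (supnorm_coordinates n_gt0 localK unramL canon_e).
  + move=> v x.
    exact: (frac_L_coordinates n_gt0 localK unramL canon_e haar_mu haar_muL v x a0 ga).
- have [nu mnu] := sigma_finite_measureP (uhaar_sigma_finite hN muB).
  (* From here on the Haar measure is the bundled sigma-finite one, as Fubini's theorem requires. *)
  subst mu; move=> alpha p phi an pn phip.
  exact: (riesz_inversion (mu := nu) n_gt0 localK muB an pn phip).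
- have [nu mnu] := sigma_finite_measureP (uhaar_sigma_finite hN muB).
  subst mu; move=> beta phi nbeta phi_loc phi_O.
  apply: (riesz_log_inversion (mu := nu) n_gt0 localK muB nbeta phi_loc phi_O).
  apply/funext => t.
  (* The kernel on L becomes radial on K^n through |tau|_L = N^n, which is less than 1 exactly when
     N is. *)
  rewrite /riesz_log_kernel (absL_coordinates n_gt0 localK unramL canon_e).
  by rewrite (of_coordinatesK localK unramL canon_e) expr_lt1 ?supnorm_ge0.
Qed.
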